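(* Let $L$ be a connected link diagram with a marked arc, and let $G$ be its Tait graph with a total order on its edges. Then the cohomology of the reduced spanning tree complex $(CST^+(G),\partial_{ST}^+)$ is isomorphic, as a bigraded abelian group, to the reduced Khovanov homology $Kh^+(L)$.
   Context: **Tait graph.** $L$ is an oriented connected link diagram, checkerboard coloured, with $n_+$ positive and $n_-$ negative crossings and a dot (marked point) on a fixed arc. The Tait graph $G$ is the plane graph with one vertex per black region and one edge per crossing, joining the black regions meeting there. An edge is positive if the $A$-smoothing of its crossing joins the two black regions, negative if it separates them. The edges of $G$ are totally ordered. **Activities.** Let $T$ be a spanning tree. For $e\in T$, $cut(T,e)$ is the set of edges of $G$ reconnecting $T\setminus e$; for $e\notin T$, $cyc(T,e)$ is the edge set of the unique cycle in $T\cup e$. An edge $e\in T$ is internally live if it is the smallest element of $cut(T,e)$, else internally dead; $e\notin T$ is externally live if it is the smallest element of $cyc(T,e)$, else externally dead. The activity letter of a positive edge is $L,D,l,d$ if it is internally live, internally dead, externally live, externally dead respectively; for negative edges the letters are $\bar L,\bar D,\bar l,\bar d$. **Khovanov complex.** For a spanning subgraph $H\subseteq G$, $F(H)$ is the disjoint union, over connected components $C$ of $H$, of the sets of faces of the plane graph $C$ (equivalently the boundary circles of a regular neighbourhood of $H$). An enhanced spanning subgraph is a pair $(H,\epsilon)$ with $\epsilon:F(H)\to\{1,x\}$. Put $i(H,\epsilon)=\#\{\text{positive edges}\notin H\}+\#\{\text{negative edges}\in H\}-n_-$ and $j(H,\epsilon)=i(H,\epsilon)+|\epsilon^{-1}(1)|-|\epsilon^{-1}(x)|+n_+-n_-$.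 $CKh(L)$ is the free bigraded $\mathbb Z$-module on enhanced spanning subgraphs. Let $A(H)=\{\text{positive edges in }H\}\cup\{\text{negative edges not in }H\}$. For $e\in A(H)$ let $H'_e$ be $H$ with $e$ removed (if positive) or added (if negative); then two faces merge or one splits. Set $\partial_{Kh}(H,\epsilon)=\sum_{e\in A(H)}(-1)^{w(e)}\sum_{\epsilon'}(H'_e,\epsilon')$, where $w(e)=\#\{f<e: f\notin A(H)\}$ and $\epsilon'$ agrees with $\epsilon$ on unaffected faces and is given on affected ones by $m(1,1)=1$, $m(1,x)=m(x,1)=x$, $m(x,x)=0$ (merge) and $\Delta(1)=1\otimes x+x\otimes 1$, $\Delta(x)=x\otimes x$ (split). $CKh^+(L)$ is spanned by the $(H,\epsilon)$ with $\epsilon=1$ on the face whose circle contains the dot; its differential $\partial^+_{Kh}$ is the component of $\partial_{Kh}$ mapping $CKh^+(L)$ to itself. $Kh^+(L)$ is its homology. **Subcomplexes for trees and the tree $G(T)$.** For a spanning tree $T$, the generators of $CKh^+(U(T))$ are the generators $(H,\epsilon)$ of $CKh^+(L)$ such that $H$ contains all internally dead and no externally dead edges of $T$ (the states of the twisted unknot $U(T)$ obtained from $L$ by smoothing the crossings of dead edges: $D,\bar d$ by $A$; $d,\bar D$ by $B$). Every generator of $CKh^+(L)$ lies in $CKh^+(U(T))$ for exactly one $T$. Let $H_c(T)$ consist of the internally dead and the externally live edges of $T$. $G(T)$ is the tree with vertex set $F(H_c(T))$ whose edges are the live edges of $T$, each joining the two faces that merge when that edge is toggled; its root $v_d$ is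 the face containing the dot. Spanning subgraphs $K$ of $G(T)$ correspond to the $H$ above: $H$ is $H_c(T)$ with the edges of $K$ toggled, and components of $K$ correspond to elements of $F(H)$. So generators are pairs $(K,\epsilon)$ with $\epsilon$ a labelling of components of $K$ by $1,x$. A live edge is a negative twist if its letter is $L$ or $\bar l$, and a positive twist if it is $\bar L$ or $l$. **The matching.** The matching on the generators for $G(T)$ is defined recursively. Let $e$ be the smallest edge incident to a degree-one vertex $v\neq v_d$ and let $v$ be that vertex. Each $(K,\epsilon)$ with $e\in K$, where $C_v$ is the component of $v$, is paired with $(K-e,\epsilon')$, where $\epsilon'(C_v-v)=\epsilon(C_v)$, $\epsilon'(\{v\})=x$ if $e$ is a negative twist and $\epsilon'(\{v\})=1$ if $e$ is a positive twist, and other labels are unchanged. The remaining generators have $v$ isolated with label $1$ (negative twist) or $x$ (positive twist); delete $v$ and apply the same rule to $G(T)\setminus v$. Exactly one generator $S_c^{T^+}$ is left unmatched: $K$ has no edges, $v_d$ has label $1$, and each vertex $v\ne v_d$ has label $1$ or $x$ according as the edge from $v$ towards $v_d$ is a negative or positive twist. $\mathcal M$ is the union over all $T$ of these matchings. **The spanning tree complex.** The Hasse diagram of $(CKh^+(L),\partial^+_{Kh})$ is the weighted directed graph on the generators with an edge $c\to c'$ of weight $[c:c']$ whenever the coefficient $[c:c']$ of $c'$ in $\partial^+_{Kh}c$ is nonzero. Let $\mathcal H_{\mathcal M}$ be obtained from it by replacing each matched edge $c\to c'$ by $c'\to c$ with weight $-1/[c:c']$. $\Gamma(c,c')$ is the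 sum over directed paths from $c$ to $c'$ in $\mathcal H_{\mathcal M}$ of the product of the edge weights. $CST^+(G)$ is the free $\mathbb Z$-module with one generator $T^+$ per spanning tree, with $i(T^+)=i(S_c^{T^+})$, $j(T^+)=j(S_c^{T^+})$, and $\partial_{ST}^+(T^+)=\sum_{i(T'^+)=i(T^+)+1}\Gamma(S_c^{T^+},S_c^{T'^+})\,T'^+$. *)

(* Defs.v *)
From HB Require Import structures.
From mathcomp Require Import all_boot all_order all_algebra.
From mathcomp Require Import boolp.

Set Implicit Arguments.
Unset Strict Implicit.
Unset Printing Implicit Defensive.

Import GRing.Theory Num.Theory.
Import Quotient.

Local Open Scope ring_scope.

Definition total_order (T : Type) (le : rel T) : Prop :=
  [/\ reflexive le, antisymmetric le, transitive le & total le].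

(* Finite multigraphs (loops and parallel edges allowed) on a set of         *)
(* vertices [vs], the edges being all of E, with endpoints [en].             *)

Section Multigraph.

Variables (V E : finType) (vs : {set V}) (en : E -> V * V).
Implicit Types (e f : E) (u v : V) (H T W C : {set E}).

Definition joins e u v : bool := (en e == (u, v)) || (en e == (v, u)).

Definition incident e v : bool := ((en e).1 == v) || ((en e).2 == v).

Definition adjacent H : rel V := fun u v => [exists e in H, joins e u v].

Definition degree W v : nat :=
  (#|[set e in W | (en e).1 == v]| + #|[set e in W | (en e).2 == v]|)%N.

Definition spans_connected H : bool :=
  [forall u in vs, forall v in vs, connect (adjacent H) u v].

(* C is the edge set of a closed walk v_0 e_0 v_1 e_1 ... v_0 with distinct  *)
(* vertices and distinct edges; its length is therefore at most #|E|.        *)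
Definition is_cycle C : bool :=
  [exists n : 'I_(#|E|.+1), exists p : n.-tuple (V * E),
    [&& tval p != [::], uniq (map fst p), uniq (map snd p),
        cycle (fun x y => joins x.2 x.1 y.1) p
      & C == [set e in map snd p]]].

Definition spanning_tree T : bool :=
  spans_connected T && [forall C, is_cycle C ==> ~~ (C \subset T)].

Definition cut T e : {set E} := [set f | spans_connected (f |: (T :\ e))].

(* For a spanning tree T and e \notin T the union has exactly one term.      *)
Definition cyc T e : {set E} :=
  \bigcup_(C : {set E} | is_cycle C && (C \subset e |: T)) C.

Section Activity.

Variable le : rel E.

Definition smallest e C : bool := (e \in C) && [forall f in C, le e f].

Definition int_live T : {set E} := [set e in T | smallest e (cut T e)].
Definition int_dead T : {set E} := [set e in T | ~~ smallest e (cut T e)].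
Definition ext_live T : {set E} := [set e in ~: T | smallest e (cyc T e)].
Definition ext_dead T : {set E} := [set e in ~: T | ~~ smallest e (cyc T e)].
Definition live T : {set E} := int_live T :|: ext_live T.

End Activity.

End Multigraph.

(* Oriented link diagrams, as planar-diagram (PD) codes.  The four ends at a *)
(* crossing are numbered counterclockwise, starting from the incoming end of *)
(* the lower strand; hence the lower strand runs from 0 to 2, and the upper  *)
(* strand from 3 to 1 at a positive crossing, from 1 to 3 at a negative one. *)
(* An arc meeting no crossing is a closed component.                         *)

Record diagram := Diagram {
  crossing : finType;
  link_arc : finType;
  arc_at : crossing -> 'I_4 -> link_arc;
  pos_crossing : pred crossing
}.

Notation end0 := (@Ordinal 4 0 isT).
Notation end1 := (@Ordinal 4 1 isT).
Notation end2 := (@Ordinal 4 2 isT).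
Notation end3 := (@Ordinal 4 3 isT).

Section Diagrams.

Variable D : diagram.
Implicit Types (c : crossing D) (a b : link_arc D) (k : 'I_4).

Definition outgoing c k : bool :=
  match val k with
  | 0%N => false
  | 1%N => pos_crossing c
  | 2%N => true
  | _ => ~~ pos_crossing c
  end.

Definition n_ends (out : bool) a : nat :=
  #|[set p : crossing D * 'I_4 |
      (arc_at p.1 p.2 == a) && (outgoing p.1 p.2 == out)]|.

Definition well_oriented : bool :=
  [forall a, (n_ends true a == n_ends false a) && (n_ends true a <= 1)%N].

Definition connected_diagram : bool :=
  [forall a, forall b,
    connect (fun a1 a2 => [exists c, exists k1, exists k2,
                            (arc_at c k1 == a1) && (arc_at c k2 == a2)]) a b].

(* A side of an arc, [true] being the left one for the orientation.          *)
Definition side := (link_arc D * bool)%type.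

(* Corner k of a crossing lies between its ends k and k+1; it is bordered by *)
(* the side [corner c k] of the former and [corner' c k] of the latter.      *)
Definition corner c k : side := (arc_at c k, outgoing c k).
Definition corner' c k : side := (arc_at c (ordS k), ~~ outgoing c (ordS k)).

Definition side_adj : rel side := fun s t =>
  [exists c, exists k, ((s, t) == (corner c k, corner' c k))
                    || ((t, s) == (corner c k, corner' c k))].

Definition region (s : side) : {set side} := [set t | connect side_adj s t].
Definition regions : {set {set side}} := [set region s | s : side].

(* Euler's formula #V - #E + #F = 2: a 4-valent graph has #E = 2 #V (this    *)
(* also covers the crossingless circle, which has two regions).              *)
Definition planar : bool := #|regions| == #|crossing D|.+2.

Definition connected_link_diagram : bool :=
  [&& well_oriented, connected_diagram & planar].

Definition n_plus : nat := #|[set c : crossing D | pos_crossing c]|.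
Definition n_minus : nat := #|[set c : crossing D | ~~ pos_crossing c]|.

Definition checkerboard (black : pred side) : Prop :=
  (forall s t, side_adj s t -> black s = black t) /\
  (forall a, black (a, true) = ~~ black (a, false)).

End Diagrams.

Notation lab1 := false (only parsing).
Notation labx := true (only parsing).

(* Coefficient of c in m(a, b), and of b (x) c in Delta(a).                  *)
Definition m_coef (a b c : bool) : int :=
  match a, b, c with
  | lab1, lab1, lab1 | lab1, labx, labx | labx, lab1, labx => 1
  | _, _, _ => 0
  end.

Definition Delta_coef (a b c : bool) : int :=
  match a, b, c with
  | lab1, lab1, labx | lab1, labx, lab1 | labx, labx, labx => 1
  | _, _, _ => 0
  end.

(* A free Z-module on a finite bigraded basis, with an endomorphism given by *)
(* its matrix: [coef b b'] is the coefficient of b' in the image of b.       *)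
Record based_complex := BasedComplex {
  basis : finType;
  hdeg : basis -> int;
  qdeg : basis -> int;
  coef : basis -> basis -> int
}.

Section Homology.

Variable K : based_complex.

Definition chain := {ffun basis K -> int}.

Definition differential (x : chain) : chain :=
  [ffun b' => \sum_b x b * coef b b'].

Definition is_complex : Prop :=
  (forall b b' : basis K, coef b b' != 0 ->
     hdeg b' = hdeg b + 1 /\ qdeg b' = qdeg b) /\
  (forall x : chain, differential (differential x) = 0).

Definition homogeneous (i j : int) (x : chain) : bool :=
  [forall b, (x b != 0) ==> (hdeg b == i) && (qdeg b == j)].

Fact differential_is_zmod_morphism : zmod_morphism differential.
Proof.
move=> x y; apply/ffunP=> b; rewrite !ffunE -sumrB.
by apply: eq_bigr => c _; rewrite !ffunE mulrBl.
Qed.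

HB.instance Definition _ :=
  GRing.isZmodMorphism.Build chain chain differential
    differential_is_zmod_morphism.

Lemma homogeneous_zmod_closed i j : zmod_closed (homogeneous i j).
Proof.
split=> [|x y /forallP hx /forallP hy]; apply/forallP=> b.
  by rewrite ffunE eqxx.
apply/implyP; rewrite !ffunE; apply: contraR => hb.
move: (hx b) (hy b); rewrite (negPf hb) !implybF !negbK.
by move=> /eqP-> /eqP->; rewrite subr0.
Qed.

Section Bidegree.

Variables i j : int.

Definition is_cocycle : {pred chain} :=
  [pred x | homogeneous i j x && (differential x == 0)].

Fact is_cocycle_zmod_closed : zmod_closed is_cocycle.
Proof.
have [h0 hB] := homogeneous_zmod_closed i j.
split=> [|x y]; first by rewrite inE raddf0 eqxx andbT; exact: h0.
rewrite !inE => /andP[hx /eqP dx] /andP[hy /eqP dy].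
by rewrite raddfB /= dx dy subrr eqxx andbT; exact: hB.
Qed.

HB.instance Definition _ :=
  GRing.isZmodClosed.Build chain is_cocycle is_cocycle_zmod_closed.

Record cocycle := Cocycle { cochain : chain; cochainP : cochain \in is_cocycle }.

HB.instance Definition _ := [isSub for cochain].
HB.instance Definition _ := [Choice of cocycle by <:].
HB.instance Definition _ := [SubChoice_isSubZmodule of cocycle by <:].

Definition is_coboundary : {pred cocycle} :=
  [pred z | `[< exists2 y, homogeneous (i - 1) j y
                             & cochain z = differential y >]].

Fact is_coboundary_zmod_closed : zmod_closed is_coboundary.
Proof.
have [h0 hB] := homogeneous_zmod_closed (i - 1) j.
split=> [|x y]; rewrite !inE.
  by apply/asboolP; exists 0; rewrite ?raddf0 //; exact: h0.
move=> /asboolP[u hu xu] /asboolP[v hv yv]; apply/asboolP.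
by exists (u - v); [exact: hB | rewrite raddfB /= -xu -yv].
Qed.

HB.instance Definition _ :=
  GRing.isZmodClosed.Build cocycle is_coboundary is_coboundary_zmod_closed.

Definition homology : zmodType := {quot is_coboundary}.

End Bidegree.

End Homology.

Definition bigraded_isomorphic_homology (K K' : based_complex) : Prop :=
  forall i j : int,
    exists f : {additive homology K i j -> homology K' i j}, bijective f.

Section Morse.

Variables (K : based_complex) (M : rel (basis K)).
Implicit Types c : basis K.

Definition hasse : rel (basis K) := fun c c' => coef c c' != 0.

(* The Hasse diagram with the edges in M reversed; matched coefficients are  *)
(* units of Z.                                                               *)
Definition rev_hasse : rel (basis K) := fun c c' =>
  (hasse c c' && ~~ M c c') || (hasse c' c && M c' c).

Definition rev_weight c c' : int :=
  if hasse c c' && ~~ M c c' then coef c c'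
  else if hasse c' c && M c' c then - (coef c' c)^-1
  else 0.

(* For M acyclic, no directed path has #|basis K| steps or more.             *)
Definition path_sum c c' : int :=
  \sum_(n < #|basis K|)
    \sum_(p : n.-tuple (basis K) | path rev_hasse c p && (last c p == c'))
      \prod_(s <- zip (c :: p) p) rev_weight s.1 s.2.

End Morse.

Section TaitGraph.

Variables (D : diagram) (black : pred (side D)).
Implicit Types (e : crossing D) (k : 'I_4) (a b : link_arc D).
Implicit Types (H T W : {set crossing D}).

Definition tait_vertices : {set {set side D}} :=
  [set region s | s in black].

(* Turning the upper strand (ends 1 and 3) counterclockwise sweeps corners 1 *)
(* and 3, which the A-smoothing therefore joins; at every crossing either    *)
(* these two corners are black, or corners 0 and 2 are.                      *)
Definition pos_edge e : bool := black (corner e end1).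

Definition tait_ends e : {set side D} * {set side D} :=
  if pos_edge e then (region (corner e end1), region (corner e end3))
  else (region (corner e end0), region (corner e end2)).

Definition A_edges H : {set crossing D} := [set e | (e \in H) == pos_edge e].

(* The crossings are smoothed so as to join the black corners of the edges   *)
(* in H and separate those of the other edges, i.e. A-smoothed on A_edges H: *)
(* end k is then connected to end [mate H e k].                              *)
Definition mate H e k : 'I_4 :=
  if odd k == (e \in A_edges H) then ord_pred k else ordS k.

(* The circles of this smoothing bound a regular neighbourhood of H; they    *)
(* are the faces of the components of H.  A circle is given by the set of    *)
(* arcs of D it runs through.                                                *)
Definition same_circle H : rel (link_arc D) :=
  connect (fun a b => [exists e, exists k,
                        (arc_at e k == a) && (arc_at e (mate H e k) == b)]).
Definition circle H a : {set link_arc D} := [set b | same_circle H a b].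
Definition faces H : {set {set link_arc D}} := [set circle H a | a : link_arc D].

(* Enhanced spanning subgraphs (H, eps): the labelling eps of faces is given *)
(* as a labelling of arcs which is constant on each face.                    *)
Definition preenhanced := ({set crossing D} * {ffun link_arc D -> bool})%type.

Definition is_enhanced (s : preenhanced) : bool :=
  [forall a, forall b, same_circle s.1 a b ==> (s.2 a == s.2 b)].

Definition enhanced := {s : preenhanced | is_enhanced s}.

Implicit Types s : enhanced.

Definition subgraph s : {set crossing D} := (val s).1.
Definition label s : {ffun link_arc D -> bool} := (val s).2.

Definition n_label s (l : bool) : nat :=
  #|[set C in faces (subgraph s) | [forall a in C, label s a == l]]|.

Definition i_deg s : int :=
  #|[set e | pos_edge e && (e \notin subgraph s)]|%:Z
  + #|[set e | ~~ pos_edge e && (e \in subgraph s)]|%:Z - (n_minus D)%:Z.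

Definition j_deg s : int :=
  i_deg s + (n_label s lab1)%:Z - (n_label s labx)%:Z
  + (n_plus D)%:Z - (n_minus D)%:Z.

Definition toggle H e : {set crossing D} :=
  if e \in H then H :\ e else e |: H.

Section Ordered.

Variables (le : rel (crossing D)) (dot : link_arc D).

Definition sign_exponent H e : nat :=
  #|[set f | [&& le f e, f != e & f \notin A_edges H]]|.

(* Ends 0 and 2 lie on different strands in both smoothings of e, so toggling *)
(* e affects the circles through these two ends: it merges them if they are  *)
(* distinct in H, and otherwise splits the circle containing both.           *)
Definition edge_coef s s' e : int :=
  let H := subgraph s in
  let: (a, b) := (arc_at e end0, arc_at e end2) in
  let unaffected c := ~~ same_circle H a c && ~~ same_circle H b c in
  if [&& e \in A_edges H, subgraph s' == toggle H e
       & [forall c, unaffected c ==> (label s' c == label s c)]]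
  then (-1) ^+ sign_exponent H e *
       (if same_circle H a b
        then Delta_coef (label s a) (label s' a) (label s' b)
        else m_coef (label s a) (label s b) (label s' a))
  else 0.

Definition CKh : based_complex :=
  @BasedComplex enhanced i_deg j_deg (fun s s' => \sum_e edge_coef s s' e).

Definition reduced := {s : enhanced | label s dot == lab1}.

Definition CKh_red : based_complex :=
  @BasedComplex reduced
    (fun r => i_deg (val r)) (fun r => j_deg (val r))
    (fun r r' => @coef CKh (val r) (val r')).

Definition is_tree T : bool := spanning_tree tait_vertices tait_ends T.

Definition T_int_dead T := int_dead tait_vertices tait_ends le T.
Definition T_ext_live T := ext_live tait_ends le T.
Definition T_ext_dead T := ext_dead tait_ends le T.
Definition T_live T := live tait_vertices tait_ends le T.

Definition in_subcomplex T s : bool :=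
  (T_int_dead T \subset subgraph s) && [disjoint T_ext_dead T & subgraph s].

Definition H_c T : {set crossing D} := T_int_dead T :|: T_ext_live T.

Definition GT_ends T e : {set link_arc D} * {set link_arc D} :=
  (circle (H_c T) (arc_at e end0), circle (H_c T) (arc_at e end2)).

Definition GT_root T : {set link_arc D} := circle (H_c T) dot.

(* For e live: its letter is L (e in T, positive) or l-bar (e not in T,      *)
(* negative); the other live edges are the positive twists.                  *)
Definition neg_twist T e : bool := (e \in T) == pos_edge e.

(* The subgraph K of G(T) to which s corresponds, for s in_subcomplex T. A   *)
(* component of K corresponds to the circle of s made of the arcs of all its *)
(* vertices, so its label is the value of [label s] on any of these arcs.    *)
Definition GT_subgraph T s : {set crossing D} :=
  [set e | (e \in subgraph s) != (e \in H_c T)].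

(* In what follows W is the edge set of the tree obtained from G(T) after    *)
(* deletion of some vertices.                                                *)
Definition leaf_edge T W e (v : {set link_arc D}) : bool :=
  [&& e \in W, v != GT_root T, incident (GT_ends T) e v
    & degree (GT_ends T) W v == 1%N].

Definition next_leaf T W e v : bool :=
  leaf_edge T W e v && [forall f, [exists u, leaf_edge T W f u] ==> le e f].

Definition paired T e (v : {set link_arc D}) s s' : bool :=
  [&& e \in GT_subgraph T s, GT_subgraph T s' == GT_subgraph T s :\ e
    & [forall a, label s' a ==
         if a \in v then (if neg_twist T e then labx else lab1) else label s a]].

Definition left_over T e (v : {set link_arc D}) s : bool :=
  (e \notin GT_subgraph T s) &&
  [forall a in v, label s a == if neg_twist T e then lab1 else labx].

Fixpoint tree_matching (n : nat) T W s s' : bool :=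
  if n is n'.+1 then
    [exists e, exists v, next_leaf T W e v &&
      (paired T e v s s' ||
       [&& left_over T e v s, left_over T e v s'
         & tree_matching n' T (W :\ e) s s'])]
  else false.

(* Each step deletes one edge, so #|T_live T| steps exhaust G(T).            *)
Definition matched_in T s s' : bool :=
  [&& in_subcomplex T s, in_subcomplex T s'
    & tree_matching #|T_live T| T (T_live T) s s'].

Definition matching : rel reduced := fun r r' =>
  [exists T, is_tree T &&
    (matched_in T (val r) (val r') || matched_in T (val r') (val r))].

(* e is the edge of G(T) from v towards the root.                            *)
Definition parent_edge T (v : {set link_arc D}) e : bool :=
  [&& e \in T_live T, incident (GT_ends T) e v
    & ~~ connect (adjacent (GT_ends T) (T_live T :\ e)) v (GT_root T)].

Definition critical_label T (v : {set link_arc D}) : bool :=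
  if (v != GT_root T) && [exists e, parent_edge T v e && ~~ neg_twist T e]
  then labx else lab1.

Definition critical_state T : preenhanced :=
  (H_c T, [ffun a => critical_label T (circle (H_c T) a)]).

Lemma same_circle_sym H : symmetric (same_circle H).
Proof.
apply: sym_connect_sym => a b; apply/existsP/existsP.
all: case=> e /existsP[k /andP[ka kb]]; exists e; apply/existsP.
all: exists (mate H e k); rewrite kb /=; suff -> : mate H e (mate H e k) = k by [].
all: rewrite /mate; case: (e \in _).
all: by case: k {ka kb} => -[|[|[|[|]]]] //= lt_k; apply/val_inj.
Qed.

Lemma circle_eq H a b : same_circle H a b -> circle H a = circle H b.
Proof.
move=> ab; apply/setP=> c; rewrite !inE.
exact: (same_connect (@same_circle_sym H) ab c).
Qed.

Fact critical_state_enhanced T : is_enhanced (critical_state T).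
Proof.
apply/forallP=> a; apply/forallP=> b; apply/implyP=> /= ab.
by rewrite !ffunE (circle_eq ab).
Qed.

Definition critical_enhanced T : enhanced := Sub _ (critical_state_enhanced T).

Fact critical_state_reduced T : label (critical_enhanced T) dot == lab1.
Proof. by rewrite /label /= ffunE /critical_label /GT_root eqxx. Qed.

Definition critical T : reduced :=
  exist (fun s : enhanced => label s dot == lab1) (critical_enhanced T)
    (critical_state_reduced T).

Definition tree := {T : {set crossing D} | is_tree T}.

Definition CST_red : based_complex :=
  @BasedComplex tree
    (fun t => i_deg (val (critical (val t))))
    (fun t => j_deg (val (critical (val t))))
    (fun t t' =>
       if i_deg (val (critical (val t'))) == i_deg (val (critical (val t))) + 1
       then @path_sum CKh_red matching (critical (val t)) (critical (val t'))
       else 0).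

End Ordered.

End TaitGraph.

(* Main.v *)
(* Idea. A smoothing is handled through the equivalence relation of lying on   *)
(* the same circle, for arcs. Orienting the arcs with a black region on their  *)
(* left, the circles are the cycles of a permutation, which a change of        *)
(* smoothing multiplies by a transposition; hence it always merges two circles *)
(* or splits one. In a planar diagram Euler's formula tells which case occurs: *)
(* the circles at the edge e of H differ exactly when e is in H and its ends   *)
(* are joined in H \ e, or e is not in H and its ends are not joined in H.     *)
(*                                                                             *)
(* The spanning trees cut the cube of subgraphs into intervals. At the largest *)
(* edge where the trees of two neighbouring subgraphs differ, this edge is     *)
(* dead for both and is the one being toggled, so that the differential        *)
(* decreases the trees lexicographically; and inside an interval the leaf by   *)
(* leaf construction of the matching provides a second decreasing quantity.    *)
(* The matching is therefore acyclic, its critical states are those of the     *)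
(* spanning trees, and algebraic Morse theory applies: with h the inverse of   *)
(* the matched block of the differential d, the idempotent chain map 1 - dh -  *)
(* hd is homotopic to the identity, its image is the complex of the critical   *)
(* states with differential d - dhd, and the entries of d - dhd are the sums   *)
(* over paths of degree 1.                                                     *)

Require Import Defs.
From HB Require Import structures.
From mathcomp Require Import fingroup perm.
From mathcomp Require Import all_boot all_order all_algebra.
From mathcomp Require Import boolp zify.

Set Implicit Arguments.
Unset Strict Implicit.
Unset Printing Implicit Defensive.

Import Order.TTheory GRing.Theory Num.Theory.
Import Quotient.

(** * Algebraic discrete Morse theory *)

Local Open Scope ring_scope.

Local Open Scope quotient_scope.

(** The proof applies algebraic discrete Morse theory to the relation [matching] on the reduced
    Khovanov complex. Four facts are needed: matched coefficients are units, partners are unique,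
    the unmatched states are exactly the critical ones, and a natural number drops along every edge
    of the Hasse diagram once the matched edges are reversed. The last fact makes the relevant
    matrices nilpotent, so a finite geometric series inverts the matched block, and sums over paths
    are entries of matrix powers. [sum_rev_mx] identifies them with the entries of d - dhd, and
    [morse_homology] concludes.

    The topology enters through one criterion, [same_circle_ends], which rests on Euler's formula
    and on [toggle_split]: a toggle always merges or splits circles. For a spanning tree T it shows
    that toggling live edges of T one after the other, starting from H_c(T), only merges circles
    ([twist_separated]). Toggling all of them gives T, whose neighbourhood has a single boundary
    circle ([cn_live]). Hence G(T) is a tree, and the matching can be analysed by stripping leaves.
    At a leaf v the pairing follows the term of Delta(y) in which v gets x, or the product m(1,y) =
    y; either way the coefficient is a sign ([paired_unit]). A state that is never paired has no
    edges and carries the critical labels ([unmatched_labels], [labels_unmatched]).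

    The decreasing number has two parts. Between different trees, [interval_toggle] shows that the
    toggled edge is the largest one where the trees differ, which gives a lexicographic decrease.
    Inside one tree, [level_decr] compares states leaf by leaf.

    That the Khovanov differential squares to zero is proved by writing states as square-free
    monomials in the arcs. Merging is then a quotient map, splitting is multiplication by a sum of
    two variables, and two surgeries commute ([local_coef_comm]). *)

Lemma eq_homologyP (K : based_complex) i j (z w : cocycle K i j) :
  reflect (exists2 y, homogeneous (i - 1) j y
                      & cochain z - cochain w = differential y)
    (\pi_(homology K i j) z == \pi_(homology K i j) w).
Proof.
rewrite -[_ == _]/(z == w %[mod (homology K i j)]).
rewrite -idealrBE inE; exact: asboolP.
Qed.

Section MapHomology.

Variables (K K' : based_complex) (f : {additive chain K -> chain K'}).
Hypothesis f_hom : forall i j x, homogeneous i j x -> homogeneous i j (f x).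
Hypothesis f_diff : forall x, f (differential x) = differential (f x).

Lemma map_cocycleP i j (z : cocycle K i j) : f (cochain z) \in @is_cocycle K' i j.
Proof.
case: z => z /=; rewrite !inE => /andP[hz /eqP dz].
by rewrite f_hom //= -f_diff dz raddf0.
Qed.

Definition map_cocycle i j (z : cocycle K i j) : cocycle K' i j :=
  Cocycle (map_cocycleP z).

Definition map_homology i j (q : homology K i j) : homology K' i j :=
  \pi_(homology K' i j) (map_cocycle (repr q)).

Lemma map_homology_pi i j (z : cocycle K i j) :
  map_homology (\pi_(homology K i j) z) = \pi_(homology K' i j) (map_cocycle z).
Proof.
apply/eqP/eq_homologyP; rewrite /=.
have /eqP/eq_homologyP[y hy dy] := reprK (\pi_(homology K i j) z).
by exists (f y); [exact: f_hom | rewrite -f_diff -dy raddfB].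
Qed.

Lemma map_homology_is_zmod_morphism i j : zmod_morphism (@map_homology i j).
Proof.
move=> p q; rewrite -[p]reprK -[q]reprK.
have piB (L : based_complex) (z w : cocycle L i j) :
    \pi_(homology L i j) z - \pi_(homology L i j) w = \pi_(homology L i j) (z - w).
  by rewrite !piE.
rewrite piB !map_homology_pi piB.
by congr (\pi_(homology K' i j) _); apply/val_inj; rewrite /= raddfB.
Qed.

HB.instance Definition _ i j :=
  GRing.isZmodMorphism.Build (homology K i j) (homology K' i j) (@map_homology i j)
    (@map_homology_is_zmod_morphism i j).

End MapHomology.

(** Homology only sees cocycles, on which the homotopy identity x - f (g x) = d h x + h d x loses
    its last term. The composite g f being the identity on chains, only f g calls for a homotopy. *)
Lemma homotopy_equivalence_homology (K K' : based_complex)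
    (f : {additive chain K -> chain K'}) (g : {additive chain K' -> chain K})
    (h : chain K' -> chain K') :
  (forall i j x, homogeneous i j x -> homogeneous i j (f x)) ->
  (forall i j x, homogeneous i j x -> homogeneous i j (g x)) ->
  (forall i j x, homogeneous i j x -> homogeneous (i - 1) j (h x)) ->
  (forall x, f (differential x) = differential (f x)) ->
  (forall x, g (differential x) = differential (g x)) ->
  (forall x, g (f x) = x) ->
  (forall x, differential x = 0 -> x - f (g x) = differential (h x)) ->
  bigraded_isomorphic_homology K K'.
Proof.
move=> f_hom g_hom h_hom f_diff g_diff fK gK i j.
exists (@map_homology _ _ f f_hom f_diff i j).
have piK (L : based_complex) (q : homology L i j) :
    exists z, q = \pi_(homology L i j) z by exists (repr q); rewrite reprK.
exists (@map_homology _ _ g g_hom g_diff i j) => q; have [z ->] := piK _ q.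
  rewrite [LHS]/= (map_homology_pi f_hom f_diff z) map_homology_pi.
  by congr (\pi_(homology K i j) _); apply/val_inj; rewrite /= fK.
rewrite [LHS]/= (map_homology_pi g_hom g_diff z) map_homology_pi.
apply/eqP; rewrite eq_sym; apply/eq_homologyP.
have /andP[hz /eqP dz] := cochainP z.
by exists (h (cochain z)); [exact: h_hom | exact: gK].
Qed.

Local Close Scope quotient_scope.

(** * Degrees and nilpotency of integer matrices *)

Section GradedMatrices.

Variables (n : nat) (hd qd : 'I_n -> int).
Implicit Types (A B : 'M[int]_n) (k l : int).

Definition graded k A : Prop :=
  forall i j, A i j != 0 -> hd j = hd i + k /\ qd j = qd i.

Lemma graded1 : graded 0 1.
Proof. by move=> i j; rewrite !mxE; case: (i =P j) => [->|]; rewrite ?addr0 ?eqxx. Qed.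

Lemma gradedD k A B : graded k A -> graded k B -> graded k (A + B).
Proof.
move=> gA gB i j; rewrite mxE; have [A0|/gA//] := eqVneq (A i j) 0.
by rewrite A0 add0r => /gB.
Qed.

Lemma gradedN k A : graded k A -> graded k (- A).
Proof. by move=> gA i j; rewrite mxE oppr_eq0 => /gA. Qed.

Lemma gradedM k l A B : graded k A -> graded l B -> graded (k + l) (A * B).
Proof.
move=> gA gB i j; rewrite mxE => nz.
have [m] : exists m, A i m * B m j != 0.
  apply/existsP; apply: contraNT nz; rewrite negb_exists => /forallP z.
  by rewrite big1 // => m _; apply/eqP; have := z m; rewrite negbK.
by rewrite mulf_eq0 negb_or => /andP[/gA[e1 e2] /gB[-> ->]]; rewrite e1 e2 addrA.
Qed.

Lemma graded_sumX (k : nat) A : graded 0 A -> graded 0 (\sum_(i < k) A ^+ i).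
Proof.
move=> gA; apply: big_ind => [i j|A1 A2|m _]; first by rewrite mxE eqxx.
- exact: gradedD.
- elim: (m : nat) => [|p IH]; first exact: graded1.
  by rewrite exprS; have := gradedM gA IH; rewrite addr0.
Qed.

End GradedMatrices.

Section Nilpotent.

Variables (n : nat) (rho : 'I_n -> nat) (A : 'M[int]_n).
Hypothesis rho_decr : forall i j, A i j != 0 -> (rho j < rho i)%N.

Lemma rank_decr (d : nat) i j : (A ^+ d) i j != 0 -> (d + rho j <= rho i)%N.
Proof.
elim: d i j => [|d IH] i j; first by rewrite expr0 mxE; case: (i =P j) => [->|].
rewrite exprS mxE => nz.
have [m] : exists m, A i m * (A ^+ d) m j != 0.
  apply/existsP; apply: contraNT nz; rewrite negb_exists => /forallP z.
  by rewrite big1 // => m _; apply/eqP; have := z m; rewrite negbK.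
rewrite mulf_eq0 negb_or => /andP[/rho_decr lt /IH le].
by rewrite addSn; apply: leq_ltn_trans le lt.
Qed.

End Nilpotent.

(** The exponent has to be the number of states, where [path_sum] is cut off. The given rank may
    take large values, so it is replaced by the number [r i] of states of smaller rank, which is
    less than n. *)
Lemma nilpotent_of_rank n (rho : 'I_n -> nat) (A : 'M[int]_n) :
  (forall i j, A i j != 0 -> (rho j < rho i)%N) -> A ^+ n = 0.
Proof.
move=> decr; pose r i := #|[set j | (rho j < rho i)%N]|.
apply/matrixP=> i j; rewrite [RHS]mxE; apply/eqP; apply: contraTT isT => nz.
have r_decr i1 j1 : A i1 j1 != 0 -> (r j1 < r i1)%N.
  move=> /decr lt; apply: proper_card; apply/properP; split.
    by apply/subsetP=> m; rewrite !inE => /ltn_trans; apply.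
  by exists j1; rewrite !inE ?ltnn.
have := rank_decr r_decr nz; have : (r i < n)%N.
  rewrite -[X in (_ < X)%N]card_ord -cardsT; apply: proper_card.
  by apply/properP; split; [apply/subsetP | exists i; rewrite !inE ?ltnn].
by rewrite ltnNge => /negP + le; case; apply: leq_trans le; rewrite leq_addr.
Qed.

Lemma geometric_inverse n (A : 'M[int]_n) : A ^+ n = 0 ->
  (1 - A) * (\sum_(i < n) A ^+ i) = 1 /\ (\sum_(i < n) A ^+ i) * (1 - A) = 1.
Proof.
move=> An; have e : (1 - A) * (\sum_(i < n) A ^+ i) = 1.
  by rewrite -opprB mulNr -subrX1 An sub0r opprK.
split=> //; rewrite -[RHS]e; apply/esym.
have cA : GRing.comm (1 - A) A by rewrite /GRing.comm mulrBl mulrBr mul1r mulr1.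
by apply: commr_sum => i _; apply: commrX.
Qed.

(* Gaussian elimination of a set of pairs (y, x) with x in X and y in Y, where *)
(* h is the inverse of the block of D from Y to X.  Matrices act on row        *)
(* vectors from the right.                                                     *)
Section Contraction.

Variables (R : pzRingType) (D h x y c Phi : R).
Hypotheses (xyc : x + y + c = 1) (xx : x * x = x) (yy : y * y = y).
Hypotheses (cc : c * c = c) (yx : y * x = 0) (cx : c * x = 0) (yc : y * c = 0).
Hypotheses (DD : D * D = 0) (xh : x * h = h) (hy : h * y = h).
Hypotheses (yDh : y * (D * h) = y) (hDx : h * D * x = x).
Hypothesis PhiE : Phi = 1 - D * h - h * D.

Lemma contraction_sq : h * h = 0.
Proof. by rewrite -{1}hy -xh -mulrA (mulrA y) yx mul0r mulr0. Qed.

Lemma contraction_hDh : h * D * h = h.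
Proof. by rewrite -{2}xh mulrA hDx xh. Qed.

Lemma Phi_comm : Phi * D = D * Phi.
Proof.
rewrite PhiE !mulrBl !mulrBr mulr1 mul1r -(mulrA h D D) DD mulr0 subr0.
by rewrite (mulrA D D h) DD mul0r subr0 mulrA.
Qed.

Lemma yPhi : y * Phi = 0.
Proof.
have yh : y * h = 0 by rewrite -xh mulrA yx mul0r.
by rewrite PhiE !mulrBr mulr1 yDh subrr mulrA yh mul0r subr0.
Qed.

Lemma Phix : Phi * x = 0.
Proof.
have hx : h * x = 0 by rewrite -hy -mulrA yx mulr0.
by rewrite PhiE !mulrBl mul1r hDx -mulrA hx mulr0 subr0 subrr.
Qed.

Lemma hc0 : h * c = 0. Proof. by rewrite -hy -mulrA yc mulr0. Qed.

Lemma ch0 : c * h = 0. Proof. by rewrite -xh mulrA cx mul0r. Qed.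

Lemma cPhic : c * Phi * c = c.
Proof.
rewrite PhiE !mulrBr !mulrBl mulr1 cc mulrA -(mulrA (c * D)) hc0 mulr0 subr0.
by rewrite mulrA ch0 !mul0r subr0.
Qed.

(** Since h h = 0 and h D h = h, the product h Phi vanishes. This kills both correction terms of the
    left factor, the second one after Phi has been moved across D. *)
Lemma Phi_idem : Phi * Phi = Phi.
Proof.
rewrite {1}PhiE !mulrBl mul1r -mulrA.
have hPhi : h * Phi = 0.
  by rewrite PhiE !mulrBr mulr1 !mulrA contraction_hDh subrr contraction_sq mul0r subr0.
by rewrite hPhi mulr0 subr0 -mulrA -Phi_comm mulrA hPhi mul0r subr0.
Qed.

(** Phi kills x on its right and y on its left, so c = 1 - x - y may be inserted between two copies
    of the idempotent: Phi factors through the critical states. *)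
Lemma PhicPhi : Phi * c * Phi = Phi.
Proof.
have -> : c = 1 - x - y by rewrite -xyc -[_ - y]addrA -opprD addrC addKr.
by rewrite !mulrBr mulr1 Phix subr0 mulrBl Phi_idem -mulrA yPhi mulr0 subr0.
Qed.

Lemma cDPhic : c * (D * Phi) * c = c * (D - D * h * D) * c.
Proof.
congr (_ * _ * _); rewrite PhiE !mulrBr mulr1 (mulrA D D h) DD mul0r subr0.
by rewrite mulrA.
Qed.

End Contraction.

Section DiagonalProjection.

Variable n : nat.
Implicit Types (p q : pred 'I_n) (A : 'M[int]_n).

Definition proj p : 'M[int]_n := \matrix_(i, j) ((i == j) && p i)%:R.

Lemma projMl p A i j : (proj p * A) i j = (p i)%:R * A i j.
Proof.
rewrite mxE (bigD1 i) //= mxE eqxx big1 ?addr0 // => k /negPf ki.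
by rewrite mxE eq_sym ki mul0r.
Qed.

Lemma projMr p A i j : (A * proj p) i j = A i j * (p j)%:R.
Proof.
rewrite mxE (bigD1 j) //= mxE eqxx big1 ?addr0 // => k /negPf kj.
by rewrite mxE kj mulr0.
Qed.

Lemma projM p q : proj p * proj q = proj (predI p q).
Proof.
by apply/matrixP=> i j; rewrite projMl !mxE /= -natrM mulnb andbCA.
Qed.

Lemma proj0 p : p =1 pred0 -> proj p = 0.
Proof. by move=> p0; apply/matrixP=> i j; rewrite !mxE p0 andbF. Qed.

Lemma eq_proj p q : p =1 q -> proj p = proj q.
Proof. by move=> pq; apply/matrixP=> i j; rewrite !mxE pq. Qed.

End DiagonalProjection.

(** * The matched block, its inverse and sums over paths *)

Section MatrixMorse.

Variables (n : nat) (hd qd : 'I_n -> int) (rho : 'I_n -> nat).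
Variables (D : 'M[int]_n) (M : rel 'I_n).
Hypotheses (gD : graded hd qd 1 D) (DD : D * D = 0).
Hypotheses (Msym : symmetric M) (Mfun : forall i j k, M i j -> M i k -> j = k).
Hypothesis Munit : forall i j, M i j -> D i j != 0 -> D i j \is a GRing.unit.
Hypothesis Mhasse : forall i j, M i j -> (D i j != 0) || (D j i != 0).

Definition rev_mx : 'M[int]_n := \matrix_(i, j)
  if (D i j != 0) && ~~ M i j then D i j
  else if (D j i != 0) && M j i then - (D j i)^-1 else 0.

Hypothesis rho_decr : forall i j, rev_mx i j != 0 -> (rho j < rho i)%N.

(** In a matched pair the differential leads from the Y-state to the X-state; the critical states
    have no partner. *)
Definition isX i := [exists j, M i j && (D j i != 0)].
Definition isY i := [exists j, M i j && (D i j != 0)].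
Definition isC i := ~~ [exists j, M i j].

Local Notation x := (proj isX).
Local Notation y := (proj isY).
Local Notation c := (proj isC).

Definition matched_mx : 'M[int]_n := \matrix_(i, j) if M i j then D i j else 0.
Definition unmatched_mx : 'M[int]_n := \matrix_(i, j) if M i j then 0 else D i j.
Definition inverse_mx : 'M[int]_n := \matrix_(i, j) if M i j then (D j i)^-1 else 0.

Local Notation P := matched_mx.
Local Notation D0 := unmatched_mx.
Local Notation U := inverse_mx.

Lemma D_asym i j : D i j != 0 -> D j i = 0.
Proof.
move=> nz; apply/eqP/negPn/negP => nz'.
have [e _] := gD nz; have [e' _] := gD nz'; lia.
Qed.

Lemma isXY i : isX i -> ~~ isY i.
Proof.
case/existsP=> j /andP[Mij nz]; apply/existsP=> -[k /andP[Mik]].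
by rewrite -(Mfun Mij Mik) (D_asym nz) eqxx.
Qed.

Lemma isXC i : isX i -> ~~ isC i.
Proof. by case/existsP=> j /andP[Mij _]; rewrite negbK; apply/existsP; exists j. Qed.

Lemma isYC i : isY i -> ~~ isC i.
Proof. by case/existsP=> j /andP[Mij _]; rewrite negbK; apply/existsP; exists j. Qed.

Lemma isC_N i : isC i = ~~ (isX i || isY i).
Proof.
apply/idP/idP => [Ci|].
  by apply/norP; split; apply/negP; [move/isXC | move/isYC]; rewrite Ci.
apply: contraNN => /existsP[j Mij].
by case/orP: (Mhasse Mij) => nz; apply/orP; [right|left]; apply/existsP; exists j; rewrite Mij.
Qed.

Lemma DE : D = D0 + P.
Proof. by apply/matrixP=> i j; rewrite !mxE; case: ifP; rewrite ?add0r ?addr0. Qed.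

Lemma rev_mxE : rev_mx = D0 - U.
Proof.
apply/matrixP=> i j; rewrite !mxE [M j i]Msym.
case Mij: (M i j); rewrite /= ?andbF ?andbT.
  by case: eqP => [->|] //=; rewrite sub0r ?invr0 ?oppr0.
by rewrite subr0; case: eqP => [->|].
Qed.

Lemma xyc1 : x + y + c = 1.
Proof.
apply/matrixP=> i j; rewrite !mxE isC_N; case: (i == j) => //=.
by have := @isXY i; case: (isX i); case: (isY i) => //= /(_ isT).
Qed.

Lemma yx0 : y * x = 0.
Proof.
by rewrite projM proj0 // => i /=; apply/negP => /andP[Y /isXY]; rewrite Y.
Qed.

Lemma cx0 : c * x = 0.
Proof.
by rewrite projM proj0 // => i /=; apply/negP => /andP[C /isXC]; rewrite C.
Qed.

Lemma yc0 : y * c = 0.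
Proof.
by rewrite projM proj0 // => i /=; apply/negP => /andP[/isYC/negP].
Qed.

Lemma proj_idem p : proj p * proj p = proj p :> 'M_n.
Proof. by rewrite projM; apply: eq_proj => i /=; rewrite andbb. Qed.

Lemma xU : x * U = U.
Proof.
apply/matrixP=> i j; rewrite projMl !mxE; case: ifP => Mij; last by rewrite mulr0.
have [->|nz] := eqVneq (D j i) 0; first by rewrite invr0 mulr0.
suff -> : isX i by rewrite mul1r.
by apply/existsP; exists j; rewrite Mij.
Qed.

Lemma Uy : U * y = U.
Proof.
apply/matrixP=> i j; rewrite projMr !mxE; case: ifP => Mij; last by rewrite mul0r.
have [->|nz] := eqVneq (D j i) 0; first by rewrite invr0 mul0r.
suff -> : isY j by rewrite mulr1.
by apply/existsP; exists i; rewrite Msym Mij.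
Qed.

Lemma Px : P * x = P.
Proof.
apply/matrixP=> i j; rewrite projMr !mxE; case: ifP => Mij; last by rewrite mul0r.
have [->|nz] := eqVneq (D i j) 0; first by rewrite mul0r.
suff -> : isX j by rewrite mulr1.
by apply/existsP; exists i; rewrite Msym Mij.
Qed.

Lemma yP : y * P = P.
Proof.
apply/matrixP=> i j; rewrite projMl !mxE; case: ifP => Mij; last by rewrite mulr0.
have [->|nz] := eqVneq (D i j) 0; first by rewrite mulr0.
suff -> : isY i by rewrite mul1r.
by apply/existsP; exists j; rewrite Mij.
Qed.

Lemma PU : P * U = y.
Proof.
apply/matrixP=> i j; rewrite !mxE.
have [|nY] := boolP (isY i); last first.
  rewrite andbF big1 // => k _; rewrite !mxE; case: ifP => Mik; last by rewrite mul0r.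
  have [->|nz] := eqVneq (D i k) 0; first by rewrite mul0r.
  by case/existsP: nY; exists k; rewrite Mik.
case/existsP=> k /andP[Mik nz]; rewrite (bigD1 k) //= big1 => [|l /negPf lk].
  rewrite addr0 !mxE Mik andbT; case: eqP => [<-|ne].
    by rewrite Msym Mik mulrV // Munit.
  case: ifP => [Mkj|]; last by rewrite mulr0.
  by case: ne; apply: (Mfun (i := k)); rewrite // Msym.
rewrite !mxE; case: ifP => [Mil|]; last by rewrite mul0r.
by move: lk; rewrite (Mfun Mik Mil) eqxx.
Qed.

Lemma UP : U * P = x.
Proof.
apply/matrixP=> i j; rewrite !mxE.
have [|nY] := boolP (isX i); last first.
  rewrite andbF big1 // => k _; rewrite !mxE; case: ifP => Mik; last by rewrite mul0r.
  have [->|nz] := eqVneq (D k i) 0; first by rewrite invr0 mul0r.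
  by case/existsP: nY; exists k; rewrite Mik.
case/existsP=> k /andP[Mik nz]; rewrite (bigD1 k) //= big1 => [|l /negPf lk].
  rewrite addr0 !mxE Mik andbT; case: eqP => [<-|ne].
    by rewrite Msym Mik mulVr // Munit // Msym.
  case: ifP => [Mkj|]; last by rewrite mulr0.
  by case: ne; apply: (Mfun (i := k)); rewrite // Msym.
rewrite !mxE; case: ifP => [Mil|]; last by rewrite mul0r.
by move: lk; rewrite (Mfun Mik Mil) eqxx.
Qed.

Lemma gD0 : graded hd qd 1 D0.
Proof. by move=> i j; rewrite mxE; case: ifP => // _; exact: gD. Qed.

Lemma gU : graded hd qd (-1) U.
Proof.
move=> i j; rewrite mxE; case: ifP; rewrite ?eqxx // => _; rewrite invr_eq0.
by case/gD => -> ->; rewrite addrK.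
Qed.

Lemma rho_D0 i j : D0 i j != 0 -> (rho j < rho i)%N.
Proof.
move=> nz; apply: rho_decr; move: nz; rewrite !mxE.
by case: ifP; rewrite ?eqxx //= andbT => _ nz; rewrite nz.
Qed.

Lemma rho_U i j : U i j != 0 -> (rho j < rho i)%N.
Proof.
move=> nz; apply: rho_decr; move: nz; rewrite !mxE.
case: ifP; rewrite ?eqxx // invr_eq0 => Mij nz.
by rewrite andbF nz [M j i]Msym Mij oppr_eq0 invr_eq0.
Qed.

Lemma rho_UD0 i j : (- (U * D0)) i j != 0 -> (rho j < rho i)%N.
Proof.
rewrite mxE oppr_eq0 mxE => nz.
have [k] : exists k, U i k * D0 k j != 0.
  apply/existsP; apply: contraNT nz; rewrite negb_exists => /forallP z.
  by rewrite big1 // => m _; apply/eqP; have := z m; rewrite negbK.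
rewrite mulf_eq0 negb_or => /andP[/rho_U lt /rho_D0 lt'].
exact: ltn_trans lt' lt.
Qed.

(** This is (1 + U D0)^-1 U. The block of D = P + D0 from Y to X is treated as a perturbation of its
    matched part P, whose inverse is U; the Neumann series is finite because [rho] drops along U and
    along D0. *)
Definition homotopy_mx : 'M[int]_n := (\sum_(i < n) (- (U * D0)) ^+ i) * U.
Local Notation h := homotopy_mx.

Lemma UD0_nilpotent : (- (U * D0)) ^+ n = 0.
Proof. exact: nilpotent_of_rank rho_UD0. Qed.

Lemma homotopy_fix : h = U - U * D0 * h.
Proof.
have [e _] := geometric_inverse UD0_nilpotent.
have e' : h + U * D0 * h = U by rewrite -[RHS]mul1r -e -[RHS]mulrA opprK mulrDl mul1r.
by rewrite -{1}e' addrK.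
Qed.

Lemma xh : x * h = h.
Proof. by rewrite homotopy_fix mulrBr !mulrA xU. Qed.

Lemma hy : h * y = h.
Proof. by rewrite -mulrA Uy. Qed.

Lemma yDh : y * (D * h) = y.
Proof.
rewrite DE mulrDl mulrDr (mulrA y P) yP {2}homotopy_fix mulrBr !mulrA PU.
by rewrite addrC subrK.
Qed.

Lemma hDx : h * D * x = x.
Proof.
have [_ e] := geometric_inverse UD0_nilpotent.
rewrite {1}DE mulrDr -[h * P]mulrA UP.
have -> : h * D0 = 1 - \sum_(i < n) (- (U * D0)) ^+ i.
  by rewrite -e opprK mulrDr mulr1 addrC addKr mulrA.
by rewrite mulrDl mulrBl mul1r -mulrA proj_idem subrK.
Qed.

Lemma g_homotopy : graded hd qd (-1) h.
Proof.
exact: (gradedM (l := -1) (graded_sumX (gradedN (gradedM gU gD0))) gU).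
Qed.

Lemma cU0 : c * U = 0. Proof. by rewrite -xU mulrA cx0 mul0r. Qed.

Lemma hU0 : h * U = 0.
Proof. by rewrite -hy -xU -mulrA (mulrA y) yx0 mul0r mulr0. Qed.

Lemma homotopy_fixr : h = U - h * D0 * U.
Proof.
have [_ e] := geometric_inverse UD0_nilpotent.
have e' : h + h * D0 * U = U.
  rewrite -[RHS]mul1r -e opprK -[RHS]mulrA mulrDl mul1r mulrDr.
  by rewrite -[X in _ + X]mulrA -[X in _ + X]mulrA !mulrA.
by rewrite -{1}e' addrK.
Qed.

Lemma rev_mx_nilpotent : rev_mx ^+ n = 0.
Proof. exact: nilpotent_of_rank rho_decr. Qed.

(** A step changes the degree by one, and the descending steps are reversed matched edges, from X to
    Y. A state of Y can only be left upwards, and a path to a critical state does not end in Y, so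
    each descent is made good before the end. *)
Lemma reach_critical (k : nat) i j : isC j -> (rev_mx ^+ k) i j != 0 ->
  hd i <= hd j /\ (isY i -> hd i < hd j).
Proof.
move=> Cj; elim: k i => [|k IH] i.
  rewrite expr0 mxE; case: (i =P j) => [-> _|//]; split=> // /isYC.
  by rewrite Cj.
rewrite exprS mxE => nz.
have [m] : exists m, rev_mx i m * (rev_mx ^+ k) m j != 0.
  apply/existsP; apply: contraNT nz; rewrite negb_exists => /forallP z.
  by rewrite big1 // => m _; apply/eqP; have := z m; rewrite negbK.
rewrite mulf_eq0 negb_or => /andP[nz1 /IH[le lt]].
move: nz1; rewrite rev_mxE !mxE; case: ifP => Mim; last first.
  by rewrite subr0 => /gD[e _]; split=> [|_]; lia.
rewrite sub0r oppr_eq0 invr_eq0 => nz1; have [e _] := gD nz1.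
have Ym : isY m by apply/existsP; exists i; rewrite Msym Mim.
have Xi : isX i by apply/existsP; exists m; rewrite Mim.
split=> [|Yi]; first by have := lt Ym; lia.
by have := isXY Xi; rewrite Yi.
Qed.

(** The series G counts all paths, and t counts the zigzags from a critical state back to its own
    degree. In c G = t + t D0 + t D0 D0 G only the middle term matters here: t preserves degrees,
    and by [reach_critical] a path that has climbed two degrees never comes back to a critical state
    one degree above the start. *)
Lemma sum_rev_mx i j : isC i -> isC j -> hd j = hd i + 1 ->
  (\sum_(k < n) rev_mx ^+ k) i j = (D - D * h * D) i j.
Proof.
move=> Ci Cj hij; set G := \sum_(k < n) _.
have [GR _] := geometric_inverse rev_mx_nilpotent; rewrite -/G rev_mxE in GR.
pose t := c * (1 - D0 * h).
have tU : t * U = 0 by rewrite -mulrA mulrBl mul1r -mulrA hU0 mulr0 subr0 cU0.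
have tc : t + t * D0 * U = c.
  have e : c * (D0 * h) = c * D0 * U - c * (D0 * h) * D0 * U.
    by rewrite {1}homotopy_fixr !mulrBr !mulrA.
  by rewrite /t mulrBr mulr1 !mulrBl -e subrK.
have tR : t * (1 + D0) * (1 - (D0 - U)) = c - t * D0 * D0.
  rewrite [LHS]mulrBr mulr1 (mulrDr t) mulr1 mulrDl !mulrBr tU subr0.
  by rewrite opprD addrA addrK opprB addrA tc.
have cG : c * G = t + t * D0 + t * D0 * D0 * G.
  move/(congr1 (fun A => A * G)): tR; rewrite -mulrA GR mulr1 mulrDr mulr1.
  by move->; rewrite mulrBl subrK.
have gt : graded hd qd 0 t.
  have gc : graded hd qd 0 c.
    by move=> a b; rewrite !mxE; case: (a =P b) => [->|]; rewrite ?addr0 ?eqxx.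
  have g1 := gradedN (gradedM gD0 g_homotopy).
  exact: (gradedM (k := 0) (l := 0) gc (gradedD (graded1 hd qd) g1)).
have cD : c * D = c * D0.
  rewrite DE mulrDr -yP mulrA; have -> : c * y = 0.
    by rewrite projM proj0 // => a /=; apply/negP => /andP[Ca /isYC]; rewrite Ca.
  by rewrite mul0r addr0.
have Dc : D * c = D0 * c.
  rewrite DE mulrDl -Px -(mulrA P); have -> : x * c = 0.
    by rewrite projM proj0 // => a /=; apply/negP => /andP[/isXC/negP].
  by rewrite mulr0 addr0.
have tD0c : t * D0 * c = c * (D - D * h * D) * c.
  rewrite mulrBr !mulrA !cD mulrBl -[c * D0 * c]mulrA -[_ * D * c]mulrA !Dc.
  by rewrite /t mulrBr mulr1 !mulrBl !mulrA.
have z1 : t i j = 0.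
  by apply/eqP/negPn/negP => /gt[]; rewrite hij; lia.
have z2 : (t * D0 * D0 * G) i j = 0.
  rewrite mxE big1 // => b _; apply/eqP/negPn/negP.
  rewrite mulf_eq0 negb_or => /andP[nz1 nz2].
  have [e _] : hd b = hd i + 1 + 1 /\ qd b = qd i.
    have := gradedM (gradedM gt gD0) gD0; rewrite add0r => /(_ _ _ nz1).
    by rewrite addrA.
  have [k] : exists k : 'I_n, (rev_mx ^+ k) b j != 0.
    apply/existsP; apply: contraNT nz2; rewrite negb_exists => /forallP z.
    by rewrite summxE big1 // => m _; apply/eqP; have := z m; rewrite negbK.
  by case/(reach_critical Cj) => le _; lia.
have := congr1 (fun A : 'M[int]_n => A i j) tD0c.
rewrite /= !projMr projMl Ci Cj !mulr1 !mul1r => <-.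
have := congr1 (fun A : 'M[int]_n => A i j) cG; rewrite /= projMl Ci mul1r => ->.
by rewrite mxE z2 addr0 mxE z1 add0r.
Qed.

End MatrixMorse.

Lemma big_tupleS (T : finType) k (F : k.+1.-tuple T -> int) :
  \sum_p F p = \sum_x \sum_(q : k.-tuple T) F [tuple of x :: q].
Proof.
rewrite pair_bigA /= (reindex (fun xq : T * k.-tuple T => [tuple of xq.1 :: xq.2])) //.
exists (fun p : k.+1.-tuple T => (thead p, [tuple of behead p])) => [[x q] _|p _] /=.
  by congr (_, _); apply/val_inj.
by rewrite [in RHS](tuple_eta p).
Qed.

Section PathWeights.

Variables (T : finType) (e : rel T) (w : T -> T -> int).
Hypothesis w_off : forall x y, ~~ e x y -> w x y = 0.

Definition weight_mx : 'M[int]_#|T| := \matrix_(i, j) w (enum_val i) (enum_val j).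

(** Weights vanish off the edges, so dropping the path condition only adds zero terms; what remains
    is the expansion of an entry of a matrix power. *)
Lemma sum_paths k x y :
  \sum_(p : k.-tuple T | path e x p && (last x p == y))
     \prod_(s <- zip (x :: p) p) w s.1 s.2
  = (weight_mx ^+ k) (enum_rank x) (enum_rank y).
Proof.
rewrite big_mkcond; elim: k x => [|k IH] x.
  rewrite (big_pred1 [tuple]) => [|p]; last by apply/esym/eqP/val_inj; case: p => -[].
  rewrite /= big_nil expr0 mxE (inj_eq enum_rank_inj).
  by case: (x == y).
rewrite big_tupleS exprS mxE [RHS](reindex _ (onW_bij _ (enum_rank_bij T))) /=.
apply: eq_bigr => z _; rewrite mxE !enum_rankK -IH big_distrr /=.
apply: eq_bigr => q _; rewrite big_cons /=.
have [_|/w_off ->] := boolP (e x z); last by rewrite !mul0r.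
by case: ifP => _; rewrite ?mulr0.
Qed.

End PathWeights.

Section MatrixAction.

Variables (B B' : finType).
Implicit Types (F : 'M[int]_(#|B|, #|B'|)) (x : {ffun B -> int}).

Definition mxapp F x : {ffun B' -> int} :=
  [ffun b' => \sum_b x b * F (enum_rank b) (enum_rank b')].

Fact mxapp_is_zmod_morphism F : zmod_morphism (mxapp F).
Proof.
move=> x y; apply/ffunP=> b; rewrite !ffunE -sumrB.
by apply: eq_bigr => c _; rewrite !ffunE mulrBl.
Qed.

HB.instance Definition _ F :=
  GRing.isZmodMorphism.Build {ffun B -> int} {ffun B' -> int} (mxapp F)
    (mxapp_is_zmod_morphism F).

Lemma mxappD F G x : mxapp (F + G) x = mxapp F x + mxapp G x.
Proof.
apply/ffunP=> b; rewrite !ffunE -big_split; apply: eq_bigr => c _.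
by rewrite mxE mulrDr.
Qed.

Lemma mxapp0 x : mxapp 0 x = 0.
Proof. by apply/ffunP=> b; rewrite !ffunE big1 // => c _; rewrite mxE mulr0. Qed.

End MatrixAction.

Lemma mxapp1 (B : finType) (x : {ffun B -> int}) : mxapp 1%:M x = x.
Proof.
apply/ffunP=> b; rewrite ffunE (bigD1 b) //= big1 => [|c /negPf cb].
  by rewrite mxE eqxx mulr1 addr0.
by rewrite mxE (inj_eq enum_rank_inj) cb mulr0.
Qed.

Lemma mxappM (B B' B'' : finType) (F : 'M[int]_(#|B|, #|B'|))
    (G : 'M[int]_(#|B'|, #|B''|)) x :
  mxapp (F *m G) x = mxapp G (mxapp F x).
Proof.
apply/ffunP=> b; rewrite !ffunE.
under [RHS]eq_bigr do rewrite ffunE big_distrl /=.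
rewrite exchange_big; apply: eq_bigr => c _ /=.
rewrite mxE big_distrr [LHS](reindex _ (onW_bij _ (enum_rank_bij B'))) /=.
by apply: eq_bigr => d _; rewrite mulrA.
Qed.

Lemma mxapp_homogeneous (K L : based_complex) (k : int)
    (F : 'M[int]_(#|basis K|, #|basis L|)) i j x :
  (forall b b', F (enum_rank b) (enum_rank b') != 0 ->
     hdeg b' = hdeg b + k /\ qdeg b' = qdeg b) ->
  @homogeneous K i j x -> @homogeneous L (i + k) j (mxapp F x).
Proof.
move=> gF /forallP hx; apply/forallP=> b'; apply/implyP; rewrite ffunE => nz.
have [b] : exists b, x b * F (enum_rank b) (enum_rank b') != 0.
  apply/existsP; apply: contraNT nz; rewrite negb_exists => /forallP z.
  by rewrite big1 // => b _; apply/eqP; have := z b; rewrite negbK.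
rewrite mulf_eq0 negb_or => /andP[xb /gF[-> ->]].
by have := hx b; rewrite xb => /andP[/eqP-> /eqP->]; rewrite !eqxx.
Qed.

(** * Transfer to based complexes *)

Section Morse.

Variables (K L : based_complex) (M : rel (basis K)) (rho : basis K -> nat).
Variable (crit : basis L -> basis K).
Hypothesis cK : is_complex K.
Hypotheses (Msym : symmetric M) (Mfun : forall b c d, M b c -> M b d -> c = d).
Hypothesis Munit : forall b c, M b c -> hasse b c -> coef b c \is a GRing.unit.
Hypothesis Mhasse : forall b c, M b c -> hasse b c \/ hasse c b.
Hypothesis rho_decr : forall b c, rev_hasse M b c -> (rho c < rho b)%N.
Hypothesis crit_inj : injective crit.
Hypothesis critP : forall b, (exists t, b = crit t) <-> (forall c, ~~ M b c).
Hypothesis crit_hdeg : forall t, hdeg (crit t) = hdeg t.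
Hypothesis crit_qdeg : forall t, qdeg (crit t) = qdeg t.
Hypothesis coefE : forall t t' : basis L, coef t t' =
  if hdeg t' == hdeg t + 1 then path_sum M (crit t) (crit t') else 0.

Local Notation n := #|basis K|.
Local Notation m := #|basis L|.

Let ev (i : 'I_n) : basis K := enum_val i.
Let hd i := hdeg (ev i).
Let qd i := qdeg (ev i).
Let D : 'M[int]_n := \matrix_(i, j) coef (ev i) (ev j).
Let Mx : rel 'I_n := fun i j => M (ev i) (ev j).
Let h : 'M[int]_n := homotopy_mx D Mx.
Let c : 'M[int]_n := proj (isC Mx).
Let S : 'M[int]_(m, n) := \matrix_(t, j) (ev j == crit (enum_val t))%:R.
Let Phi : 'M[int]_n := 1 - D * h - h * D.

Lemma D_graded : graded hd qd 1 D.
Proof. by move=> i j; rewrite mxE; apply: cK.1. Qed.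

Lemma differentialE x : differential x = mxapp D x.
Proof.
by apply/ffunP=> b; rewrite !ffunE; apply: eq_bigr => d _; rewrite mxE /ev !enum_rankK.
Qed.

Lemma DD0 : D * D = 0.
Proof.
apply/matrixP=> i j; have := cK.2 [ffun b => (b == ev i)%:R].
rewrite !differentialE -mxappM => /ffunP/(_ (ev j)); rewrite !ffunE.
rewrite (bigD1 (ev i)) //= big1 => [|b /negPf bi]; last by rewrite ffunE bi mul0r.
by rewrite ffunE eqxx mul1r addr0 /ev !enum_valK => ->; rewrite mxE.
Qed.

Lemma rev_mx_weight : rev_mx D Mx = weight_mx (rev_weight M).
Proof. by apply/matrixP=> i j; rewrite !mxE. Qed.

Lemma Mx_sym : symmetric Mx. Proof. by move=> i j; apply: Msym. Qed.

Lemma Mx_fun i j k : Mx i j -> Mx i k -> j = k.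
Proof. by move=> ij ik; apply/enum_val_inj/(Mfun ij ik). Qed.

Lemma Mx_unit i j : Mx i j -> D i j != 0 -> D i j \is a GRing.unit.
Proof. by rewrite mxE => ij nz; apply: Munit. Qed.

Lemma Mx_hasse i j : Mx i j -> (D i j != 0) || (D j i != 0).
Proof. by move=> /Mhasse; rewrite /hasse !mxE => -[] ->; rewrite ?orbT. Qed.

Lemma rho_rev_mx i j : rev_mx D Mx i j != 0 -> (rho (ev j) < rho (ev i))%N.
Proof.
rewrite rev_mx_weight mxE => nz; apply: rho_decr; move: nz.
rewrite /rev_weight /rev_hasse; case: ifP => //= _; case: ifP => //.
Qed.

Lemma isC_crit t : isC Mx (enum_rank (crit t)).
Proof.
apply/existsP => -[j]; rewrite /Mx /ev enum_rankK; apply/negP.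
by apply: (critP (crit t)).1; exists t.
Qed.

Lemma S_trS : S^T *m S = c.
Proof.
apply/matrixP=> i j; rewrite !mxE.
under eq_bigr do rewrite !mxE -natrM mulnb.
have [Ci|nC] := boolP (isC Mx i); last first.
  rewrite andbF big1 // => t _; case: eqP => // e.
  by case/negP: nC; rewrite -[i]enum_valK -/(ev i) e isC_crit.
have [|t et] := (critP (ev i)).2.
  move=> b; apply: contraNN Ci => Mb; apply/existsP; exists (enum_rank b).
  by rewrite /Mx /ev enum_rankK.
rewrite (bigD1 (enum_rank t)) //= big1 => [|s /eqP st].
  by rewrite addr0 enum_rankK -et eqxx (inj_eq enum_val_inj) andbT eq_sym.
case: eqP => //; rewrite et => /crit_inj ts; case: st.
by rewrite ts enum_valK.
Qed.

Lemma S_Str : S *m S^T = 1%:M.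
Proof.
apply/matrixP=> s t; rewrite !mxE.
under eq_bigr do rewrite !mxE -natrM mulnb.
rewrite (bigD1 (enum_rank (crit (enum_val s)))) //= big1 => [|j /eqP js].
  rewrite addr0 /ev enum_rankK eqxx (inj_eq crit_inj) (inj_eq enum_val_inj).
  by [].
case: eqP => // e; case: js.
by rewrite -e enum_valK.
Qed.

Lemma SmE k (A : 'M[int]_(n, k)) t j : (S *m A) t j = A (enum_rank (crit (enum_val t))) j.
Proof.
rewrite mxE (bigD1 (enum_rank (crit (enum_val t)))) //= big1 => [|i /eqP ne].
  by rewrite mxE /ev enum_rankK eqxx mul1r addr0.
rewrite mxE; case: eqP => [e|]; last by rewrite mul0r.
by case: ne; rewrite -e enum_valK.
Qed.

Lemma mStrE k (A : 'M[int]_(k, n)) i t :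
  (A *m S^T) i t = A i (enum_rank (crit (enum_val t))).
Proof.
rewrite mxE (bigD1 (enum_rank (crit (enum_val t)))) //= big1 => [|j /eqP ne].
  by rewrite !mxE /ev enum_rankK eqxx mulr1 addr0.
rewrite !mxE; case: eqP => [e|]; last by rewrite mulr0.
by case: ne; rewrite -e enum_valK.
Qed.

Let Phi_idemM : Phi *m c *m Phi = Phi.
Proof.
exact: (PhicPhi (xyc1 D_graded Mx_fun Mx_hasse) (yx0 D_graded Mx_fun) DD0
  (xh Mx_sym rho_rev_mx) (hy D Mx_sym) (yDh Mx_sym Mx_fun Mx_unit rho_rev_mx)
  (hDx Mx_sym Mx_fun Mx_unit rho_rev_mx) (erefl Phi)).
Qed.

Let Phi_idem2 : Phi *m Phi = Phi.
Proof.
exact: (Phi_idem (yx0 D_graded Mx_fun) DD0 (xh Mx_sym rho_rev_mx) (hy D Mx_sym)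
  (hDx Mx_sym Mx_fun Mx_unit rho_rev_mx) (erefl Phi)).
Qed.

Let Phi_commM : Phi *m D = D *m Phi.
Proof. exact: (Phi_comm DD0 (erefl Phi)). Qed.

Let cPhicM : c *m Phi *m c = c.
Proof.
exact: (cPhic (proj_idem _) (cx0 D Mx) (yc0 D Mx) (xh Mx_sym rho_rev_mx)
  (hy D Mx_sym) (erefl Phi)).
Qed.

Lemma Phi_graded : graded hd qd 0 Phi.
Proof.
have gh := @g_homotopy _ hd qd D Mx D_graded.
have g1 := gradedN (gradedM D_graded gh); have g2 := gradedN (gradedM gh D_graded).
exact: (gradedD (gradedD (graded1 hd qd) g1) g2).
Qed.

Let DL : 'M[int]_m := S *m (D *m Phi) *m S^T.

(** Outside consecutive degrees both sides vanish, D Phi being homogeneous of degree 1. In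
    consecutive degrees, D Phi compressed to the critical states is D - D h D, which [sum_rev_mx]
    and [sum_paths] read as a sum over paths. *)
Lemma coef_critical t t' : coef t t' = DL (enum_rank t) (enum_rank t').
Proof.
rewrite /DL mStrE SmE !enum_rankK coefE; set i := enum_rank _; set j := enum_rank _.
have hi : hd i = hdeg t by rewrite /hd /ev enum_rankK crit_hdeg.
have hj : hd j = hdeg t' by rewrite /hd /ev enum_rankK crit_hdeg.
have [e|ne] := eqVneq; last first.
  apply/esym/eqP; apply: contraNT ne => nz; apply/eqP; rewrite -hi -hj.
  by have [-> _] := gradedM D_graded Phi_graded nz; rewrite addr0.
have := congr1 (fun A : 'M[int]_n => A i j) (cDPhic c DD0 (erefl Phi)).
rewrite /= !projMr !projMl !isC_crit !mulr1 !mul1r => ->.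
rewrite -(sum_rev_mx D_graded Mx_sym Mx_fun rho_rev_mx) ?isC_crit ?hi ?hj //.
rewrite /path_sum summxE; apply: eq_bigr => k _.
rewrite rev_mx_weight -(sum_paths (e := rev_hasse M)) // => b d.
rewrite /rev_hasse /rev_weight negb_or => /andP[/negPf-> /negPf->].
by [].
Qed.

Lemma differential_critical x : differential x = mxapp DL x.
Proof. by apply/ffunP=> b; rewrite !ffunE; apply: eq_bigr => d _; rewrite coef_critical. Qed.

(** F and G are the two halves of a homotopy equivalence: F G = 1, while G F = Phi = 1 - D h - h
    D. *)
Let F : 'M[int]_(m, n) := S *m Phi.
Let G : 'M[int]_(n, m) := Phi *m S^T.

Lemma DL_F : DL *m F = F *m D.
Proof.
rewrite /DL /F -!mulmxA (mulmxA _ S) S_trS [Phi *m (c *m _)]mulmxA Phi_idemM.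
by rewrite -Phi_commM.
Qed.

Lemma D_G : D *m G = G *m DL.
Proof.
rewrite /DL /G !mulmxA -(mulmxA Phi) S_trS -(mulmxA _ D) -Phi_commM !mulmxA.
by rewrite Phi_idemM.
Qed.

Lemma F_G : F *m G = 1%:M.
Proof.
rewrite /F /G -mulmxA (mulmxA Phi) Phi_idem2 -S_Str.
have e : S *m c = S by rewrite -S_trS mulmxA S_Str mul1mx.
have e' : c *m S^T = S^T by rewrite -S_trS -mulmxA S_Str mulmx1.
have -> : S *m (Phi *m S^T) = S *m c *m (Phi *m (c *m S^T)) by rewrite e e'.
have -> : S *m c *m (Phi *m (c *m S^T)) = S *m (c *m Phi *m c) *m S^T.
  by rewrite !mulmxA.
by rewrite cPhicM e.
Qed.

Lemma G_F : G *m F = Phi.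
Proof. by rewrite /F /G -mulmxA (mulmxA _ S) S_trS mulmxA Phi_idemM. Qed.

Theorem morse_complex : is_complex L.
Proof.
split=> [t t'|x].
  rewrite coef_critical /DL mStrE SmE !enum_rankK.
  move/(gradedM D_graded Phi_graded); rewrite addr0 /hd /qd /ev !enum_rankK.
  by rewrite !crit_hdeg !crit_qdeg.
rewrite !differential_critical -mxappM.
have -> : DL *m DL = S *m D *m (Phi *m c *m Phi) *m D *m S^T.
  by rewrite /DL -{2}Phi_commM -S_trS !mulmxA.
by rewrite Phi_idemM -!mulmxA (mulmxA Phi) Phi_commM !mulmxA -(mulmxA S) [D *m D]DD0
  mulmx0 !mul0mx mxapp0.
Qed.

Theorem morse_homology : bigraded_isomorphic_homology L K.
Proof.
have gh := @g_homotopy _ hd qd D Mx D_graded.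
apply: (@homotopy_equivalence_homology L K (mxapp F) (mxapp G) (mxapp h)).
- move=> i j x; rewrite -{2}[i]addr0; apply: mxapp_homogeneous => t b.
  rewrite SmE enum_rankK => /Phi_graded; rewrite /hd /qd /ev !enum_rankK.
  by rewrite crit_hdeg crit_qdeg.
- move=> i j x; rewrite -{2}[i]addr0; apply: mxapp_homogeneous => b t.
  rewrite mStrE enum_rankK => /Phi_graded; rewrite /hd /qd /ev !enum_rankK.
  by rewrite crit_hdeg crit_qdeg.
- move=> i j x; apply: mxapp_homogeneous => b b' /gh.
  by rewrite /hd /qd /ev !enum_rankK.
- move=> x; rewrite /= differential_critical differentialE.
  by rewrite -[LHS]mxappM -[RHS]mxappM DL_F.
- move=> x; rewrite /= differential_critical differentialE.
  by rewrite -[LHS]mxappM -[RHS]mxappM D_G.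
- by move=> x; rewrite /= -[LHS]mxappM F_G mxapp1.
move=> x; rewrite /= !differentialE -[mxapp F _]mxappM G_F -mxappM => dx.
have e : mxapp (D * h) x = 0 by rewrite [LHS]mxappM dx raddf0.
(* Matrices act on row vectors, so D h applies D first and vanishes on a cocycle, while h D gives
   the differential of h x. *)
have e1 : (1 : 'M_n) = D * h + h * D + Phi.
  by apply/esym; rewrite /Phi -[1 - _ - _]addrA -opprD [LHS]addrC; exact: subrK.
by rewrite -{1}[x]mxapp1 -[1%:M]/(1 : 'M_n) e1 !mxappD e add0r addrK.
Qed.

End Morse.

(** * Spanning trees and activities *)

Local Close Scope ring_scope.

(* The equivalence relation generated by R and (a, b), when R is one.         *)
Definition glue (T : Type) (R : rel T) (a b : T) : rel T := fun x y =>
  [|| R x y, R x a && R b y | R x b && R a y].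

Lemma connect_glue (T : finType) (r r' : rel T) a b :
  connect_sym r -> subrel r r' -> r' a b -> r' b a ->
  (forall x y, r' x y -> [|| r x y, (x == a) && (y == b) | (x == b) && (y == a)]) ->
  connect r' =2 glue (connect r) a b.
Proof.
move=> rC rr' ab ba r'E x y; have sub := connect_sub (fun u v uv => connect1 (rr' u v uv)).
apply/idP/idP => [/connectP[p]|]; last first.
  have cab := connect1 ab; have cba := connect1 ba.
  case/or3P=> [/sub//|/andP[/sub xa /sub by_]|/andP[/sub xb /sub ay]].
    exact: connect_trans xa (connect_trans cab by_).
  exact: connect_trans xb (connect_trans cba ay).
elim/last_ind: p y => [|p z IH] y /= => [_ ->|].
  by rewrite /glue connect0.
rewrite rcons_path last_rcons => /andP[pth stp] ->.
have {IH} := IH _ pth erefl; set w := last x p in stp *.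
case/or3P: (r'E _ _ stp) => [wz|/andP[/eqP wa /eqP->]|/andP[/eqP wb /eqP->]].
- have tr u : connect r u w -> connect r u z by move/connect_trans; apply; apply: connect1.
  by rewrite /glue; case/or3P=> [/tr ->|/andP[-> /tr->]|/andP[-> /tr->]]; rewrite ?orbT.
- rewrite wa /glue; case/or3P=> [xa|/andP[-> _]|/andP[xb _]].
  + by rewrite xa connect0 orbT.
  + by rewrite connect0 orbT.
  + by rewrite xb.
- rewrite wb /glue; case/or3P=> [xa|/andP[xb _]|/andP[-> _]].
  + by rewrite xa connect0 !orbT.
  + by rewrite xb.
  + by rewrite connect0 !orbT.
Qed.

Section Connectivity.

Variables (V E : finType) (en : E -> V * V).
Implicit Types (e f : E) (u v : V) (H T C : {set E}).

Definition joined H u v := connect (adjacent en H) u v.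
Definition closes H e := joined H (en e).1 (en e).2.

Lemma joinsC e u v : joins en e u v = joins en e v u.
Proof. by rewrite /joins orbC. Qed.

Lemma joins_ends e : joins en e (en e).1 (en e).2.
Proof. by rewrite /joins -surjective_pairing eqxx. Qed.

Lemma adjacentC H : symmetric (adjacent en H).
Proof. by move=> u v; apply: eq_existsb => e; rewrite joinsC. Qed.

Lemma joinedC H u v : joined H u v = joined H v u.
Proof. exact: sym_connect_sym (adjacentC H) u v. Qed.

Lemma joined_refl H u : joined H u u. Proof. exact: connect0. Qed.

Lemma joined_trans H u v w : joined H u v -> joined H v w -> joined H u w.
Proof. exact: connect_trans. Qed.

Lemma joinedS H H' u v : H \subset H' -> joined H u v -> joined H' u v.
Proof.
move=> /subsetP sub; apply: connect_sub => {u v} u v /existsP[e /andP[eH j]].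
by apply/connect1/existsP; exists e; rewrite sub.
Qed.

Lemma closesS H H' e : H \subset H' -> closes H e -> closes H' e.
Proof. exact: joinedS. Qed.

Lemma joins_joined H e u v : closes H e -> joins en e u v -> joined H u v.
Proof.
rewrite /closes => c /orP[/eqP e1|/eqP e1]; first by move: c; rewrite e1.
by rewrite joinedC; move: c; rewrite e1.
Qed.

Lemma mem_closes H e : e \in H -> closes H e.
Proof. by move=> eH; apply/connect1/existsP; exists e; rewrite eH joins_ends. Qed.

Lemma joined_closed H H' u v :
  (forall e, e \in H' -> closes H e) -> joined H' u v -> joined H u v.
Proof.
move=> cl; apply: connect_sub => {u v} u v /existsP[e /andP[/cl c j]].
exact: joins_joined c j.
Qed.

Lemma joinedU1 e H u v :
  joined (e |: H) u v = glue (joined H) (en e).1 (en e).2 u v.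
Proof.
apply: connect_glue => [x y|x y /existsP[f /andP[fH j]]|||x y /existsP[f /andP[]]].
- exact: joinedC.
- by apply/existsP; exists f; rewrite in_setU1 fH orbT.
- by apply/existsP; exists e; rewrite setU11 joins_ends.
- by apply/existsP; exists e; rewrite setU11 joinsC joins_ends.
rewrite in_setU1 => /orP[/eqP->|fH j]; last first.
  by apply/or3P/Or31/existsP; exists f; rewrite fH.
rewrite /joins {1 2}[en e]surjective_pairing.
by case/orP=> /eqP[-> ->]; rewrite !eqxx ?orbT.
Qed.

Lemma joined0 u v : joined set0 u v = (u == v).
Proof.
apply/connectP/eqP => [[[|w p] /=]|->]; [by move=> _ -> | | by exists [::]].
by case/andP=> /existsP[e]; rewrite inE.
Qed.

Local Notation walk := (fun x y : V * E => joins en x.2 x.1 y.1).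

Lemma walk_joined H x q z : path walk x (rcons q z) ->
  {subset map snd (x :: q) <= H} -> joined H x.1 z.1.
Proof.
elim: q x => [|y q IH] x /= => [/andP[j _] sub|/andP[j pth] sub].
  by apply: joins_joined j; apply/mem_closes/sub; rewrite inE.
have yz : joined H y.1 z.1.
  by apply: IH pth _ => f fq; apply: sub; rewrite inE fq orbT.
apply: joined_trans yz; apply: joins_joined j; apply/mem_closes/sub.
by rewrite inE eqxx.
Qed.

(** Rotate the closed walk so that it starts with f. The other steps join the ends of f, and f does
    not recur among them because the edges are distinct. *)
Lemma cycle_closes C f : is_cycle en C -> f \in C -> closes (C :\ f) f.
Proof.
case/existsP=> n /existsP[p] /and5P[_ _ uE cyc /eqP ->].
rewrite inE => /mapP[[v g] vf /= ->] {f}.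
have [i q rq] := rot_to vf.
have pq g' : (g' \in map snd p) = (g' \in map snd ((v, g) :: q)).
  by rewrite -rq map_rot mem_rot.
move: uE; rewrite -(rot_uniq i) -map_rot rq /= => /andP[gq _].
move: cyc; rewrite -(rot_cycle i) rq; case: q gq pq {rq} => [|y q] gq pq /=.
  by rewrite andbT => /orP[]/eqP e1; rewrite /closes e1 joined_refl.
case/andP=> j pth; have yv : joined ([set e in map snd p] :\ g) y.1 v.
  apply: walk_joined pth _ => f fq; rewrite in_setD1 inE pq inE fq orbT andbT.
  by apply: contraNneq gq => <-.
by case/orP: j => /eqP e1; rewrite /closes e1 // joinedC.
Qed.

(** The chosen edges are distinct because a later edge has both ends among the later vertices,
    whereas the first edge has the end u, which is not visited again. *)
Lemma simple_walk H u q : path (adjacent en H) u q -> uniq (u :: q) ->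
  exists p : seq (V * E), [/\ map fst p = belast u q, {subset map snd p <= H},
    uniq (map snd p),
    forall f, f \in map snd p -> ((en f).1 \in u :: q) && ((en f).2 \in u :: q)
    & forall z, z.1 = last u q -> sorted walk (rcons p z)].
Proof.
elim: q u => [|w q IH] u; first by exists [::].
rewrite [path _ _ _]/= => /andP[/existsP[g /andP[gH j]] pth] /andP[uq uq'].
have [p [p1 p2 p3 p4 p5]] := IH _ pth uq'; exists ((u, g) :: p); split.
- by rewrite /= p1.
- by move=> f; rewrite inE => /orP[/eqP->|/p2].
- rewrite /= p3 andbT; apply: contra uq => /p4.
  by case/orP: j => /eqP -> /=; case/andP.
- move=> f; rewrite inE => /orP[/eqP->|/p4/andP[f1 f2]].
    by case/orP: j => /eqP -> /=; rewrite !inE !eqxx ?orbT.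
  by rewrite inE f1 inE f2 !orbT.
- move=> z zl; have := p5 z zl; case: p p1 {p2 p3 p4 p5} => [|y p] p1 /=.
    by case: q p1 zl {IH pth uq uq'} => //= _ ->; rewrite j.
  by move=> ->; rewrite andbT; case: q p1 {IH zl pth uq uq'} => //= ? ? [-> _].
Qed.

Lemma closes_cycle H f : f \notin H -> closes H f ->
  exists C, [/\ is_cycle en C, f \in C & C \subset f |: H].
Proof.
move=> fH /connectP[q0 pth0 lst0]; case/shortenP: pth0 lst0 => q pth uq _ lst.
have [p [p1 p2 p3 p4 p5]] := simple_walk pth uq.
have cyc : cycle walk (((en f).2, f) :: p).
  have := p5 ((en f).2, f) lst; case: p p1 {p2 p3 p4 p5} => [|y p] p1 /=.
    by case: q p1 lst {pth uq} => //= _ e2; rewrite {1}e2 joins_ends.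
  move=> ->; rewrite andbT joinsC; case: q p1 {lst pth uq} => //= ? ? [-> _].
  exact: joins_ends.
pose s := ((en f).2, f) :: p.
have us : uniq (map snd s) by rewrite /= p3 andbT; apply: contra fH => /p2.
have ls : (size s < #|E|.+1)%N.
  by rewrite ltnS -(size_map snd) -(card_uniqP us) max_card.
exists [set e in map snd s]; split; last 2 first.
- by rewrite inE mem_head.
- apply/subsetP=> g; rewrite inE in_setU1 inE => /orP[->//|/p2->].
  by rewrite orbT.
apply/existsP; exists (Ordinal ls); apply/existsP; exists (in_tuple s).
apply/and5P; split=> //.
by rewrite /s /= p1 lst -rcons_uniq -lastI; exact: uq.
Qed.

End Connectivity.

Section LexicographicOrder.

Variables (E : finType) (le : rel E).
Hypothesis le_total : total_order le.
Implicit Types A B C : {set E}.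

Lemma total_le_refl e : le e e. Proof. by case: le_total. Qed.
Lemma total_le_anti e f : le e f -> le f e -> e = f.
Proof. by case: le_total => _ anti _ _ ef fe; apply: anti; rewrite ef. Qed.
Lemma total_le_trans e f g : le e f -> le f g -> le e g.
Proof. by case: le_total => _ _ tr _; apply: tr. Qed.
Lemma total_le_total e f : le e f || le f e. Proof. by case: le_total. Qed.

Lemma max_edge (P : pred E) : (exists e, P e) ->
  exists2 e, P e & forall f, P f -> le f e.
Proof.
case=> e0 Pe0; pose dn e := #|[set f | P f & le f e]|.
have [e Pe mx] := @arg_maxnP _ e0 P dn Pe0; exists e => // f Pf.
case/orP: (total_le_total f e) => // ef; apply: contraTT (mx _ Pf) => nfe.
rewrite -ltnNge; apply: proper_card; apply/properP; split.
  by apply/subsetP=> g; rewrite !inE => /andP[-> /total_le_trans]; apply.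
by exists f; rewrite !inE Pf ?total_le_refl ?(negPf nfe).
Qed.

(** Sets are compared like binary numbers whose leading digit is the largest edge. *)
Definition lex_lt A B := [exists e, [&& e \in B, e \notin A
  & [forall f, le e f && (f != e) ==> ((f \in A) == (f \in B))]]].

Lemma lex_ltP A B : reflect (exists e, [/\ e \in B, e \notin A
    & forall f, le e f -> f != e -> (f \in A) = (f \in B)]) (lex_lt A B).
Proof.
apply: (iffP existsP) => -[e]; first case/and3P=> eB eA /forallP al.
  by exists e; split=> // f ef fe; apply/eqP; move: (al f); rewrite ef fe.
case=> eB eA al; exists e; rewrite eB eA; apply/forallP=> f.
by apply/implyP=> /andP[ef fe]; rewrite al.
Qed.

Lemma lex_lt_irr A : ~~ lex_lt A A.
Proof. by apply/lex_ltP => -[e [-> ]]. Qed.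

Lemma lex_lt_trans A B C : lex_lt A B -> lex_lt B C -> lex_lt A C.
Proof.
case/lex_ltP=> e [eB eA eAB] /lex_ltP[f [fC fB fBC]]; apply/lex_ltP.
have ef : e != f by apply: contraNneq fB => <-.
case/orP: (total_le_total e f) => le_ef; [exists f|exists e].
  split=> // [|g fg gf]; first by rewrite eAB // eq_sym.
  rewrite eAB ?fBC //; first exact: total_le_trans le_ef fg.
  by apply: contraNneq gf => ge; rewrite ge in fg *; rewrite (total_le_anti fg le_ef).
split=> // [|g eg ge]; first by rewrite -fBC.
rewrite eAB // fBC //; first exact: total_le_trans le_ef eg.
by apply: contraNneq ge => gf; rewrite gf in eg *; rewrite (total_le_anti eg le_ef).
Qed.

Definition lex_rank A := #|[set B | lex_lt B A]|.

Lemma lex_rank_lt A B : lex_lt A B -> (lex_rank A < lex_rank B)%N.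
Proof.
move=> AB; apply: proper_card; apply/properP; split.
  by apply/subsetP=> C; rewrite !inE => /lex_lt_trans; apply.
by exists A; rewrite !inE ?AB ?lex_lt_irr.
Qed.

End LexicographicOrder.

(** * Activities and the partition of the cube of subgraphs into intervals *)

Section SpanningTrees.

Variables (V E : finType) (vs : {set V}) (en : E -> V * V) (le : rel E).
Hypothesis le_total : total_order le.
Hypothesis en_vs : forall e, ((en e).1 \in vs) && ((en e).2 \in vs).
Implicit Types (e f : E) (T H C : {set E}).

Local Notation joined := (joined en).
Local Notation closes := (closes en).
Local Notation tree := (spanning_tree vs en).

Lemma spans_closes H e : spans_connected vs en H -> closes H e.
Proof.
move/forallP/(_ (en e).1)/implyP; have /andP[-> e2] := en_vs e.
by move/(_ isT)/forallP/(_ (en e).2); rewrite e2.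
Qed.

Lemma spans_closed H H' : (forall e, e \in H' -> closes H e) ->
  spans_connected vs en H' -> spans_connected vs en H.
Proof.
move=> cl /forallP sp; apply/forallP=> u; apply/implyP=> uv; apply/forallP=> v.
apply/implyP=> vv; apply: joined_closed cl _.
by have /implyP/(_ uv)/forallP/(_ v)/implyP/(_ vv) := sp u.
Qed.

Lemma spanning_treeP T : reflect
  (spans_connected vs en T /\ forall f, f \in T -> ~~ closes (T :\ f) f) (tree T).
Proof.
apply: (iffP andP) => -[sp ac]; split=> //.
  move=> f fT; apply/negP => /closes_cycle; rewrite in_setD1 eqxx => /(_ isT)[C [cC _]].
  rewrite setD1K // => CT.
  by have /forallP/(_ C) := ac; rewrite cC CT.
apply/forallP=> C; apply/implyP=> cC; apply/negP=> /subsetP CT.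
have [f fC] : exists f, f \in C.
  case/existsP: (cC) => n /existsP[p] /and5P[+ _ _ _ /eqP ->].
  by case: (tval p) => // -[v g] q _; exists g; rewrite inE mem_head.
have := ac f (CT f fC); apply/negP; rewrite negbK.
by apply: closesS (cycle_closes cC fC); apply: setSD; apply/subsetP.
Qed.

Lemma tree_spans T : tree T -> spans_connected vs en T.
Proof. by case/spanning_treeP. Qed.

Lemma tree_closes T e : tree T -> closes T e.
Proof. by move/tree_spans/spans_closes. Qed.

Lemma tree_bridge T f : tree T -> f \in T -> ~~ closes (T :\ f) f.
Proof. by case/spanning_treeP=> _; apply. Qed.

Lemma spans_notin T e : tree T -> e \in T -> ~~ spans_connected vs en (T :\ e).
Proof. by move=> tT eT; apply: contraNN (tree_bridge tT eT) => /spans_closes. Qed.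

Lemma mem_cut T e f : tree T -> e \in T ->
  (f \in cut vs en T e) = ~~ closes (T :\ e) f.
Proof.
move=> tT eT; rewrite inE; apply/idP/idP => [sp|nc].
  apply: contraNN (spans_notin tT eT) => c.
  by apply: spans_closed sp => g; rewrite in_setU1 => /orP[/eqP->//|/mem_closes].
apply: spans_closed (tree_spans tT) => g gT.
have [->|ge] := eqVneq g e; last by apply: mem_closes; rewrite in_setU1 in_setD1 ge gT orbT.
have : closes (e |: (T :\ e)) f by rewrite setD1K //; apply: tree_closes.
rewrite /closes !joinedU1 /glue -[joined _ (en f).1 (en f).2]/(closes _ _) (negPf nc) /=.
case/orP=> /andP[a b]; last by rewrite a b !orbT.
by rewrite -[joined _ (en e).1 (en f).1]joinedC a -[joined _ (en f).2 _]joinedC b orbT.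
Qed.

(** If an old edge g were not a bridge of the new tree, a detour around g would have to cross f,
    since g is a bridge of T. Together with g it would then join the ends of f within T \ e,
    although f lies in the cut. *)
Lemma cut_swap T e f : tree T -> e \in T -> f \in cut vs en T e -> f != e ->
  tree (f |: (T :\ e)).
Proof.
move=> tT eT fcut fe; apply/spanning_treeP; split; first by rewrite inE in fcut.
move: fcut; rewrite mem_cut // => nc.
have fT : f \notin T by apply: contraNN nc => fT; apply: mem_closes; rewrite in_setD1 fe.
move=> g; rewrite in_setU1; have [->|gf] := eqVneq g f.
  move=> _; apply: contraNN nc; apply: closesS.
  by apply/subsetP=> h; rewrite !inE => /andP[/negPf->].
move=> /= gTe; have [ge gT] := setD1P gTe; apply: contraNN nc => c.
have e1 : (f |: T :\ e) :\ g = f |: (T :\ e :\ g).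
  by apply/setP=> h; rewrite !inE; have [->|//] := eqVneq h f; rewrite eq_sym gf.
have sub : T :\ e :\ g \subset T :\ g by apply: setSD; apply: subsetDl.
have sub' : T :\ e :\ g \subset T :\ e by apply: subsetDl.
move: c; rewrite /closes e1 joinedU1 => /or3P[c|/andP[a b]|/andP[a b]].
- by case/negP: (tree_bridge tT gT); apply: closesS sub c.
- have cg := mem_closes en gTe; rewrite joinedC in a; rewrite joinedC in b.
  exact: joined_trans (joinedS sub' a) (joined_trans cg (joinedS sub' b)).
- have cg := mem_closes en gTe; rewrite /closes joinedC in cg.
  exact: joined_trans (joinedS sub' b) (joined_trans cg (joinedS sub' a)).
Qed.

Lemma cyc_cycle T e : tree T -> e \notin T ->
  exists C, [/\ is_cycle en C, e \in C & C \subset e |: T].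
Proof. by move=> tT eT; apply: closes_cycle eT (tree_closes e tT). Qed.

Lemma mem_cyc T e f : tree T -> e \notin T -> f \in cyc en T e -> f != e ->
  f \in T /\ e \in cut vs en T f.
Proof.
move=> tT eT /bigcupP[C /andP[cC CT] fC] fe.
have fT : f \in T by move/subsetP/(_ f fC): CT; rewrite in_setU1 (negPf fe).
split=> //; rewrite mem_cut //; apply: contraNN (tree_bridge tT fT) => ce.
apply: joined_closed (cycle_closes cC fC) => g; rewrite in_setD1 => /andP[gf gC].
move/subsetP/(_ g gC): CT; rewrite in_setU1 => /orP[/eqP->//|gT].
by apply: mem_closes; rewrite in_setD1 gf.
Qed.

Lemma cyc_self T e : tree T -> e \notin T -> e \in cyc en T e.
Proof.
move=> tT eT; have [C [cC eC sub]] := cyc_cycle tT eT.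
by apply/bigcupP; exists C; rewrite ?cC.
Qed.

Local Notation ID := (int_dead vs en le).
Local Notation IL := (int_live vs en le).
Local Notation ED := (ext_dead en le).
Local Notation EL := (ext_live en le).

Lemma int_liveP T e : tree T -> e \in T ->
  reflect (forall f, le f e -> f != e -> closes (T :\ e) f) (e \in IL T).
Proof.
move=> tT eT; rewrite inE eT /= /smallest mem_cut // tree_bridge //=.
apply: (iffP forallP) => [sm f fe nfe|sm f].
  have := sm f; rewrite mem_cut //; have [//|_ ef] := boolP (closes _ f).
  by rewrite (total_le_anti le_total fe ef) eqxx in nfe.
apply/implyP; rewrite mem_cut //; have [->|fe] := eqVneq f e; first by rewrite total_le_refl.
by case/orP: (total_le_total le_total e f) => // ef; rewrite sm.
Qed.

Lemma ext_liveP T e : tree T -> e \notin T ->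
  reflect (forall f, f \in cyc en T e -> le e f) (e \in EL T).
Proof.
move=> tT eT; rewrite !inE eT /= /smallest cyc_self //=.
by apply: (iffP forallP) => sm f; [have /implyP := sm f | apply/implyP/sm].
Qed.

Lemma int_deadE T : ID T = T :\: IL T.
Proof. by apply/setP=> e; rewrite !inE; case: (e \in T); rewrite ?andbF //= andbT. Qed.

Lemma ext_deadE T : ED T = ~: (T :|: EL T).
Proof. by apply/setP=> e; rewrite !inE; case: (e \in T). Qed.

(* An externally live edge is smaller than the rest of its cycle, hence none of *)
(* the other edges of this cycle is the smallest one of its cut.               *)
Lemma ext_live_closes T e : tree T -> e \in EL T ->
  closes (ID T :&: [set f | le e f]) e.
Proof.
move=> tT eEL; have eT : e \notin T by move: eEL; rewrite !inE => /andP[].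
have sm := elimT (ext_liveP tT eT) eEL.
have [C [cC eC sub]] := cyc_cycle tT eT.
apply: closesS (cycle_closes cC eC); apply/subsetP=> f; rewrite in_setD1 => /andP[fe fC].
have fcyc : f \in cyc en T e by apply/bigcupP; exists C; rewrite ?cC.
have [fT ecut] := mem_cyc tT eT fcyc fe.
rewrite in_setI !inE fT sm // andbT /smallest negb_and; apply/orP; right.
apply/forallP => /(_ e); rewrite ecut => /= lefe.
by rewrite (total_le_anti le_total (sm f fcyc) lefe) eqxx in fe.
Qed.

(** As e is the smallest element of its cut, every smaller edge has its ends joined in T \ e
    already. Adding these edges cannot reconnect the ends of e. *)
Lemma int_live_bridge T e : tree T -> e \in IL T ->
  ~~ closes ((T :&: [set f | le e f]) :\ e :|: [set f | le f e && (f != e)]) e.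
Proof.
move=> tT eIL; have eT : e \in T by move: eIL; rewrite inE => /andP[].
have sm := elimT (int_liveP tT eT) eIL.
apply: contraNN (tree_bridge tT eT); apply: joined_closed => f.
rewrite in_setU => /orP[]; last by rewrite inE => /andP[]; apply: sm.
by rewrite !inE => /and3P[fe fT _]; apply: mem_closes; rewrite in_setD1 fe.
Qed.

Definition in_interval T H := (ID T \subset H) && [disjoint ED T & H].

(* At the largest edge where two trees differ, both see the same edges above   *)
(* it, so that it is dead for both of them.                                    *)
Lemma interval_separation T T' H H' e : tree T -> tree T' ->
  in_interval T H -> in_interval T' H' -> e \in T -> e \notin T' ->
  (forall f, le e f -> f != e -> (f \in T) = (f \in T')) ->
  e \in H /\ e \notin H'.
Proof.
move=> tT tT' /andP[ID_H _] /andP[_ ED_H] eT eT' agree.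
have above : T :&: [set f | le e f] :\ e = T' :&: [set f | le e f].
  apply/setP=> f; rewrite !inE; have [->|fe] := eqVneq f e; first by rewrite (negPf eT').
  by case ef: (le e f); rewrite ?andbF //= !andbT agree.
split.
  apply: (subsetP ID_H); rewrite int_deadE in_setD eT andbT.
  apply: contraTN (tree_closes e tT') => /(int_live_bridge tT).
  apply: contraNN => c; apply: closesS c; apply/subsetP=> f fT'.
  rewrite in_setU above !inE fT' /=; case/orP: (total_le_total le_total e f) => ef; rewrite ef //.
  by rewrite orbC; have [fe|] := eqVneq f e; [rewrite -fe fT' in eT' | ].
apply/negP => eH'; have : e \notin ED T'.
  by apply: contraTN eH' => eED; rewrite (disjointFr ED_H eED).
rewrite ext_deadE in_setC negbK in_setU (negPf eT') /= => /(ext_live_closes tT').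
apply/negP; apply: contraNN (tree_bridge tT eT); apply: closesS.
apply: subset_trans (_ : T' :&: [set f | le e f] \subset _).
  by apply: setSI; rewrite int_deadE subsetDl.
by rewrite -above; apply: setSD; apply: subsetIl.
Qed.

Lemma largest_difference (A B : {set E}) : A != B ->
  exists2 e, (e \in A) != (e \in B) &
    forall f, le e f -> f != e -> (f \in A) = (f \in B).
Proof.
move=> AB; have [e ne mx] : exists2 e, (e \in A) != (e \in B) &
    forall f, (f \in A) != (f \in B) -> le f e.
  apply: (max_edge le_total); apply/existsP; apply: contraNT AB.
  rewrite negb_exists => /forallP eqAB; apply/eqP/setP => e.
  by apply/eqP; have := eqAB e; rewrite negbK.
exists e => // f ef fe; apply/eqP; apply: contraNT fe => /mx fe.
by rewrite (total_le_anti le_total fe ef).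
Qed.

Lemma interval_uniq T T' H : tree T -> tree T' ->
  in_interval T H -> in_interval T' H -> T = T'.
Proof.
move=> tT tT' iT iT'; apply/eqP/negPn/negP => /largest_difference[e ne agree].
have [eT|eT] := boolP (e \in T).
  have eT' : e \notin T' by move: ne; rewrite eT; case: (e \in T').
  by have [eH /negP] := interval_separation tT tT' iT iT' eT eT' agree.
have eT' : e \in T' by move: ne; rewrite (negPf eT); case: (e \in T').
have [|eH /negP//] := interval_separation tT' tT iT' iT eT' eT.
by move=> f ef fe; rewrite agree.
Qed.

(** By [interval_separation] the largest edge where the trees differ also distinguishes H from H'.
    As these can differ only at e, it is e. *)
Lemma interval_toggle T T' H H' e : tree T -> tree T' ->
  in_interval T H -> in_interval T' H' -> T != T' ->
  (forall f, f != e -> (f \in H) = (f \in H')) ->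
  [/\ (e \in H) = (e \in T), (e \in H') = (e \in T'), (e \in T') = ~~ (e \in T)
    & forall f, le e f -> f != e -> (f \in T) = (f \in T')].
Proof.
move=> tT tT' iT iT' /largest_difference[e' ne agree] HH'.
have [e'T|e'T] := boolP (e' \in T).
  have e'T' : e' \notin T' by move: ne; rewrite e'T; case: (e' \in T').
  have [e'H e'H'] := interval_separation tT tT' iT iT' e'T e'T' agree.
  have ee' : e = e' by apply/eqP; apply: contraNT e'H'; rewrite eq_sym => /HH' <-.
  by rewrite ee' e'H e'T (negPf e'H') (negPf e'T').
have e'T' : e' \in T' by move: ne; rewrite (negPf e'T); case: (e' \in T').
have [|e'H' e'H] := interval_separation tT' tT iT' iT e'T' e'T.
  by move=> f ef fe; rewrite agree.
have ee' : e = e' by apply/eqP; apply: contraNT e'H; rewrite eq_sym => /HH' ->.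
by rewrite ee' e'H' e'T' (negPf e'H) (negPf e'T).
Qed.

Lemma exists_tree : spans_connected vs en setT -> exists T, tree T.
Proof.
move=> sp; have [T spT mn] := @arg_minnP _ setT (spans_connected vs en) (fun T => #|T|) sp.
exists T; apply/spanning_treeP; split=> // f fT; apply/negP=> c.
have : spans_connected vs en (T :\ f).
  apply: spans_closed spT => g gT; have [->//|gf] := eqVneq g f.
  by apply: mem_closes; rewrite in_setD1 gf.
by move/mn; rewrite (cardsD1 f T) fT add1n ltnn.
Qed.

(* The tree whose symmetric difference with H is lexicographically minimal.    *)
Lemma exists_interval H : spans_connected vs en setT ->
  exists2 T, tree T & in_interval T H.
Proof.
case/exists_tree=> T0 tT0; pose sd T := [set e | (e \in T) != (e \in H)].
have [T tT mn] := @arg_minnP _ T0 tree (fun T => lex_rank le (sd T)) tT0.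
(* Exchanging e for a smaller f takes e out of the symmetric difference with H and changes nothing
   above e, against minimality. A tree edge missing from H must then be internally live, and a
   non-tree edge of H externally live. *)
have no_swap e f : (e \in T) != (e \in H) -> le f e -> f != e ->
    forall T', tree T' -> e \in sd T -> e \notin sd T' ->
    (forall g, g != e -> g != f -> (g \in T') = (g \in T)) -> False.
  move=> eTH fe nfe T' tT' e1 e2 agree.
  have : lex_lt le (sd T') (sd T).
    apply/lex_ltP; exists e; split=> // g eg ge; rewrite !inE agree //.
    by apply: contraNneq nfe => gf; rewrite gf in eg; rewrite (total_le_anti le_total fe eg).
  by move/(lex_rank_lt le_total); rewrite ltnNge mn.
exists T => //; apply/andP; split.
  apply/subsetP=> e; rewrite int_deadE in_setD => /andP[eIL eT].
  apply: contraNT eIL => eH; apply/(int_liveP tT eT) => f fe nfe.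
  apply: contraT; rewrite -mem_cut // => fcut; exfalso.
  apply: (no_swap e f _ fe nfe _ (cut_swap tT eT fcut nfe)); rewrite ?inE ?eT ?(negPf eH) //.
    by rewrite eqxx [e == f]eq_sym (negPf nfe).
  by move=> g ge gf; rewrite !inE (negPf gf) ge.
rewrite disjoint_subset; apply/subsetP=> e; rewrite ext_deadE in_setC in_setU negb_or.
case/andP=> eT eEL; rewrite inE; apply: contraNN eEL => eH.
apply/(ext_liveP tT eT) => f fcyc; have [->|nfe] := eqVneq f e; first exact: total_le_refl.
case/orP: (total_le_total le_total e f) => // fe; exfalso.
have [fT ecut] := mem_cyc tT eT fcyc nfe; rewrite eq_sym in nfe.
rewrite eq_sym in nfe.
have nef : e != f by rewrite eq_sym.
apply: (no_swap e f _ fe nfe _ (cut_swap tT fT ecut nef)); rewrite ?inE ?(negPf eT) ?eH //.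
  by rewrite eqxx.
by move=> g ge gf; rewrite !inE (negPf ge) gf.
Qed.

End SpanningTrees.

(** * Surgery on the circles of a diagram *)

Definition equivalence (T : Type) (R : rel T) := [/\ reflexive R, symmetric R & transitive R].

Section Classes.

Variable T : finType.
Implicit Types (R : rel T) (a b : T).

Definition n_classes R := #|[set [set y | R x y] | x : T]|.

Lemma eq_n_classes R R' : R =2 R' -> n_classes R = n_classes R'.
Proof.
move=> RR'; rewrite /n_classes; congr #|pred_of_set _|; apply: eq_imset => x.
by apply/setP=> y; rewrite !inE RR'.
Qed.

Lemma equiv_glue R a b : equivalence R -> equivalence (glue R a b).
Proof.
move=> [r s t]; rewrite /glue; split=> [x|x y|y x z]; first by rewrite r.
  rewrite (s x y) (s x a) (s b y) (s x b) (s a y) (andbC (R a x)) (andbC (R b x)).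
  by rewrite (orbC (R y b && _)).
have tr u v w : R u v -> R v w -> R u w by apply: t.
rewrite !(s a) !(s b).
case/or3P=> [xy|/andP[xa yb]|/andP[xb ya]]; case/or3P=> [yz|/andP[ya' zb]|/andP[yb' za]].
- by rewrite (tr _ _ _ xy yz).
- by rewrite (tr _ _ _ xy ya') zb orbT.
- by rewrite (tr _ _ _ xy yb') za !orbT.
- by rewrite xa (tr z y b) ?orbT // s.
- by rewrite xa zb orbT.
- by rewrite (tr x a z) // s.
- by rewrite xb (tr z y a) ?orbT // s.
- by rewrite (tr x b z) // s.
- by rewrite xb za !orbT.
Qed.

Lemma glueC R a b : equivalence R -> glue R a b =2 glue R b a.
Proof. by move=> [r s t] x y; rewrite /glue [X in _ || X]orbC. Qed.

Lemma eq_glue_ends R a b a' b' : equivalence R -> R a a' -> R b b' ->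
  glue R a b =2 glue R a' b'.
Proof.
move=> [r s t] aa' bb' x y.
have mv u v w : R u v -> R w u = R w v.
  by move=> uv; apply/idP/idP => h; apply: t h _; rewrite // s.
by rewrite /glue (s a) (s b) !(mv _ _ _ aa') !(mv _ _ _ bb') (s a') (s b').
Qed.

Lemma n_classes_glue R a b : equivalence R -> ~~ R a b ->
  n_classes R = (n_classes (glue R a b)).+1.
Proof.
move=> [r s t] nab; have tr u v w : R u v -> R v w -> R u w by apply: t.
pose cl x := [set y | R x y].
pose AB := cl a :|: cl b.
pose rest := [set cl x | x in ~: AB].
have clE x y : R x y -> cl x = cl y.
  by move=> xy; apply/setP=> z; rewrite !inE; apply/idP/idP; apply: tr; rewrite // s.
have eR : [set cl x | x : T] = cl a |: (cl b |: rest).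
  apply/setP=> C; apply/imsetP/idP => [[x _ ->]|].
    rewrite !in_setU1; have [xAB|xAB] := boolP (x \in AB); last first.
      by rewrite [_ \in rest]imset_f ?orbT // in_setC.
    by move: xAB; rewrite !inE => /orP[]/clE ->; rewrite eqxx ?orbT.
  by case/setU1P=> [->|/setU1P[->|/imsetP[x _ ->]]]; [exists a|exists b|exists x].
have eG : [set [set y | glue R a b x y] | x : T] = AB |: rest.
  have gin x : x \in AB -> [set y | glue R a b x y] = AB.
    rewrite !inE => /orP[] h; apply/setP=> y; rewrite !inE /glue.
      rewrite [R x a]s h; have -> : R x b = false.
        by apply: contraNF nab => xb; apply: tr h xb.
      by rewrite /= orbF; congr (_ || _); apply/idP/idP; apply: tr; rewrite // s.
    rewrite [R x b]s h; have -> : R x a = false.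
      by apply: contraNF nab => xa; rewrite s; apply: tr h xa.
    by rewrite /= orbC; congr (_ || _); apply/idP/idP; apply: tr; rewrite // s.
  have gout x : x \notin AB -> [set y | glue R a b x y] = cl x.
    rewrite !inE negb_or => /andP[h1 h2]; apply/setP=> y; rewrite !inE /glue.
    by rewrite !(s x) (negPf h1) (negPf h2) !orbF.
  apply/setP=> C; apply/imsetP/idP => [[x _ ->]|].
    have [xAB|xAB] := boolP (x \in AB); first by rewrite gin // setU11.
    by rewrite gout // in_setU1 [_ \in rest]imset_f ?orbT // in_setC.
  case/setU1P=> [->|/imsetP[x]]; first by exists a; rewrite ?gin // !inE r.
  by rewrite in_setC => xAB ->; exists x; rewrite ?gout.
rewrite /n_classes eR eG !cardsU1 in_setU1.
have nrest (C : {set T}) x : x \in C -> x \in AB -> C \notin rest.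
  move=> xC xAB; apply/imsetP=> -[y yAB CE]; rewrite in_setC in yAB.
  move: xC yAB; rewrite CE !inE => yx; apply/negP; rewrite negbK.
  by move: xAB; rewrite !inE => /orP[] h; rewrite (tr _ x _ h) ?orbT // s.
have aAB : a \in AB by rewrite !inE r.
have bAB : b \in AB by rewrite !inE r orbT.
have na : cl a \notin rest by apply: (nrest _ a); rewrite // inE r.
have nb : cl b \notin rest by apply: (nrest _ b); rewrite // inE r.
rewrite (negPf na) nb (nrest AB a) // orbF.
suff -> : cl a != cl b by rewrite !add1n.
by apply: contraNneq nab => e; have := r b; rewrite -[R b b]inE -/(cl b) -e inE.
Qed.

End Classes.

Section SurgeryOnCycles.

Variables (T : finType) (p q : T).
Hypothesis pq : p != q.
Implicit Types s : {perm T}.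

Definition same_cycle s : rel T := fun x y => y \in porbit s x.

Lemma same_cycle_equiv s : equivalence (same_cycle s).
Proof.
split=> [x|x y|y x z]; rewrite /same_cycle ?porbit_id ?[_ \in porbit _ y]porbit_sym //.
by rewrite -!eq_porbit_mem => /eqP -> /eqP ->.
Qed.

Lemma same_cycle_glue s : subrel (same_cycle (tperm p q * s)) (glue (same_cycle s) p q).
Proof.
move=> x _ /porbitP[i ->]; elim: i => [|i IH].
  by rewrite expg0 perm1 /glue /same_cycle porbit_id.
have [gr gs gt] := equiv_glue p q (same_cycle_equiv s).
rewrite expgSr permM; apply: gt IH _; move: ((_ ^+ i)%g : {perm T}) => u; rewrite permM; move: (u x) => y.
have st z : same_cycle s z (s z) by apply: (mem_porbit s 1).
have [r sy t] := same_cycle_equiv s.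
case: tpermP => [->|->|_ _]; rewrite /glue ?st ?r ?orbT //.
Qed.

(** Each of the two permutations would refine the other by [same_cycle_glue], so they would have the
    same cycles as sets. But multiplication by a transposition changes the number of cycles by
    one. *)
Lemma same_cycle_count s : same_cycle s p q -> same_cycle (tperm p q * s) p q -> False.
Proof.
set t := (_ * _)%g => sp tp.
have sub s1 s2 : same_cycle s1 p q -> s2 = (tperm p q * s1)%g ->
    subrel (same_cycle s2) (same_cycle s1).
  move=> s1pq -> x y /same_cycle_glue; have [_ sy tr] := same_cycle_equiv s1.
  case/or3P=> // /andP[xp qy]; first exact: tr (tr _ _ _ xp s1pq) qy.
  by rewrite sy in s1pq; apply: tr (tr _ _ _ xp s1pq) qy.
have e : porbits t = porbits s.
  rewrite /porbits; apply: eq_imset => x; apply/setP=> y.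
  apply/idP/idP; first exact: sub.
  by apply: sub => //; rewrite /t mulgA tperm2 mul1g.
have := porbits_mul_tperm s p q; rewrite /= -/t e pq porbit_sym.
by move: sp; rewrite /same_cycle => ->; rewrite /= addn0 addn1 => /eqP; lia.
Qed.

Lemma same_cycle_surgery s :
  same_cycle (tperm p q * s) p q = ~~ same_cycle s p q.
Proof.
set t := (_ * _)%g; apply/idP/idP => [tp|nsp].
  by apply/negP => sp; apply: same_cycle_count sp tp.
apply: contraT => ntp.
have := porbits_mul_tperm s p q; have := porbits_mul_tperm t p q.
rewrite /= {1}/t mulgA tperm2 mul1g -/t pq.
move: ntp nsp; rewrite /same_cycle porbit_sym => ->; rewrite porbit_sym => ->.
by rewrite /=; lia.
Qed.

Lemma same_cycle_merge s : ~~ same_cycle s p q ->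
  same_cycle (tperm p q * s) =2 glue (same_cycle s) p q.
Proof.
move=> nsp x y; set t := (_ * _)%g; have tp : same_cycle t p q by rewrite same_cycle_surgery.
have [_ sy tr] := same_cycle_equiv t.
have sub : subrel (same_cycle s) (same_cycle t).
  have -> : s = (tperm p q * t)%g by rewrite mulgA tperm2 mul1g.
  move=> {}x {}y /same_cycle_glue/or3P[//|/andP[xp qy]|/andP[xq py]].
    exact: tr (tr _ _ _ xp tp) qy.
  by rewrite sy in tp; apply: tr (tr _ _ _ xq tp) py.
apply/idP/idP; first exact: same_cycle_glue.
case/or3P=> [/sub//|/andP[/sub xp /sub qy]|/andP[/sub xq /sub py]].
  exact: tr (tr _ _ _ xp tp) qy.
by rewrite sy in tp; apply: tr (tr _ _ _ xq tp) py.
Qed.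

End SurgeryOnCycles.

(** * Circles of a smoothing as cycles of a permutation *)

Section Circles.

Variables (L : diagram) (black : pred (side L)).
Hypotheses (oriented : well_oriented L) (coloured : checkerboard black).
Implicit Types (c e : crossing L) (k : 'I_4) (a b : link_arc L) (H : {set crossing L}).

(* The arcs are reoriented so as to have a black region on their left: such an *)
(* arc leaves the crossing c through its end k when corner k is black.        *)
Definition leaving c k := black (corner c k).

Lemma black_side a l : black (a, ~~ l) = ~~ black (a, l).
Proof. by case: coloured => _ alt; case: l; rewrite alt ?negbK. Qed.

Lemma leavingS c k : leaving c (ordS k) = ~~ leaving c k.
Proof.
have [adj _] := coloured; rewrite /leaving (adj (corner c k) (corner' c k)).
  by rewrite -black_side negbK.
by apply/existsP; exists c; apply/existsP; exists k; rewrite eqxx.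
Qed.

Lemma leaving_mate H c k : leaving c (mate black H c k) = ~~ leaving c k.
Proof.
by rewrite /mate; case: ifP => _; rewrite ?leavingS // -[in RHS](ord_predK k) leavingS negbK.
Qed.

Lemma mateK H c : involutive (mate black H c).
Proof.
move=> k; rewrite /mate; case: (c \in _);
by case: k => -[|[|[|[|]]]] //= lt_k; apply/val_inj.
Qed.

Lemma leavingE c k : leaving c k = black (arc_at c k, false) (+) outgoing c k.
Proof.
by rewrite /leaving /corner; case: (outgoing c k); rewrite ?addbT ?addbF // -black_side.
Qed.

(** An arc has at most one outgoing and one incoming end. Reorienting it by the colouring exchanges
    these two roles or keeps both. *)
Lemma leaving_inj c k c' k' : arc_at c k = arc_at c' k' ->
  leaving c k = leaving c' k' -> (c, k) = (c', k').
Proof.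
move=> ea el; have eo : outgoing c k = outgoing c' k'.
  by move: el; rewrite !leavingE ea => /addbI.
have ends_le1 out : (n_ends out (arc_at c k) <= 1)%N.
  by move/forallP/(_ (arc_at c k)): oriented => /andP[/eqP eqn le1]; case: out; rewrite // -eqn.
apply: contraTeq (ends_le1 (outgoing c k)) => ne; rewrite -ltnNge /n_ends.
apply: leq_trans (subset_leq_card (_ : [set (c, k); (c', k')] \subset _)).
  by rewrite cards2 ne.
by apply/subsetP=> p; rewrite !inE => /orP[] /eqP -> /=; rewrite ?ea ?eo !eqxx.
Qed.

Lemma opposite_end c k :
  exists c' k', arc_at c' k' = arc_at c k /\ leaving c' k' = ~~ leaving c k.
Proof.
have /forallP/(_ (arc_at c k))/andP[/eqP eqn _] := oriented.
have pos out : (0 < n_ends out (arc_at c k))%N.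
  suff : (0 < n_ends (outgoing c k) (arc_at c k))%N.
    by case: (outgoing c k) out => -[]; rewrite // ?eqn // -eqn.
  by apply/card_gt0P; exists (c, k); rewrite inE /= !eqxx.
have /card_gt0P[[c' k']] := pos (~~ outgoing c k).
rewrite inE /= => /andP[/eqP ea /eqP eo]; exists c', k'; split=> //.
by rewrite !leavingE ea eo addbN.
Qed.

(** An arc is followed to the end where it enters a crossing and continued through the smoothing.
    The default a serves the arcs that meet no crossing, each being a circle by itself. *)
Definition next H a : link_arc L :=
  if [pick p : crossing L * 'I_4 | (arc_at p.1 p.2 == a) && ~~ leaving p.1 p.2] is Some p
  then arc_at p.1 (mate black H p.1 p.2) else a.

Lemma next_arc H c k : ~~ leaving c k -> next H (arc_at c k) = arc_at c (mate black H c k).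
Proof.
move=> nl; rewrite /next; case: pickP => [[c' k'] /= /andP[/eqP ea nl']|/(_ (c, k))].
  by have [-> ->] : (c', k') = (c, k) by apply: leaving_inj; rewrite // (negPf nl) (negPf nl').
by rewrite /= eqxx nl.
Qed.

Lemma next_inj H : injective (next H).
Proof.
have nextP a : (exists2 p, arc_at p.1 p.2 = a & ~~ leaving p.1 p.2) \/
    next H a = a /\ forall c k, arc_at c k <> a.
  rewrite /next; case: pickP => [p /andP[/eqP ea nl]|none]; first by left; exists p.
  right; split=> // c k ea; have [nl|nl] := boolP (leaving c k); last first.
    by have := none (c, k); rewrite /= ea eqxx nl.
  have [c' [k' [ea' el']]] := opposite_end c k.
  by have := none (c', k'); rewrite /= ea' ea eqxx el' nl.
move=> a b; have [[[c k] /= <- nl]|[-> na]] := nextP a;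
  have [[[c' k'] /= <- nl']|[-> nb]] := nextP b; rewrite ?next_arc //.
- move=> ea; have [ec em] := leaving_inj ea (etrans (leaving_mate _ _ _)
    (etrans (congr1 negb (etrans (negPf nl) (esym (negPf nl')))) (esym (leaving_mate _ _ _)))).
  by rewrite ec in em *; rewrite (can_inj (mateK H c') em).
- by move=> ea; case: (nb _ _ ea).
- by move=> ea; case: (na _ _ (esym ea)).
Qed.

Definition next_perm H : {perm link_arc L} := perm (@next_inj H).

Lemma same_circle_cycle H : same_circle black H =2 same_cycle (next_perm H).
Proof.
have [r s t] := same_cycle_equiv (next_perm H).
have step c k : same_cycle (next_perm H) (arc_at c k) (arc_at c (mate black H c k)).
  have nx c' k' : ~~ leaving c' k' ->
      same_cycle (next_perm H) (arc_at c' k') (arc_at c' (mate black H c' k')).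
    by move=> nl; rewrite -next_arc // -(permE (@next_inj H)); apply: (mem_porbit _ 1).
  have [l|/nx//] := boolP (leaving c k).
  have := nx c (mate black H c k); rewrite leaving_mate l => /(_ isT).
  by rewrite mateK s.
move=> a b; apply/idP/idP => [/connectP[p]|/porbitP[i ->]].
  elim: p a => [|d p IH] a /= => [_ ->|/andP[/existsP[c /existsP[k /andP[/eqP ea /eqP ed]]] pth lst]].
    exact: r.
  by apply: t (IH _ pth lst); rewrite -ea -ed.
elim: i => [|i IH]; first by rewrite expg0 perm1; apply: connect0.
apply: connect_trans IH _; rewrite expgSr permM permE /next.
case: pickP => [[c k] /= /andP[/eqP ea _]|_]; last exact: connect0.
by apply/connect1/existsP; exists c; apply/existsP; exists k; rewrite ea !eqxx.
Qed.

Lemma same_circle_equiv H : equivalence (same_circle black H).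
Proof.
have [r s t] := same_cycle_equiv (next_perm H).
by split=> [x|x y|y x z]; rewrite !same_circle_cycle; [apply: r | apply: s | apply: t].
Qed.

Lemma same_circle_mate H c k : same_circle black H (arc_at c k) (arc_at c (mate black H c k)).
Proof. by apply/connect1/existsP; exists c; apply/existsP; exists k; rewrite !eqxx. Qed.

Lemma in_toggle H e f : (f \in toggle H e) = (f \in H) (+) (f == e).
Proof.
rewrite /toggle; case: ifP => eH; rewrite !inE; have [->|] := eqVneq f e;
by rewrite ?eH ?addbF.
Qed.

Lemma in_A_edges H f : (f \in A_edges black H) = ((f \in H) == pos_edge black f).
Proof. by rewrite inE. Qed.

Lemma A_edges_toggle H e f : (f \in A_edges black (toggle H e)) = (f \in A_edges black H) (+) (f == e).
Proof. by rewrite !in_A_edges in_toggle; case: (f \in H); case: (pos_edge _ f); case: (f == e). Qed.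

Local Notation opp k := (ordS (ordS k)).

Lemma mate_toggle H e c k : mate black (toggle H e) c k =
  mate black H c (if c == e then opp k else k).
Proof.
rewrite /mate A_edges_toggle; have [->|_] := eqVneq c e; rewrite ?addbF // addbT.
by case: (e \in _); case: k => -[|[|[|[|]]]] //= lt_k; apply/val_inj.
Qed.

(** Circles enter e through two opposite ends, and changing the smoothing exchanges where these two
    lead. In the product the transposition acts first. *)
Lemma next_toggle H e k : ~~ leaving e k ->
  next_perm (toggle H e) = (tperm (arc_at e k) (arc_at e (opp k)) * next_perm H)%g.
Proof.
move=> nl; have nl' : ~~ leaving e (opp k) by rewrite !leavingS negbK.
have oppK : opp (opp k) = k by case: k {nl nl'} => -[|[|[|[|]]]] //= lt_k; apply/val_inj.
apply/perm.permP=> a; rewrite permM permE [RHS]permE; case: (tpermP (arc_at e k) (arc_at e (opp k)) a) => [->|->|/eqP ne /eqP ne'].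
- by rewrite !next_arc // mate_toggle eqxx.
- by rewrite !next_arc // mate_toggle eqxx oppK.
rewrite /next; case: pickP => // -[c k'] /= /andP[/eqP ea nlc].
rewrite mate_toggle; case: eqP => // ce; subst c.
have [k'k|] := eqVneq k' k; first by rewrite -ea k'k eqxx in ne.
have [k'k|] := eqVneq k' (opp k); first by rewrite -ea k'k eqxx in ne'.
have : leaving e k' = leaving e k by rewrite (negPf nl) (negPf nlc).
have lE j : leaving e j = leaving e end0 (+) odd j.
  have j1 : leaving e end1 = ~~ leaving e end0.
    by rewrite -leavingS; congr leaving; apply/val_inj.
  have j2 : leaving e end2 = leaving e end0.
    by rewrite -[RHS]negbK -j1 -leavingS; congr leaving; apply/val_inj.
  have j3 : leaving e end3 = ~~ leaving e end0.
    by rewrite -j2 -leavingS; congr leaving; apply/val_inj.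
  case: j => -[|[|[|[|]]]] //= lt_j; rewrite ?addbF ?addbT.
  - by congr leaving; apply/val_inj.
  - by rewrite -j1; congr leaving; apply/val_inj.
  - by rewrite -j2; congr leaving; apply/val_inj.
  - by rewrite -j3; congr leaving; apply/val_inj.
rewrite (lE k') (lE k) => /addbI; rewrite -!val_eqE /=.
by case: k k' {nl nl' oppK ne ne' ea nlc} => -[|[|[|[|]]]] //= ? [] [|[|[|[|]]]].
Qed.

Local Notation ae := (fun e => arc_at e end0).
Local Notation be := (fun e => arc_at e end2).

(** Either smoothing connects ends 0 and 2 with ends 1 and 3, so any opposite pair represents the
    same two circles. This allows passing from ends 0 and 2, used in the definitions, to the
    entering ends, where the permutation sees the surgery. *)
Lemma opposite_ends H e k :
  (same_circle black H (ae e) (arc_at e k) && same_circle black H (be e) (arc_at e (opp k))) ||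
  (same_circle black H (ae e) (arc_at e (opp k)) && same_circle black H (be e) (arc_at e k)).
Proof.
have [r s t] := same_circle_equiv H.
have m0 := same_circle_mate H e end0; have m2 := same_circle_mate H e end2.
have o k0 k1 : val k0 = val k1 -> arc_at e k0 = arc_at e k1.
  by move=> ?; congr (arc_at e _); apply/val_inj.
have [eA|eA] := boolP (e \in A_edges black H).
- have v0 : val (mate black H e end0) = 1 by rewrite /mate eA.
  have v2 : val (mate black H e end2) = 3 by rewrite /mate eA.
  rewrite (o _ end1 v0) in m0; rewrite (o _ end3 v2) in m2.
  case: k => -[|[|[|[|]]]] //= lt_k.
  + by rewrite (o (Ordinal lt_k) end0) // (o (opp (Ordinal lt_k)) end2) // !r.
  + by rewrite (o (Ordinal lt_k) end1) // (o (opp (Ordinal lt_k)) end3) // m0 m2 ?orbT.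
  + by rewrite (o (Ordinal lt_k) end2) // (o (opp (Ordinal lt_k)) end0) // !r ?orbT.
  + by rewrite (o (Ordinal lt_k) end3) // (o (opp (Ordinal lt_k)) end1) // m0 m2 ?orbT.
- have v0 : val (mate black H e end0) = 3 by rewrite /mate (negPf eA).
  have v2 : val (mate black H e end2) = 1 by rewrite /mate (negPf eA).
  rewrite (o _ end3 v0) in m0; rewrite (o _ end1 v2) in m2.
  case: k => -[|[|[|[|]]]] //= lt_k.
  + by rewrite (o (Ordinal lt_k) end0) // (o (opp (Ordinal lt_k)) end2) // !r.
  + by rewrite (o (Ordinal lt_k) end1) // (o (opp (Ordinal lt_k)) end3) // m0 m2 ?orbT.
  + by rewrite (o (Ordinal lt_k) end2) // (o (opp (Ordinal lt_k)) end0) // !r ?orbT.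
  + by rewrite (o (Ordinal lt_k) end3) // (o (opp (Ordinal lt_k)) end1) // m0 m2 ?orbT.
Qed.

Lemma same_circle_opp H e k : same_circle black H (arc_at e k) (arc_at e (opp k)) =
  same_circle black H (ae e) (be e).
Proof.
have [r s t] := same_circle_equiv H.
have tr u v w : same_circle black H u v -> same_circle black H v w ->
  same_circle black H u w by apply: t.
case/orP: (opposite_ends H e k) => /andP[a b]; apply/idP/idP => h.
- by apply: tr a (tr _ _ _ h _); rewrite s.
- by rewrite s in a; apply: tr a (tr _ _ _ h _).
- by apply: tr a (tr _ (arc_at e k) _ _ _); rewrite s.
- by rewrite s; rewrite s in a; apply: tr a (tr _ _ _ h _).
Qed.

Lemma glue_opp H e k : glue (same_circle black H) (arc_at e k) (arc_at e (opp k)) =2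
  glue (same_circle black H) (ae e) (be e).
Proof.
have eq := same_circle_equiv H; have [r s t] := eq => x y.
case/orP: (opposite_ends H e k) => /andP[a b]; last rewrite glueC //.
  by apply: eq_glue_ends => //; rewrite s.
by apply: eq_glue_ends => //; rewrite s.
Qed.

Lemma leaving_end e : exists2 k, ~~ leaving e k & arc_at e k != arc_at e (opp k).
Proof.
have [k nl] : exists k, ~~ leaving e k.
  have [l|] := boolP (leaving e end0); last by exists end0.
  by exists (ordS end0); rewrite leavingS l.
exists k => //; apply/eqP => /leaving_inj; rewrite !leavingS negbK => /(_ erefl)[].
by move/(congr1 val); case: k {nl} => -[|[|[|[|]]]].
Qed.

(** The two entering ends of e lie on different arcs, so toggling multiplies by a genuine
    transposition. The coherent orientation coming from the colouring is what excludes a surgery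
    turning one circle into one circle. *)
Theorem toggle_split H e :
  same_circle black (toggle H e) (ae e) (be e) = ~~ same_circle black H (ae e) (be e).
Proof.
have [k nl ne] := leaving_end e; rewrite -!(same_circle_opp _ _ k).
by rewrite !same_circle_cycle (next_toggle _ nl) same_cycle_surgery.
Qed.

Theorem toggle_merge H e : ~~ same_circle black H (ae e) (be e) ->
  same_circle black (toggle H e) =2 glue (same_circle black H) (ae e) (be e).
Proof.
have [k nl ne] := leaving_end e; rewrite -!(same_circle_opp _ _ k) => nsc x y.
rewrite -(glue_opp _ _ k) same_circle_cycle (next_toggle _ nl) same_cycle_merge //.
  by rewrite /glue -!same_circle_cycle.
by rewrite -same_circle_cycle.
Qed.

Lemma toggleK H e : toggle (toggle H e) e = H.
Proof. by apply/setP=> f; rewrite !in_toggle -addbA addbb addbF. Qed.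

Lemma toggle_unmerge H e : same_circle black H (ae e) (be e) ->
  same_circle black H =2 glue (same_circle black (toggle H e)) (ae e) (be e).
Proof.
move=> sc x y; rewrite -{1}[H](toggleK H e); apply: toggle_merge.
by rewrite toggle_split sc.
Qed.

End Circles.

(** * The Khovanov complex *)

Local Open Scope ring_scope.

Section Khovanov.

Variables (L : diagram) (black : pred (side L)).
Hypotheses (oriented : well_oriented L) (coloured : checkerboard black).
Implicit Types (e f : crossing L) (a b c : link_arc L) (H : {set crossing L}).
Implicit Types (w : seq (link_arc L)) (s : enhanced black).

Local Notation sc := (same_circle black).
Local Notation ae := (fun e => arc_at e end0).
Local Notation be := (fun e => arc_at e end2).
Local Notation equiv_sc := (same_circle_equiv oriented coloured).

Lemma sc_refl H a : sc H a a. Proof. by case: (equiv_sc H). Qed.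
Lemma sc_sym H a b : sc H a b = sc H b a. Proof. by case: (equiv_sc H). Qed.
Lemma sc_trans H a b c : sc H a b -> sc H b c -> sc H a c.
Proof. by case: (equiv_sc H) => _ _ t; apply: t. Qed.

Lemma sc_left H a b c : sc H a b -> sc H a c = sc H b c.
Proof.
by move=> ab; apply/idP/idP; apply: sc_trans; rewrite // sc_sym.
Qed.

Lemma label_sc s a b : sc (subgraph s) a b -> label s a = label s b.
Proof. by move=> ab; have /forallP/(_ a)/forallP/(_ b)/implyP/(_ ab)/eqP := valP s. Qed.

(* The monomial given by a list w of arcs, each standing for a label x on its  *)
(* circle, is the basis element s, a square of x being zero.                   *)
Definition monomial H w s : bool :=
  [forall c, count (sc H c) w == label s c :> nat].

Lemma monomialP H w s :
  reflect (forall c, count (sc H c) w = label s c :> nat) (monomial H w s).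
Proof. by apply: (iffP forallP) => h c; apply/eqP; rewrite ?h. Qed.

Lemma eq_count_sc H w a b : sc H a b -> count (sc H a) w = count (sc H b) w.
Proof. by move=> ab; apply: eq_count => c; apply: sc_left. Qed.

Lemma monomial_exists H w : (forall c, count (sc H c) w <= 1)%N ->
  exists2 s, subgraph s = H & monomial H w s.
Proof.
move=> le1; pose l := [ffun c => (count (sc H c) w == 1)%N].
have es : is_enhanced black (H, l).
  apply/forallP=> a; apply/forallP=> b; apply/implyP=> /= ab.
  by rewrite !ffunE (eq_count_sc _ ab).
exists (Sub (H, l) es) => //; apply/monomialP=> c.
by rewrite /label /= ffunE; have := le1 c; case: count => [|[]].
Qed.

Lemma monomial_uniq H w s s' : subgraph s = H -> subgraph s' = H ->
  monomial H w s -> monomial H w s' -> s = s'.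
Proof.
move=> sH s'H /monomialP ms /monomialP ms'; apply/val_inj.
rewrite [val s]surjective_pairing [val s']surjective_pairing.
congr (_, _); first exact: etrans sH (esym s'H).
apply/ffunP=> c; have := ms c; rewrite ms' /label.
by case: (_ c) (_ c) => -[].
Qed.

Lemma monomial_cons_sc H w s a b : sc H a b -> monomial H (a :: w) s = monomial H (b :: w) s.
Proof.
by move=> ab; apply: eq_forallb => c /=; rewrite ![sc H c _]sc_sym (sc_left _ ab).
Qed.

Lemma monomial_swap H w s a b : monomial H [:: a, b & w] s = monomial H [:: b, a & w] s.
Proof. by apply: eq_forallb => c /=; rewrite addnCA. Qed.

(** The choice depends only on the set of arcs of the circle, so it is the same for all of them. The
    default is never reached, a being on its own circle. *)
Definition canonical_arc H a := odflt a [pick b | sc H a b].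

Lemma canonical_arc_sc H a : sc H a (canonical_arc H a).
Proof. by rewrite /canonical_arc; case: pickP => //= _; apply: sc_refl. Qed.

Lemma eq_canonical_arc H a b : sc H a b -> canonical_arc H a = canonical_arc H b.
Proof.
move=> ab; rewrite /canonical_arc (eq_pick (fun c => sc_left c ab)).
by case: pickP => //= /(_ b); rewrite sc_refl.
Qed.

Lemma state_monomial s : exists w, monomial (subgraph s) w s.
Proof.
set H := subgraph s.
exists [seq a <- enum (link_arc L) | label s a && (canonical_arc H a == a)].
apply/monomialP=> c; rewrite count_filter.
have e : predI (sc H c) (fun a => label s a && (canonical_arc H a == a)) =1
    predI (pred1 (canonical_arc H c)) (fun a => label s c).
  move=> a /=; apply/and3P/andP => [[ca la /eqP ra]|[/eqP-> lc]].
    by rewrite (label_sc ca) la -ra (eq_canonical_arc ca).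
  have cr := canonical_arc_sc H c.
  by rewrite cr -(label_sc cr) lc -(eq_canonical_arc cr).
rewrite (eq_count e); case: (label s c); last first.
  by rewrite (@eq_count _ _ pred0) ?count_pred0 // => a /=; rewrite andbF.
rewrite (@eq_count _ _ (pred1 (canonical_arc H c))) => [|a /=]; last by rewrite andbT.
by rewrite count_uniq_mem ?enum_uniq // mem_enum.
Qed.

Lemma count_glue H H' w a b c : ~~ sc H a b -> sc H' =2 glue (sc H) a b ->
  count (sc H' c) w = if sc H a c || sc H b c then (count (sc H a) w + count (sc H b) w)%N
                      else count (sc H c) w.
Proof.
move=> nab H'E; elim: w => [|d w IH] /=; first by case: ifP.
rewrite IH H'E /glue [sc H c a]sc_sym [sc H c b]sc_sym.
have nad : ~~ (sc H a d && sc H b d).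
  by apply: contraNN nab => /andP[ad bd]; apply: sc_trans ad _; rewrite sc_sym.
case ac: (sc H a c); case bc: (sc H b c) => /=.
- by case/negP: nab; apply: sc_trans ac _; rewrite sc_sym.
- rewrite -(sc_left d ac); move: nad; case: (sc H a d); case: (sc H b d) => //= _; lia.
- rewrite -(sc_left d bc) orbC; move: nad; case: (sc H a d); case: (sc H b d) => //= _; lia.
- by rewrite orbF.
Qed.

(** Sign and direction of the toggle are left out: that two surgeries commute concerns the Frobenius
    algebra alone, and the signs are treated separately. *)
Definition local_coef s s' e : int :=
  let H := subgraph s in
  if (subgraph s' == toggle H e) &&
     [forall c, (~~ sc H (ae e) c && ~~ sc H (be e) c) ==> (label s' c == label s c)]
  then if sc H (ae e) (be e)
       then Delta_coef (label s (ae e)) (label s' (ae e)) (label s' (be e))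
       else m_coef (label s (ae e)) (label s (be e)) (label s' (ae e))
  else 0.

(* The images of a monomial w under a merge (w itself), and under a split of   *)
(* the circle through a and b (where Delta is the multiplication by a + b).    *)
Definition expand H e w : seq (seq (link_arc L)) :=
  if sc H (ae e) (be e) then [:: ae e :: w; be e :: w] else [:: w].

(** States on H are the square-free monomials in the arcs, where arcs on one circle are identified
    and squares vanish. A merge is then a quotient map, and a split multiplies by a + b, which gives
    a + b on 1 and ab on x. *)
Lemma local_coef_monomial s s' e w :
  subgraph s' = toggle (subgraph s) e -> monomial (subgraph s) w s ->
  local_coef s s' e = \sum_(v <- expand (subgraph s) e w) (monomial (subgraph s') v s')%:R.
Proof.
move=> s'E ms; rewrite /local_coef /expand s'E eqxx /=.
have ls := @label_sc s; have ls' := @label_sc s'; rewrite s'E in ls'.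
move: ms ls ls'; set H := subgraph s; set H' := toggle H e => /monomialP ms ls ls'.
set a := ae e; set b := be e.
have unaffectedP : reflect (forall c, ~~ sc H a c -> ~~ sc H b c -> label s' c = label s c)
    [forall c, (~~ sc H a c && ~~ sc H b c) ==> (label s' c == label s c)].
  apply: (iffP forallP) => h c; first by move=> ac bc; have := h c; rewrite ac bc => /eqP.
  by apply/implyP=> /andP[ac bc]; rewrite h.
have nat_eq (x y : bool) : (x = y :> nat) -> x = y by case: x; case: y.
case: (boolP (sc H a b)) => sab; last first.
  have gl := toggle_merge oriented coloured sab; rewrite big_seq1.
  have cE c : count (sc H' c) w = if sc H a c || sc H b c then (label s a + label s b)%N else label s c.
    by rewrite (count_glue _ _ sab gl) !ms.
  have aff c : sc H a c || sc H b c -> label s' c = label s' a.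
    by move=> ac; apply: ls'; rewrite gl /glue sc_refl ![sc H c _]sc_sym orbC -!orbA; 
       case/orP: ac => ->; rewrite ?orbT.
  have -> : monomial H' w s' = [forall c, (~~ sc H a c && ~~ sc H b c) ==> (label s' c == label s c)]
       && ((label s a + label s b)%N == label s' a).
    apply/monomialP/andP => [ms'|[/unaffectedP un /eqP sum] c].
      split; last by rewrite -ms' cE sc_refl.
      by apply/unaffectedP=> c /negPf ac /negPf bc; apply: nat_eq; rewrite -ms' cE ac bc.
    rewrite cE; case: ifP => [/aff ->//|/norP[ac bc]].
    by rewrite un.
  by case: ifP => //= _; case: (label s a) (label s b) (label s' a) => -[] [].
have nsab : ~~ sc H' a b by rewrite toggle_split ?sab.
have gl : sc H =2 glue (sc H') a b by apply: toggle_unmerge.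
have affE c : sc H' a c || sc H' b c = sc H a c.
  by rewrite gl /glue sc_refl (negPf nsab) ?orbF /= ?orbF sc_sym [sc H' b c]sc_sym; case: (sc H' c a).
have cE c : (if sc H a c then (count (sc H' a) w + count (sc H' b) w)%N else count (sc H' c) w) = label s c.
  by rewrite -ms (count_glue _ _ nsab gl) affE.
have bc_ac c : sc H b c = sc H a c by rewrite (sc_left _ sab).
pose un := [forall c, (~~ sc H a c && ~~ sc H b c) ==> (label s' c == label s c)].
have mE v : (forall c, ~~ sc H a c -> count (sc H' c) v = count (sc H' c) w) ->
    monomial H' v s' = [&& un, count (sc H' a) v == label s' a & count (sc H' b) v == label s' b].
  move=> vw; apply/monomialP/and3P => [ms'|[/unaffectedP un_ /eqP va /eqP vb] c].
    split; [|by apply/eqP|by apply/eqP]; apply/unaffectedP=> c ac _.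
    by apply: nat_eq; rewrite -ms' vw // -cE (negPf ac).
  have [ac|ac] := boolP (sc H a c); last by rewrite un_ ?bc_ac // -cE (negPf ac) vw.
  by move: ac; rewrite -affE => /orP[] h; rewrite -(ls' _ _ h) -(eq_count_sc _ h).
rewrite big_cons big_seq1 !mE => [|c|c]; last 2 first.
- by rewrite -affE => /norP[_ /negPf bc]; rewrite /= sc_sym bc.
- by rewrite -affE => /norP[/negPf ac _]; rewrite /= sc_sym ac.
rewrite -/un /= !sc_refl [sc H' b a]sc_sym (negPf nsab) !add0n.
have := cE a; rewrite sc_refl; move: (count _ _) (count _ _) => p q.
move: {mE} un => [] //=; case: (label s a) (label s' a) (label s' b) p q => -[] [] [|[|p]] [|[|q]] //=.
Qed.

(** A monomial containing a square on H is zero and stands for no state. Its images then vanish too,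
    so that [sum_monomial] misses nothing when it sums over actual states. *)
Lemma expand_squarefree H e v u s' : u \in expand H e v ->
  monomial (toggle H e) u s' -> forall c, (count (sc H c) v <= 1)%N.
Proof.
rewrite /expand; case: (boolP (sc H (ae e) (be e))) => sab; last first.
  rewrite inE => /eqP-> /monomialP m c.
  apply: (@leq_trans (count (sc (toggle H e) c) v)); last by rewrite m; case: (label _ _).
  by apply: sub_count => d cd; rewrite (toggle_merge oriented coloured sab) /glue cd.
set H' := toggle H e; have nsab : ~~ sc H' (ae e) (be e) by rewrite toggle_split ?sab.
have gl : sc H =2 glue (sc H') (ae e) (be e) by apply: toggle_unmerge.
have le1 (b : bool) : (b <= 1)%N by case: b.
rewrite !inE => uE /monomialP m c; rewrite (count_glue _ _ nsab gl).
have ma := m (ae e); have mb := m (be e); have mc := m c.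
have {}ma := leq_trans (eq_leq ma) (le1 _); have {}mb := leq_trans (eq_leq mb) (le1 _).
have {}mc := leq_trans (eq_leq mc) (le1 _).
case/orP: uE ma mb mc => /eqP -> /=; rewrite sc_refl ?[sc H' (be e) (ae e)]sc_sym (negPf nsab);
  case: ifP => _; lia.
Qed.

Lemma sum_monomial H f v s' : subgraph s' = toggle H f ->
  \sum_(s : enhanced black | subgraph s == H) (monomial H v s)%:R * local_coef s s' f
  = \sum_(u <- expand H f v) (monomial (toggle H f) u s')%:R.
Proof.
move=> s'E; have [/existsP[s0 /andP[/eqP s0H m0]]|none] :=
    boolP [exists s, (subgraph s == H) && monomial H v s].
  rewrite (bigD1 s0) ?s0H //= m0 mul1r big1 => [|s /andP[/eqP sH ss0]].
    have e0 : subgraph s' = toggle (subgraph s0) f by rewrite s0H.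
    have m0' : monomial (subgraph s0) v s0 by rewrite s0H.
    by rewrite addr0 (local_coef_monomial e0 m0') s'E s0H.
  case m: (monomial H v s); last by rewrite mul0r.
  by rewrite (monomial_uniq sH s0H m m0) eqxx in ss0.
rewrite big1 => [|s /eqP sH].
  apply/esym; rewrite big_seq big1 // => u uE; case m: (monomial _ u s') => //.
  have [s sH ms] := monomial_exists (expand_squarefree uE m).
  by case/existsP: none; exists s; rewrite sH eqxx.
case m: (monomial H v s); last by rewrite mul0r.
by case/existsP: none; exists s; rewrite sH eqxx.
Qed.

Lemma local_coef_comp s s'' e f w :
  subgraph s'' = toggle (toggle (subgraph s) e) f -> monomial (subgraph s) w s ->
  \sum_s' local_coef s s' e * local_coef s' s'' f
  = \sum_(v <- expand (subgraph s) e w) \sum_(u <- expand (toggle (subgraph s) e) f v)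
      (monomial (subgraph s'') u s'')%:R.
Proof.
move=> s''E m; rewrite (bigID (fun s' => subgraph s' == toggle (subgraph s) e)) /=.
rewrite addrC big1 ?add0r => [|s' /negPf ne]; last by rewrite /local_coef ne mul0r.
under eq_bigr => s' /eqP s'E do rewrite (local_coef_monomial s'E m) s'E big_distrl /=.
by rewrite exchange_big; apply: eq_bigr => v _; rewrite (sum_monomial v s''E) -s''E.
Qed.

Lemma toggleC H e f : toggle (toggle H e) f = toggle (toggle H f) e.
Proof. by apply/setP=> g; rewrite !in_toggle addbAC. Qed.

Lemma n_classes_toggle H e (m := sc H (ae e) (be e)) :
  (n_classes (sc (toggle H e)) + ~~ m = n_classes (sc H) + m)%N.
Proof.
rewrite /m; case: (boolP (sc H (ae e) (be e))) => sab; last first.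
  rewrite (eq_n_classes (toggle_merge oriented coloured sab)).
  by rewrite (n_classes_glue (equiv_sc H) sab) addn1 addn0.
have nsab : ~~ sc (toggle H e) (ae e) (be e) by rewrite toggle_split ?sab.
rewrite (n_classes_glue (equiv_sc _) nsab) addn0 addn1; congr _.+1.
by apply: eq_n_classes => x y; rewrite -toggle_unmerge.
Qed.

Lemma glue_new H a b c d : ~~ sc H c d -> glue (sc H) a b c d ->
  (sc H a c && sc H b d) || (sc H a d && sc H b c).
Proof.
rewrite /glue => /negPf-> /=; rewrite [sc H c a]sc_sym [sc H c b]sc_sym.
by case/orP=> /andP[-> ->]; rewrite ?orbT.
Qed.

(* When the surgeries at e and f do not keep their type upon being exchanged,  *)
(* they act on the same pair of circles.                                       *)
Lemma crossed_surgeries H e f (H2 := toggle (toggle H e) f) :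
  sc H (ae e) (be e) != sc (toggle H f) (ae e) (be e) ->
  sc H (ae f) (be f) != sc (toggle H e) (ae f) (be f) ->
  (sc H2 (ae e) (ae f) && sc H2 (be e) (be f)) ||
  (sc H2 (ae e) (be f) && sc H2 (be e) (ae f)).
Proof.
move=> ne_e ne_f; have [nef|ef] := boolP (sc (toggle H e) (ae f) (be f)).
  have nf : ~~ sc H (ae f) (be f) by move: ne_f; rewrite nef; case: (sc H _ _).
  have nf2 : ~~ sc H2 (ae f) (be f) by rewrite toggle_split ?nef.
  have fe : sc (toggle H f) (ae e) (be e).
    have := ne_e; have := n_classes_toggle H e; have := n_classes_toggle H f.
    have := n_classes_toggle (toggle H e) f; have := n_classes_toggle (toggle H f) e.
    rewrite [toggle (toggle H f) e]toggleC nef (negPf nf) /=.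
    by case: (sc H (ae e) (be e)); case: (sc _ (ae e) (be e)) => //=; lia.
  apply: glue_new nf2 _; rewrite /H2 toggleC -(toggle_unmerge oriented coloured fe).
  by rewrite toggle_split.
have ff : sc H (ae f) (be f) by move: ne_f; rewrite (negPf ef); case: (sc H _ _).
have ee : sc H (ae e) (be e).
  have := ne_e; have := n_classes_toggle H e; have := n_classes_toggle H f.
  have := n_classes_toggle (toggle H e) f; have := n_classes_toggle (toggle H f) e.
  rewrite [toggle (toggle H f) e]toggleC (negPf ef) ff /=.
  by case: (sc H (ae e) (be e)); case: (sc _ (ae e) (be e)) => //=; lia.
have := ff; rewrite (toggle_unmerge oriented coloured ee) => /(glue_new ef).
have sub u v : sc (toggle H e) u v -> sc H2 u v.
  by move=> uv; rewrite (toggle_merge oriented coloured ef) /glue uv.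
by case/orP=> /andP[/sub-> /sub->]; rewrite ?orbT.
Qed.

Lemma expand_comm H e f s w : subgraph s = toggle (toggle H e) f ->
  \sum_(v <- expand H e w) \sum_(u <- expand (toggle H e) f v) (monomial (subgraph s) u s)%:R
  = \sum_(v <- expand H f w) \sum_(u <- expand (toggle H f) e v) (monomial (subgraph s) u s)%:R :> int.
Proof.
move=> sE; have := @crossed_surgeries H e f; rewrite -sE; set H2 := subgraph s => cross.
have := n_classes_toggle H e; have := n_classes_toggle H f.
have := n_classes_toggle (toggle H e) f; have := n_classes_toggle (toggle H f) e.
rewrite [toggle (toggle H f) e]toggleC /expand; move: cross.
have sw a b := monomial_swap H2 w s a b.
(* The final number of circles does not depend on the order, so both orders have equally many
   splits; [lia] discards the other cases. Three cases stay nontrivial: two splits in both orders,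
   settled by reordering the factors, and the two cases where both surgeries change type, settled by
   [crossed_surgeries]. *)
case: (sc H (ae e) (be e)); case: (sc (toggle H e) (ae f) (be f));
  case: (sc H (ae f) (be f)); case: (sc (toggle H f) (ae e) (be e)) => //= cross;
  rewrite ?(big_cons, big_nil) ?addr0 //; try by clear; lia.
- by move=> _ _ _ _; rewrite (sw (ae e)) (sw (ae e)) (sw (be e)) (sw (be e)) addrACA.
- move=> _ _ _ _; case/orP: (cross isT isT) => /andP[h1 h2].
    by rewrite (monomial_cons_sc _ _ h1) (monomial_cons_sc _ _ h2).
  by rewrite (monomial_cons_sc _ _ h1) (monomial_cons_sc _ _ h2) addrC.
- move=> _ _ _ _; case/orP: (cross isT isT) => /andP[h1 h2].
    by rewrite (monomial_cons_sc _ _ h1) (monomial_cons_sc _ _ h2).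
  by rewrite (monomial_cons_sc _ _ h1) (monomial_cons_sc _ _ h2) addrC.
Qed.

Lemma local_coef_comm s s'' e f :
  \sum_s' local_coef s s' e * local_coef s' s'' f =
  \sum_s' local_coef s s' f * local_coef s' s'' e.
Proof.
have [s''E|ne] := eqVneq (subgraph s'') (toggle (toggle (subgraph s) e) f).
  have [w m] := state_monomial s; rewrite (local_coef_comp s''E m).
  have s''E' : subgraph s'' = toggle (toggle (subgraph s) f) e by rewrite toggleC.
  by rewrite (local_coef_comp s''E' m) expand_comm.
have z g g' : subgraph s'' != toggle (toggle (subgraph s) g) g' ->
    \sum_s' local_coef s s' g * local_coef s' s'' g' = 0.
  move=> ne'; rewrite big1 // => s' _; rewrite /local_coef.
  have [s'E|] := eqVneq (subgraph s') (toggle (subgraph s) g); last by rewrite mul0r.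
  by rewrite -s'E in ne'; rewrite (negPf ne') mulr0.
by rewrite !z // toggleC.
Qed.

End Khovanov.

(** * Signs, degrees and the reduced complex *)

Section KhovanovComplex.

Variables (L : diagram) (black : pred (side L)) (le : rel (crossing L)) (dot : link_arc L).
Hypotheses (oriented : well_oriented L) (coloured : checkerboard black).
Hypothesis le_total : total_order le.
Implicit Types (e f : crossing L) (a b c : link_arc L) (H : {set crossing L}).
Implicit Types (w : seq (link_arc L)) (s : enhanced black).

Local Notation sc := (same_circle black).
Local Notation ae := (fun e => arc_at e end0).
Local Notation be := (fun e => arc_at e end2).
Local Notation equiv_sc := (same_circle_equiv oriented coloured).
Local Notation A := (A_edges black).
Local Notation sgn := (sign_exponent black le).

Lemma edge_coefE s s' e : edge_coef le s s' e =
  if e \in A (subgraph s) then (-1) ^+ sgn (subgraph s) e * local_coef s s' e else 0.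
Proof.
rewrite /edge_coef /local_coef; case: (e \in _) => //=.
by case: ifP; rewrite ?mulr0.
Qed.

Lemma local_coef_subgraph s s' e : local_coef s s' e != 0 ->
  subgraph s' = toggle (subgraph s) e.
Proof. by rewrite /local_coef; case: ifP => [/andP[/eqP]|]; rewrite ?eqxx. Qed.

(** Toggling e takes it out of the A-edges, which raises the exponents of the larger edges only. Of
    two distinct edges exactly one is the larger, so the two orders of toggling get opposite
    signs. *)
Lemma sgn_toggle H e f : e \in A H -> e != f ->
  sgn (toggle H e) f = (le e f + sgn H f)%N.
Proof.
move=> eA ef; rewrite /sign_exponent.
have e_notin : e \notin [set g | [&& le g f, g != f & g \notin A H]].
  by rewrite inE eA !andbF.
case lef: (le e f); last rewrite add0n; last first.
  apply: eq_card => g; rewrite !inE -[_ == pos_edge _ _]in_A_edges.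
  rewrite -[(g \in H) == _]in_A_edges A_edges_toggle.
  by have [->|] := eqVneq g e; rewrite ?lef ?addbF.
rewrite -{1}e_notin -cardsU1; apply: eq_card => g.
rewrite in_setU1 !inE -[_ == pos_edge _ _]in_A_edges -[(g \in H) == _]in_A_edges A_edges_toggle.
by have [->|] := eqVneq g e; rewrite ?lef ?eA ?ef ?addbF.
Qed.

Lemma edge_coef_anticomm s s'' e f : e != f ->
  \sum_s' edge_coef le s s' e * edge_coef le s' s'' f =
  - \sum_s' edge_coef le s s' f * edge_coef le s' s'' e.
Proof.
have comp g g' : g != g' -> \sum_s' edge_coef le s s' g * edge_coef le s' s'' g' =
    if (g \in A (subgraph s)) && (g' \in A (subgraph s)) then
      (-1) ^+ (sgn (subgraph s) g + sgn (subgraph s) g' + le g g')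
      * \sum_s' local_coef s s' g * local_coef s' s'' g' else 0.
  move=> gg'; have [gA|gA] := boolP (g \in A (subgraph s)); last first.
    by rewrite big1 // => s' _; rewrite edge_coefE (negPf gA) mul0r.
  rewrite /=; have [g'A|g'A] := boolP (g' \in A (subgraph s)); last first.
    rewrite big1 // => s' _; rewrite !edge_coefE gA.
    have [->|/local_coef_subgraph ->] := eqVneq (local_coef s s' g) 0.
      by rewrite mulr0 mul0r.
    by rewrite A_edges_toggle (negPf g'A) eq_sym (negPf gg') mulr0.
  rewrite big_distrr; apply: eq_bigr => s' _ /=; rewrite !edge_coefE gA.
  have [->|/local_coef_subgraph ->] := eqVneq (local_coef s s' g) 0.
    by rewrite mulr0 !mul0r mulr0.
  rewrite A_edges_toggle g'A [g' == g]eq_sym (negPf gg') sgn_toggle //.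
  by rewrite mulrACA -exprD -addnA [in RHS](addnC (sgn _ g')).
move=> ef; rewrite !comp // 1?eq_sym // andbC; case: ifP => _; last by rewrite oppr0.
rewrite (local_coef_comm oriented coloured) -mulNr; congr (_ * _).
rewrite (addnC (sgn _ f)); have: le e f = ~~ le f e.
  have := total_le_total le_total e f; case ef1: (le e f); case fe1: (le f e) => //= _.
  by rewrite (total_le_anti le_total ef1 fe1) eqxx in ef.
by move->; case: (le f e); rewrite !exprD ?expr0 ?expr1 ?mulrN1 ?mulr1 ?opprK.
Qed.

Lemma edge_coef_sq s s'' e : \sum_s' edge_coef le s s' e * edge_coef le s' s'' e = 0.
Proof.
rewrite big1 // => s' _; rewrite !edge_coefE; case: ifP => eA; last by rewrite mul0r.
have [->|/local_coef_subgraph ->] := eqVneq (local_coef s s' e) 0.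
  by rewrite mulr0 mul0r.
by rewrite A_edges_toggle eA eqxx mulr0.
Qed.

Lemma CKh_sq (s s'' : enhanced black) :
  \sum_s' (\sum_e edge_coef le s s' e) * (\sum_e edge_coef le s' s'' e) = 0.
Proof.
pose X e f := \sum_s' edge_coef le s s' e * edge_coef le s' s'' f.
have -> : \sum_s' (\sum_e edge_coef le s s' e) * (\sum_e edge_coef le s' s'' e)
    = \sum_e \sum_f X e f.
  under eq_bigr do rewrite big_distrl /=.
  rewrite exchange_big; apply: eq_bigr => e _ /=; rewrite /X exchange_big.
  by apply: eq_bigr => s' _; rewrite big_distrr.
have XN e f : X e f = - X f e.
  have [->|ef] := eqVneq e f; first by rewrite /X edge_coef_sq oppr0.
  exact: edge_coef_anticomm.
have : \sum_e \sum_f X e f = - \sum_e \sum_f X e f.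
  rewrite [in LHS]exchange_big -sumrN; apply: eq_bigr => e _.
  by rewrite -sumrN; apply: eq_bigr => f _.
by move: (\sum_e _) => x; lia.
Qed.

Lemma i_degE s : i_deg s = #|~: A (subgraph s)|%:Z - (n_minus L)%:Z.
Proof.
rewrite /i_deg -PoszD -cardsUI; congr (Posz _ - _).
rewrite [X in (_ + X)%N](_ : _ = 0%N) ?addn0.
  apply: eq_card => e; rewrite !inE.
  by case: (pos_edge _ e); case: (e \in _).
by apply: eq_card0 => e; rewrite !inE; case: (pos_edge _ e); case: (e \in _).
Qed.

Lemma card_A_toggle H e : e \in A H -> #|~: A (toggle H e)| = #|~: A H|.+1.
Proof.
move=> eA; have -> : ~: A (toggle H e) = e |: ~: A H.
  apply/setP=> f; rewrite in_setU1 !in_setC A_edges_toggle.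
  by have [->|] := eqVneq f e; rewrite ?eA ?addbF.
by rewrite cardsU1 in_setC eA.
Qed.

Lemma facesE H C : reflect (exists a, C = circle black H a) (C \in faces black H).
Proof. by apply: (iffP imsetP) => [[a _ ->]|[a ->]]; exists a. Qed.

Lemma circle_label s a l :
  [forall b in circle black (subgraph s) a, label s b == l] = (label s a == l).
Proof.
apply/forallP/idP => [/(_ a)|la b]; first by rewrite inE sc_refl.
by apply/implyP; rewrite inE => ab; rewrite -(label_sc ab).
Qed.

Lemma n_label_total s : (n_label s lab1 + n_label s labx)%N = n_classes (sc (subgraph s)).
Proof.
rewrite -[RHS](cardsID [set C : {set link_arc L} | [forall a in C, label s a == labx]]) addnC.
congr (_ + _)%N; apply: eq_card => C; rewrite !inE; first by [].
rewrite andbC; case: facesE => [[a ->]|]; rewrite ?andbF // !andbT !circle_label.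
by case: (label s a).
Qed.

Lemma n_label_monomial w s : monomial (subgraph s) w s -> n_label s labx = size w.
Proof.
move=> /monomialP m; set H := subgraph s in m *.
have sub a : a \in w -> label s a.
  move=> aw; suff : (0 < count (sc H a) w)%N by rewrite m; case: (label s a).
  by rewrite -has_count; apply/hasP; exists a => //; apply: sc_refl.
have w_inj a b : a \in w -> b \in w -> sc H a b -> a = b.
  move=> aw bw ab; apply/eqP; apply: contraT => nab.
  have : (count (sc H a) w <= 1)%N by rewrite m; case: (label s a).
  rewrite leqNgt; apply: contraNT => _.
  apply: leq_trans (_ : size [:: a; b] <= _)%N => //.
  rewrite -size_filter; apply: uniq_leq_size; first by rewrite /= inE nab.
  by move=> c; rewrite !inE mem_filter => /orP[]/eqP->; rewrite ?sc_refl ?ab ?aw ?bw.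
have uw : uniq w.
  apply: count_mem_uniq => a; have [aw|/count_memPn->//] := boolP (a \in w).
  apply/eqP; rewrite eqn_leq -has_count has_pred1 aw andbT.
  apply: leq_trans (_ : count (sc H a) w <= 1)%N; last by rewrite m; case: (label s a).
  by apply: sub_count => b /= /eqP->; apply: sc_refl.
rewrite -(card_uniqP uw) -(card_in_imset (f := circle black H)).
  apply: eq_card => C; rewrite inE; apply/andP/imsetP => [[/facesE[a ->]]|[a aw ->]].
    rewrite circle_label => /eqP la.
    have : (0 < count (sc H a) w)%N by rewrite m la.
    rewrite -has_count => /hasP[b bw ab]; exists b => //; exact: circle_eq.
  by rewrite circle_label sub //; split=> //; apply/facesE; exists a.
move=> a b aw bw e; apply: w_inj => //.
by have : b \in circle black H b by [rewrite inE sc_refl]; rewrite -e inE.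
Qed.

Lemma coef_nz s s' : @coef (CKh black le) s s' != 0 ->
  exists e, [/\ e \in A (subgraph s), subgraph s' = toggle (subgraph s) e & local_coef s s' e != 0].
Proof.
move=> nz; have [e] : exists e, edge_coef le s s' e != 0.
  apply/existsP; apply: contraNT nz; rewrite negb_exists => /forallP z.
  by rewrite /= big1 // => e _; apply/eqP; have := z e; rewrite negbK.
rewrite edge_coefE; case: ifP; rewrite ?eqxx // => eA; rewrite mulf_eq0 negb_or.
by case/andP=> _ nz'; exists e; rewrite (local_coef_subgraph nz').
Qed.

(** The labels contribute the number of circles minus twice the length of the monomial. A split adds
    one circle and one variable, a merge removes one circle; both lower this number by one, which
    offsets the rise of i. *)
Lemma CKh_degrees s s' : @coef (CKh black le) s s' != 0 ->
  i_deg s' = i_deg s + 1 /\ j_deg s' = j_deg s.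
Proof.
case/coef_nz=> e [eA s'E nz]; have ie : i_deg s' = i_deg s + 1.
  by rewrite !i_degE s'E card_A_toggle // addrAC -addn1 PoszD.
split=> //; rewrite /j_deg ie; have [w m] := state_monomial oriented coloured s.
have [v [vE mv]] : exists v, v \in expand black (subgraph s) e w /\ monomial (subgraph s') v s'.
  move: nz; rewrite (local_coef_monomial oriented coloured s'E m) => nz.
  have /hasP[v vE mv] : has (fun v => monomial (subgraph s') v s') (expand black (subgraph s) e w).
    apply: contraNT nz => /hasPn none; rewrite big_seq big1 // => v /none.
    by case: (monomial _ v s').
  by exists v.
have := n_label_total s; have := n_label_total s'.
rewrite (n_label_monomial mv) (n_label_monomial m) s'E.
have := n_classes_toggle oriented coloured (subgraph s) e.
move: vE; rewrite /expand; case: ifP => _; last by rewrite inE => /eqP-> /=; lia.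
by rewrite !inE => /orP[] /eqP-> /=; lia.
Qed.

(** A label x survives every merge and split. For the dotted arc this says that the states labelled
    x there span a subcomplex, with the reduced complex as quotient. *)
Lemma local_coef_labx s s' e a : local_coef s s' e != 0 -> label s a -> label s' a.
Proof.
move=> nz la; have s'E := local_coef_subgraph nz; have ls' := @label_sc _ _ s'.
move: nz; rewrite /local_coef s'E eqxx /=; case: ifP; rewrite ?eqxx // => /forallP un.
rewrite s'E in ls'; set H := subgraph s in un ls' *.
have [aff|] := boolP (sc H (ae e) a || sc H (be e) a); last first.
  by rewrite negb_or => aff; have := un a; rewrite aff la => /eqP->.
case: (boolP (sc H (ae e) (be e))) => sab.
  have lae : label s (ae e).
    case/orP: aff => [/label_sc-> //|h]; rewrite (label_sc sab).
    by rewrite (label_sc h).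
  have : sc H a (ae e).
    case/orP: aff => h; first by rewrite sc_sym.
    rewrite sc_sym //; exact: sc_trans sab h.
  rewrite (toggle_unmerge oriented coloured sab) /glue sc_refl //.
  have nab : ~~ sc (toggle H e) (ae e) (be e) by rewrite toggle_split ?sab.
  rewrite [sc _ (be e) (ae e)]sc_sym // (negPf nab) andbF andbT /= => aff'.
  rewrite lae; have [h|h] : sc (toggle H e) a (ae e) \/ sc (toggle H e) a (be e).
    by case/orP: aff'; auto.
  - by rewrite (ls' _ _ h); case: (label s' (ae e)); case: (label s' (be e)).
  - by rewrite (ls' _ _ h); case: (label s' (ae e)); case: (label s' (be e)).
have -> : label s' a = label s' (ae e).
  apply: ls'; rewrite (toggle_merge oriented coloured sab) /glue !sc_refl //.
  by case/orP: aff => h; rewrite sc_sym // in h; rewrite h ?orbT.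
case/orP: aff => h; rewrite (label_sc h) la; first by case: (label s (be e)); case: (label s' _).
by case: (label s (ae e)); case: (label s' _).
Qed.

Lemma CKh_red_complex : is_complex (CKh_red black le dot).
Proof.
split=> [r r'|x]; first exact: CKh_degrees.
apply/ffunP=> r''; rewrite !ffunE.
under eq_bigr do rewrite ffunE big_distrl /=.
rewrite exchange_big big1 //= => r _.
under eq_bigr do rewrite -mulrA.
rewrite -big_distrr /= [X in _ * X](_ : _ = 0) ?mulr0 //.
rewrite -[RHS](CKh_sq (val r) (val r'')).
rewrite [RHS](bigID (fun s => label s dot == lab1)) /= [X in _ = _ + X]big1 ?addr0.
  rewrite [RHS](reindex_omap (val : reduced black dot -> enhanced black) insub) /=.
    by apply: eq_bigl => r'; rewrite valK eqxx (valP r').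
  by move=> s sd; rewrite insubT.
(* An intermediate state labelled x at the dot cannot lead to one labelled 1 there, so restricting
   the sum to reduced states leaves the square unchanged. *)
move=> s sx; apply/eqP; rewrite mulf_eq0; apply/orP; right.
apply: contraNT sx => /coef_nz[e [_ _ /(@local_coef_labx _ _ _ dot)]].
by have /eqP-> := valP r''; case: (label s dot) => // /(_ isT).
Qed.

End KhovanovComplex.

(** * Planarity *)

Lemma n_classes_image (T U : finType) (R : rel T) (f : T -> U) :
  (forall x y, R x y = (f x == f y)) -> n_classes R = #|[set f x | x : T]|.
Proof.
move=> Rf; pose g u := [set y | u == f y].
rewrite -(card_in_imset (f := g)) => [|_ _ /imsetP[x _ ->] /imsetP[y _ ->] e]; last first.
  have : x \in g (f x) by rewrite inE.
  by rewrite e inE => /eqP->.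
rewrite -imset_comp; congr #|pred_of_set _|; apply: eq_imset => x.
by apply/setP=> y; rewrite !inE Rf.
Qed.

Lemma connect_map (T U : finType) (e : rel T) (R : rel U) (f : T -> U) :
  reflexive R -> transitive R -> (forall x y, e x y -> R (f x) (f y)) ->
  forall x y, connect e x y -> R (f x) (f y).
Proof.
move=> r t ef x _ /connectP[p pth ->].
elim: p x pth => [|z p IH] x /=; first by rewrite r.
by case/andP=> /ef xz /IH; apply: t xz.
Qed.

Section Checkerboard.

Variables (L : diagram).
Hypothesis (oriented : well_oriented L).

Lemma side_adj_sym : symmetric (@side_adj L).
Proof.
by move=> s t; apply: eq_existsb => c; apply: eq_existsb => k; rewrite orbC.
Qed.

Lemma regionE (s t : side L) : (region s == region t) = connect (@side_adj L) s t.
Proof.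
have sym := sym_connect_sym side_adj_sym.
apply/eqP/idP => [e|st]; first by have : t \in region t by [rewrite inE connect0]; rewrite -e inE.
by apply/setP=> u; rewrite !inE; apply: same_connect.
Qed.

Section Colour.

Variable black : pred (side L).
Hypothesis coloured : checkerboard black.
Implicit Types (c e : crossing L) (k : 'I_4) (a b : link_arc L) (s t : side L).

Definition black_side_of a : side L := (a, black (a, true)).

Lemma black_black_side a : black (black_side_of a).
Proof.
rewrite /black_side_of; case e: (black (a, true)) => //.
by rewrite -[false]/(~~ true) (black_side coloured) e.
Qed.

Lemma black_sideE s : black s -> black_side_of s.1 = s.
Proof.
case: s => a [] /= bs; rewrite /black_side_of ?bs //.
by rewrite -[true]/(~~ false) (black_side coloured) bs.
Qed.

Lemma leaving_parity e k : leaving black e k = leaving black e end0 (+) odd k.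
Proof.
have S j j' : ordS j = j' -> leaving black e j' = ~~ leaving black e j.
  by move=> <-; apply: leavingS.
have l1 : leaving black e end1 = ~~ leaving black e end0 by apply: S; apply/val_inj.
have l2 : leaving black e end2 = ~~ leaving black e end1 by apply: S; apply/val_inj.
have l3 : leaving black e end3 = ~~ leaving black e end2 by apply: S; apply/val_inj.
by case: k => -[|[|[|[|]]]] //= lt_k; rewrite (bool_irrelevance lt_k isT)
  ?l3 ?l2 ?l1; case: (leaving _ _ _).
Qed.

Lemma pos_edgeE e : pos_edge black e = ~~ leaving black e end0.
Proof. by rewrite -[LHS]/(leaving black e end1) leaving_parity addbT. Qed.

Lemma mate0_leaving c k : leaving black c k -> mate black set0 c k = ordS k.
Proof.
rewrite leaving_parity /mate in_A_edges inE pos_edgeE.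
by case: (odd k); case: (leaving _ _ _).
Qed.

Lemma leaving_corner c k : leaving black c k ->
  corner c k = black_side_of (arc_at c k) /\ corner' c k = black_side_of (arc_at c (ordS k)).
Proof.
move=> l; split; first by rewrite -[LHS](black_sideE l).
rewrite -[LHS]black_sideE //; case: coloured => adj _; rewrite -(adj (corner c k)) //.
by apply/existsP; exists c; apply/existsP; exists k; rewrite eqxx.
Qed.

(** When all black corners are separated, each step along a circle passes across a black corner from
    one side of an arc to the next, so circles run around black regions. *)
Lemma same_circle0 a b :
  same_circle black set0 a b = (region (black_side_of a) == region (black_side_of b)).
Proof.
have [r sy tr] := same_circle_equiv oriented coloured set0.
rewrite regionE; apply/idP/idP.
  apply: (connect_map (f := black_side_of)) => [x|y x z|x y].
  - exact: connect0.
  - exact: connect_trans.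
  case/existsP=> c /existsP[k /andP[/eqP <- /eqP <-]].
  have step j : leaving black c j -> connect (@side_adj L) (black_side_of (arc_at c j))
      (black_side_of (arc_at c (mate black set0 c j))).
    move=> l; rewrite mate0_leaving //; have [<- <-] := leaving_corner l.
    by apply/connect1/existsP; exists c; apply/existsP; exists j; rewrite eqxx.
  have [/step//|nl] := boolP (leaving black c k).
  rewrite (sym_connect_sym side_adj_sym) -{2}(mateK black set0 c k).
  by apply: step; rewrite leaving_mate.
move=> cab; suff : black (black_side_of b) &&
    same_circle black set0 (black_side_of a).1 (black_side_of b).1 by case/andP.
pose R s t := black s ==> (black t && same_circle black set0 s.1 t.1).
suff : R (black_side_of a) (black_side_of b) by rewrite /R black_black_side.
apply: (connect_map (f := id)) cab => [s|t s u|s t].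
- by rewrite /R r; case: (black s).
- rewrite /R; case: (black s) => //= /andP[-> st] /andP[-> tu].
  exact: tr st tu.
rewrite /R => /existsP[c /existsP[k]].
have adjE : black (corner c k) = black (corner' c k).
  case: coloured => adj _; apply: adj.
  by apply/existsP; exists c; apply/existsP; exists k; rewrite eqxx.
have step : black (corner c k) -> same_circle black set0 (arc_at c k) (arc_at c (ordS k)).
  by move=> l; rewrite -(mate0_leaving l); apply: same_circle_mate.
case/orP=> /eqP[-> ->]; apply/implyP => bs.
  by rewrite -adjE bs step.
by rewrite adjE bs sy step // adjE.
Qed.

End Colour.

Variable black : pred (side L).
Hypothesis coloured : checkerboard black.
Hypothesis planar_L : planar L.
Implicit Types (c e : crossing L) (k : 'I_4) (a b : link_arc L) (H : {set crossing L}).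

Local Notation sc := (same_circle black).
Local Notation ae := (fun e => arc_at e end0).
Local Notation be := (fun e => arc_at e end2).

Lemma coloured_white : checkerboard (predC black).
Proof.
case: coloured => adj alt; split=> [s t /adj /= -> //|a].
by rewrite /= alt.
Qed.

Lemma same_circle_white : same_circle (predC black) set0 =2 sc setT.
Proof.
apply: eq_connect => a b; apply: eq_existsb => c; apply: eq_existsb => k.
rewrite /mate !in_A_edges !inE; suff -> : pos_edge (predC black) c = ~~ pos_edge black c.
  by case: (pos_edge _ _).
by [].
Qed.

(** The circles of the empty subgraph correspond to the black regions and, after exchanging the
    colours, those of the full subgraph to the white ones. *)
Lemma n_classes_planar : (n_classes (sc set0) + n_classes (sc setT))%N = #|crossing L|.+2.
Proof.
rewrite -(eqP planar_L) -(eq_n_classes same_circle_white).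
pose fb a := region (black_side_of black a).
pose fw a := region (black_side_of (predC black) a).
rewrite (n_classes_image (f := fb)) => [|x y]; last exact: same_circle0.
rewrite (n_classes_image (f := fw)) => [|x y]; last exact: same_circle0 coloured_white x y.
have adj s t : connect (@side_adj L) s t -> black s == black t.
  apply: (@connect_map _ _ _ (fun u v => black u == black v) id) => [u|u v w|u v].
  - by rewrite eqxx.
  - by move=> /eqP-> /eqP->.
  - by case: coloured => adj _ /adj ->.
rewrite -cardsUI addnC [X in (X + _)%N](_ : _ = 0%N) => [|]; last first.
  apply: eq_card0 => C; apply/negP; rewrite in_setI => /andP[/imsetP[a _ ->] /imsetP[b _]].
  move/eqP; rewrite regionE => /adj; rewrite black_black_side //.
  by have := black_black_side coloured_white b; rewrite /= => /negPf->.
apply: eq_card => C; rewrite in_setU; apply/orP/imsetP => [[]/imsetP[a _ ->]|[s _ ->]].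
- by exists (black_side_of black a).
- by exists (black_side_of (predC black) a).
have [bs|bs] := boolP (black s); [left|right]; apply/imsetP; exists s.1 => //.
  by rewrite /fb black_sideE.
by rewrite /fw (black_sideE coloured_white).
Qed.

Hypothesis connected_L : connected_diagram L.

Definition vx a := region (black_side_of black a).

Local Notation tends := (tait_ends black).
Local Notation tv := (tait_vertices black).

(** Connectivity in the Tait graph, transported to arcs by the region on their black side so as to
    be comparable with [same_circle]. *)
Definition linked H : rel (link_arc L) := fun a b => joined tends H (vx a) (vx b).

Lemma linked_equiv H : equivalence (linked H).
Proof.
rewrite /linked; split=> [a|a b|b a c]; first exact: joined_refl.
  exact: joinedC.
exact: joined_trans.
Qed.

Lemma linked0 : linked set0 =2 sc set0.
Proof. by move=> a b; rewrite /linked joined0 same_circle0. Qed.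

Lemma tait_ends_vx e : tends e = (vx (be e), vx (ae e)) \/ tends e = (vx (ae e), vx (be e)).
Proof.
have o k k' : val k = val k' -> arc_at e k = arc_at e k'.
  by move=> kk'; congr (arc_at e _); apply/val_inj.
have rc k : leaving black e k ->
    region (corner e k) = vx (arc_at e k) /\ region (corner e k) = vx (arc_at e (ordS k)).
  move=> l; have [e1 e2] := leaving_corner coloured l; rewrite {1}e1; split=> //.
  rewrite /vx -e2; apply/eqP; rewrite regionE; apply/connect1/existsP; exists e.
  by apply/existsP; exists k; rewrite eqxx.
rewrite /tait_ends pos_edgeE //; have [l0|l0] := boolP (leaving black e end0); [right|left].
  have l2 : leaving black e end2 by rewrite leaving_parity // l0.
  by rewrite /= (rc _ l0).1 (rc _ l2).1.
have l1 : leaving black e end1 by rewrite leaving_parity // (negPf l0).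
have l3 : leaving black e end3 by rewrite leaving_parity // (negPf l0).
by rewrite /= (rc _ l1).2 (rc _ l3).2 (o (ordS end1) end2) // (o (ordS end3) end0).
Qed.

Lemma closes_linked H e : closes tends H e = linked H (ae e) (be e).
Proof. by rewrite /closes /linked; case: (tait_ends_vx e) => ->; rewrite //= joinedC. Qed.

Lemma linkedU1 H e : linked (e |: H) =2 glue (linked H) (ae e) (be e).
Proof.
move=> a b; rewrite /linked joinedU1 -[RHS]/(glue _ (vx (ae e)) (vx (be e)) (vx a) (vx b)).
case: (tait_ends_vx e) => -> //=; rewrite glueC //.
by split=> [u|u v|v u w]; [apply: joined_refl|apply: joinedC|apply: joined_trans].
Qed.

Lemma linkedS H H' a b : H \subset H' -> linked H a b -> linked H' a b.
Proof. exact: joinedS. Qed.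

Lemma vx_end c k : vx (arc_at c k) = vx (ae c) \/ vx (arc_at c k) = vx (be c).
Proof.
have vxE a b : sc set0 a b -> vx b = vx a by rewrite same_circle0 // => /eqP.
by case/orP: (opposite_ends oriented coloured set0 c k) => /andP[h1 h2];
  [left; apply: vxE | right; apply: vxE].
Qed.

Lemma linked_ends H c k k' : c \in H -> linked H (arc_at c k) (arc_at c k').
Proof.
move=> cH; have l : joined tends H (vx (ae c)) (vx (be c)).
  by rewrite -[joined _ _ _ _]/(linked H _ _) -closes_linked; apply: mem_closes.
rewrite /linked; case: (vx_end c k) => ->; case: (vx_end c k') => ->; rewrite ?joined_refl //.
by rewrite joinedC.
Qed.

(** A circle stays at one component of H: at a crossing outside H it keeps to one black region, and
    at a crossing in H all four ends border the two regions joined there. *)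
Lemma same_circle_linked H a b : sc H a b -> linked H a b.
Proof.
have [r s t] := linked_equiv H.
apply: (@connect_map _ _ _ (linked H) id) => [//|//|{}a {}b].
case/existsP=> c /existsP[k /andP[/eqP <- /eqP <-]]; rewrite /=.
have [cH|cH] := boolP (c \in H); first exact: linked_ends.
have -> : mate black H c k = mate black set0 c k.
  by rewrite /mate !in_A_edges inE (negPf cH).
by apply: linkedS (sub0set H) _; rewrite linked0; apply: same_circle_mate.
Qed.

Lemma linkedT a b : linked setT a b.
Proof.
have [r s t] := linked_equiv setT.
have /forallP/(_ a)/forallP/(_ b) := connected_L; move: a b.
apply: (@connect_map _ _ _ (linked setT) id) => [//|//|a b].
case/existsP=> c /existsP[k /existsP[k' /andP[/eqP <- /eqP <-]]].
exact: linked_ends.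
Qed.

Variable dot : link_arc L.

Lemma n_classes_linkedT : n_classes (linked setT) = 1%N.
Proof.
rewrite (n_classes_image (f := fun=> tt)) => [|x y]; last by rewrite linkedT eqxx.
by rewrite (eq_card (_ : _ =i [set tt])) ?cards1 // => u; rewrite !inE; case: u;
  apply/imsetP; exists dot.
Qed.

(* With V black regions and k(H) components, H has 2 k(H) + |H| - V circles in  *)
(* the plane.  The gap cannot decrease when an edge is added to H, and Euler's *)
(* formula makes it vanish both without edges and with all of them.            *)
Definition euler_gap H : int :=
  (2 * n_classes (linked H) + #|H|)%N%:Z - (n_classes (sc set0) + n_classes (sc H))%N%:Z.

Lemma euler_gap0 : euler_gap set0 = 0.
Proof. by rewrite /euler_gap cards0 (eq_n_classes linked0); lia. Qed.

Lemma euler_gapT : euler_gap setT = 0.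
Proof.
have := n_classes_planar; rewrite /euler_gap n_classes_linkedT cardsT; lia.
Qed.

Lemma toggle_notin H e : e \notin H -> toggle H e = e |: H.
Proof. by rewrite /toggle => /negPf->. Qed.

Lemma toggle_in H e : e \in H -> toggle H e = H :\ e.
Proof. by rewrite /toggle => ->. Qed.

(** An edge joining two components merges two circles and keeps the gap. An edge within a component
    keeps the gap when it splits a circle, and raises it by 2 when it merges two. *)
Lemma euler_gapU1 H e : e \notin H ->
  euler_gap H <= euler_gap (e |: H) /\
  (linked H (ae e) (be e) -> ~~ sc H (ae e) (be e) -> euler_gap H < euler_gap (e |: H)).
Proof.
move=> eH; have := n_classes_toggle oriented coloured H e; rewrite (toggle_notin eH).
rewrite /euler_gap cardsU1 eH (eq_n_classes (linkedU1 H e)).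
have [leH|nleH] := boolP (linked H (ae e) (be e)); last first.
  have -> : sc H (ae e) (be e) = false.
    by apply: contraNF nleH; apply: same_circle_linked.
  rewrite (n_classes_glue (linked_equiv H) nleH) /=.
  by clear; move: (n_classes _) (n_classes _) (n_classes _) (n_classes _) => k p q r; split=> [|//]; lia.
have -> : n_classes (glue (linked H) (ae e) (be e)) = n_classes (linked H).
  apply: eq_n_classes => x y; rewrite /glue.
  have [r s t] := linked_equiv H.
  have tr u v w : linked H u v -> linked H v w -> linked H u w by apply: t.
  apply/or3P/idP => [[//|/andP[xa by_]|/andP[xb ay]]|]; last by move=> h; apply: Or31.
    exact: tr xa (tr _ _ _ leH by_).
  by rewrite s in leH; apply: tr xb (tr _ _ _ leH ay).
by clear; move: (n_classes _) (n_classes _) (n_classes _) (n_classes _) => k p q r;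
  case: (sc H _ _); split=> //; lia.
Qed.

Lemma euler_gapS H H' : H \subset H' -> euler_gap H <= euler_gap H'.
Proof.
have [n le_n sub] := ubnP #|H' :\: H|; elim: n => [|n IH] in H le_n sub *.
  by case: (notF le_n).
have [D0|[e]] := set_0Vmem (H' :\: H).
  by have -> : H = H' by apply/eqP; rewrite eqEsubset sub -setD_eq0 D0 eqxx.
rewrite in_setD => /andP[eH eH'].
apply: le_trans (euler_gapU1 eH).1 (IH _ _ _); last by rewrite subUset sub1set eH'.
have := cardsD1 e (H' :\: H); rewrite in_setD eH eH' /= => h.
have -> : H' :\: (e |: H) = (H' :\: H) :\ e.
  by apply/setP=> f; rewrite !inE negb_or andbA.
by move: le_n; rewrite h; lia.
Qed.

(** The gap is monotone and vanishes for the empty and the full subgraph, hence is constant, which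
    forbids an edge that closes a cycle from merging circles. If e is in H, this is applied to H \ e
    and negated by [toggle_split]. *)
Theorem same_circle_ends H e :
  sc H (ae e) (be e) = (e \in H) (+) linked (H :\ e) (ae e) (be e).
Proof.
have notin H1 : e \notin H1 -> sc H1 (ae e) (be e) = linked H1 (ae e) (be e).
  move=> eH1; apply/idP/idP => [/same_circle_linked //|l]; apply: contraT => nsc.
  have := (euler_gapU1 eH1).2 l nsc; have := euler_gapS (sub0set H1).
  have := euler_gapS (subsetT (e |: H1)); rewrite euler_gap0 euler_gapT.
  by move=> h1 h2 h3; have := le_lt_trans h2 (lt_le_trans h3 h1); rewrite ltxx.
have [eH|eH] := boolP (e \in H); last first.
  by rewrite notin // addFb; congr linked; apply/esym/setDidPl; rewrite disjoint_sym disjoints1.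
rewrite -notin ?setD11 // -[LHS]negbK; congr (~~ _).
by rewrite -toggle_split // toggle_in.
Qed.

Lemma spans_tait_graph : spans_connected tv tends setT.
Proof.
apply/forallP=> u; apply/implyP=> /imsetP[s bs ->].
apply/forallP=> v; apply/implyP=> /imsetP[t bt ->].
by rewrite -(black_sideE coloured bs) -(black_sideE coloured bt); apply: linkedT.
Qed.

Lemma tait_ends_vertices e : ((tends e).1 \in tv) && ((tends e).2 \in tv).
Proof.
have inv d : vx d \in tv.
  by apply: imset_f; apply: (black_black_side coloured d).
by case: (tait_ends_vx e) => -> /=; rewrite !inv.
Qed.

End Checkerboard.

(** * The tree of a twisted unknot and its matching *)

Local Close Scope ring_scope.

Section TreeOfTwistedUnknot.

Variables (L : diagram) (black : pred (side L)) (le : rel (crossing L)) (dot : link_arc L).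
Hypotheses (oriented : well_oriented L) (coloured : checkerboard black).
Hypotheses (planar_L : planar L) (connected_L : connected_diagram L).
Hypothesis le_total : total_order le.
Variable T : {set crossing L}.
Hypothesis tree_T : is_tree black T.
Implicit Types (e f : crossing L) (a b x y : link_arc L) (H K W : {set crossing L}).

Local Notation sc := (same_circle black).
Local Notation ae := (fun e => arc_at e end0).
Local Notation be := (fun e => arc_at e end2).
Local Notation ID := (T_int_dead black le T).
Local Notation EL := (T_ext_live black le T).
Local Notation live := (T_live black le T).
Local Notation Hc := (H_c black le T).
Local Notation GTe := (GT_ends black le T).

Definition twist K : {set crossing L} := [set e | (e \in Hc) (+) (e \in K)].

Lemma in_twist K e : (e \in twist K) = (e \in Hc) (+) (e \in K).
Proof. by rewrite inE. Qed.

Lemma in_live e : (e \in live) = (e \in int_live (tait_vertices black) (tait_ends black) le T)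
  || (e \in EL).
Proof. by rewrite in_setU. Qed.

Lemma ID_T e : e \in ID -> e \in T.
Proof. by rewrite inE => /andP[]. Qed.

Lemma EL_T e : e \in EL -> e \notin T.
Proof. by rewrite !inE => /andP[]. Qed.

Lemma live_ID e : e \in live -> e \notin ID.
Proof.
rewrite in_live => /orP[|/EL_T]; last by apply: contraNN; apply: ID_T.
by rewrite !inE => /andP[-> ->].
Qed.

Lemma live_Hc e : e \in live -> (e \in Hc) = (e \notin T).
Proof.
move=> eL; rewrite in_setU (negPf (live_ID eL)) /=; move: eL; rewrite in_live.
case/orP=> [|eEL]; last by rewrite eEL EL_T.
rewrite inE => /andP[eT _]; rewrite eT /=; apply/negP => /EL_T.
by rewrite eT.
Qed.

Lemma twist_live : twist live = T.
Proof.
apply/setP=> e; rewrite inE; have [eL|eL] := boolP (e \in live).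
  by rewrite live_Hc // addbT negbK.
move: eL; rewrite addbF in_live negb_or in_setU => /andP[eIL /negPf->].
by rewrite orbF -[ID]/(int_dead _ _ le T) int_deadE in_setD eIL.
Qed.

Lemma twist0 : twist set0 = Hc.
Proof. by apply/setP=> e; rewrite !in_set addbF. Qed.

Lemma EL_closes K e : K \subset live -> e \in EL ->
  closes (tait_ends black) (twist K :\ e) e.
Proof.
move=> /subsetP KL eEL; have tT : spanning_tree (tait_vertices black) (tait_ends black) T by [].
apply: closesS (ext_live_closes le_total (tait_ends_vertices coloured) tT eEL).
apply/subsetP=> f; rewrite in_setI => /andP[fID _]; rewrite in_setD1 inE in_setU fID /=.
have -> : f != e by apply: contraTneq fID => ->; apply: live_ID; rewrite in_live eEL orbT.
by apply/negP => /KL/live_ID; rewrite fID.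
Qed.

Lemma twist_separated K e : K \subset live -> e \in live -> e \notin K ->
  ~~ sc (twist K) (ae e) (be e).
Proof.
move=> KL eL eK; rewrite (same_circle_ends oriented coloured planar_L connected_L dot).
have tT : spanning_tree (tait_vertices black) (tait_ends black) T by [].
have evs := tait_ends_vertices coloured.
rewrite inE live_Hc // (negPf eK) addbF -(closes_linked coloured).
have [eT|eT] := boolP (e \in T); last first.
  suff -> : closes (tait_ends black) (twist K :\ e) e by [].
  have eEL : e \in EL by move: eL; rewrite in_live inE (negPf eT).
  exact: EL_closes.
rewrite addFb; apply: contraNN (tree_bridge tT eT); apply: joined_closed => f.
rewrite in_setD1 => /andP[fe fK]; have [fT|fT] := boolP (f \in T).
  by apply: mem_closes; rewrite in_setD1 fe.
have fEL : f \in EL.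
  move: fK; rewrite inE in_setU; have [/ID_T|_] := boolP (f \in ID); first by rewrite (negPf fT).
  case: (boolP (f \in EL)) => //= fEL fK; move/subsetP/(_ f fK): KL; rewrite in_live (negPf fEL).
  by rewrite inE (negPf fT).
apply: closesS (ext_live_closes le_total evs tT fEL).
apply/subsetP=> g; rewrite in_setI => /andP[gID _]; rewrite in_setD1 ID_T // andbT.
by apply: contraTneq gID => ->; apply: live_ID.
Qed.

(* Sealed, so that conversion never attempts to compute connected components.  *)
Fact cn_key : {cn : {set crossing L} -> rel (link_arc L) | forall K, cn K = sc (twist K)}.
Proof. by exists (fun K => sc (twist K)). Qed.

Definition cn := sval cn_key.

Lemma cnE K : cn K = sc (twist K). Proof. exact: (svalP cn_key). Qed.

Lemma cn_equiv K : equivalence (cn K).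
Proof. by rewrite cnE; apply: same_circle_equiv. Qed.

Lemma cn_refl K a : cn K a a. Proof. by case: (cn_equiv K). Qed.
Lemma cn_sym K a b : cn K a b = cn K b a. Proof. by case: (cn_equiv K). Qed.
Lemma cn_trans K a b c : cn K a b -> cn K b c -> cn K a c.
Proof. by case: (cn_equiv K) => _ _ t; apply: t. Qed.

Lemma cn_new K e : K \subset live -> e \in live -> e \notin K -> ~~ cn K (ae e) (be e).
Proof. by rewrite cnE; apply: twist_separated. Qed.

Lemma cnU1 K e : K \subset live -> e \in live -> e \notin K ->
  cn (e |: K) =2 glue (cn K) (ae e) (be e).
Proof.
have := @cn_new K e; rewrite !cnE => new KL eL eK x y.
rewrite -(toggle_merge oriented coloured (new KL eL eK)).
congr (sc _ x y); apply/setP=> f; rewrite in_toggle !inE.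
by have [->|] := eqVneq f e; rewrite ?(negPf eK) ?addbF.
Qed.

Lemma cnD1 K e : K \subset live -> e \in K -> cn K =2 glue (cn (K :\ e)) (ae e) (be e).
Proof.
move=> KL eK x y; rewrite -{1}(setD1K eK) cnU1 ?setD11 //; last exact: (subsetP KL).
by apply: subset_trans KL; apply: subsetDl.
Qed.

Lemma set_indU1 (P : {set crossing L} -> Prop) :
  P set0 -> (forall K e, e \notin K -> P K -> P (e |: K)) -> forall K, P K.
Proof.
move=> P0 PU K; move: {2}_.+1 (ltnSn #|K|) => n; elim: n K => // n IH K le_n.
have [->//|[e eK]] := set_0Vmem K; rewrite -(setD1K eK).
apply: PU; first by rewrite setD11.
by apply: IH; move: le_n; rewrite (cardsD1 e) eK; lia.
Qed.

(** Each new edge glues two circles just as it glues two components of G(T), so circles and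
    components correspond by induction on K. *)
Lemma cn_joined K a b : K \subset live ->
  cn K a b = joined GTe K (circle black Hc a) (circle black Hc b).
Proof.
elim/set_indU1: K a b => [|K e eK IH] a b KL.
  rewrite joined0 cnE twist0; apply/idP/eqP => [/circle_eq//|e].
  by have : b \in circle black Hc b by [rewrite inE sc_refl]; rewrite -e inE.
have eL : e \in live by apply: (subsetP KL); rewrite setU11.
have {}KL : K \subset live by apply: subset_trans KL; apply: subsetUr.
by rewrite cnU1 // joinedU1 /glue !IH.
Qed.

Lemma cn0 a b : cn set0 a b = (circle black Hc a == circle black Hc b).
Proof. by rewrite cn_joined ?sub0set // joined0. Qed.

Lemma cnS K K' a b : K \subset K' -> K' \subset live -> cn K a b -> cn K' a b.
Proof.
move=> KK' K'L; rewrite !cn_joined // ?(subset_trans KK') //.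
exact: joinedS.
Qed.

Lemma cn_mem K e : K \subset live -> e \in K -> cn K (ae e) (be e).
Proof. by move=> KL eK; rewrite cn_joined //; have := mem_closes GTe eK. Qed.

(** Toggling all live edges turns H_c(T) into T, whose neighbourhood has a single boundary circle.
    This is the connectedness of G(T). *)
Lemma cn_live a b : cn live a b.
Proof.
have tT : spanning_tree (tait_vertices black) (tait_ends black) T by [].
have evs := tait_ends_vertices coloured.
have [r s t] := cn_equiv live.
have ends e : cn live (ae e) (be e).
  rewrite cnE twist_live (same_circle_ends oriented coloured planar_L connected_L dot).
  rewrite -(closes_linked coloured); have [eT|eT] := boolP (e \in T).
    by rewrite (negPf (tree_bridge tT eT)).
  rewrite addFb; have -> : T :\ e = T by apply/setDidPl; rewrite disjoint_sym disjoints1.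
  exact: tree_closes.
have all_ends e k : cn live (ae e) (arc_at e k).
  case/orP: (opposite_ends oriented coloured (twist live) e k);
    rewrite -cnE => /andP[h1 h2] //.
  by apply: cn_trans (ends e) _.
have /forallP/(_ a)/forallP/(_ b) := connected_L; move: a b.
apply: (@connect_map _ _ _ (cn live) id) => [//|//|a b].
case/existsP=> c /existsP[k /existsP[k' /andP[/eqP <- /eqP <-]]].
by apply: cn_trans (all_ends c k'); rewrite cn_sym.
Qed.

(** Vertices of G(T) are represented by arcs, [cn set0] being equality of vertices; a is the end of
    e under consideration and b the opposite one. *)
Definition is_end e a b : bool :=
  ((a == ae e) && (b == be e)) || ((a == be e) && (b == ae e)).

Definition rooted W := W \subset live /\ forall f, f \in W -> cn W (ae f) dot.

Definition isolated W a := forall f, f \in W -> ~~ cn set0 (ae f) a /\ ~~ cn set0 (be f) a.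

Definition leaf W e a b :=
  [/\ e \in W, is_end e a b, ~~ cn set0 a dot & isolated (W :\ e) a].

Lemma rooted_live : rooted live.
Proof. by split=> // f _; apply: cn_live. Qed.

Lemma isolatedS W W' a : W \subset W' -> isolated W' a -> isolated W a.
Proof. by move=> /subsetP sub iso f /sub/iso. Qed.

Lemma isolated_cn W a x : W \subset live -> isolated W a -> cn W a x -> cn set0 a x.
Proof.
move=> WL iso; rewrite cn_joined // => /connectP[[|v p] /=]; first by rewrite cn0 => _ ->.
case/andP=> /existsP[f /andP[/iso[fa fb]]]; rewrite !cn0 in fa fb.
by case/orP=> /eqP[h1 h2]; [rewrite h1 eqxx in fa | rewrite h2 eqxx in fb].
Qed.

Lemma cn_end W e a b : W \subset live -> is_end e a b -> e \in W ->
  cn W =2 glue (cn (W :\ e)) a b.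
Proof.
move=> WL /orP[]/andP[/eqP-> /eqP->] eW x y; rewrite (cnD1 WL eW) // glueC //.
exact: cn_equiv.
Qed.

Lemma cn_end_mem W e a b : W \subset live -> is_end e a b -> e \in W -> cn W a b.
Proof. by move=> WL eab eW; rewrite (cn_end WL eab eW) /glue !cn_refl orbT. Qed.

Lemma is_end_new W e a b : W \subset live -> is_end e a b -> e \in live -> e \notin W ->
  ~~ cn W a b.
Proof.
by move=> WL /orP[]/andP[/eqP-> /eqP->] eL eW; [|rewrite cn_sym]; apply: cn_new.
Qed.

Section LeafGeometry.

Variables (W : {set crossing L}) (e : crossing L) (a b : link_arc L).
Hypotheses (rW : rooted W) (leafW : leaf W e a b).

Lemma leaf_live : W \subset live. Proof. by case: rW. Qed.
Lemma leaf_liveD1 : W :\ e \subset live.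
Proof. by apply: subset_trans leaf_live; apply: subsetDl. Qed.

Lemma leaf_mem : e \in W. Proof. by case: leafW. Qed.
Lemma leaf_end : is_end e a b. Proof. by case: leafW. Qed.
Lemma leaf_dot : ~~ cn set0 a dot. Proof. by case: leafW. Qed.
Lemma leaf_isolated : isolated (W :\ e) a. Proof. by case: leafW. Qed.

Lemma leaf_cn x : cn (W :\ e) a x -> cn set0 a x.
Proof. exact: isolated_cn leaf_liveD1 leaf_isolated. Qed.

Lemma leaf_cnW : cn W =2 glue (cn (W :\ e)) a b.
Proof. exact: cn_end leaf_live leaf_end leaf_mem. Qed.

Lemma leaf_not_dot : ~~ cn (W :\ e) a dot.
Proof. by apply: contraNN leaf_dot; apply: leaf_cn. Qed.

Lemma leaf_parent_dot : cn (W :\ e) b dot.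
Proof.
have : cn W a dot.
  have [/orP[]/andP[/eqP-> /eqP _]] := (leaf_end, rW.2 e leaf_mem) => //.
  by move=> h; apply: cn_trans h; rewrite cn_sym; apply: cn_mem leaf_live leaf_mem.
rewrite leaf_cnW /glue => /or3P[|/andP[//]|/andP[_]]; last first.
  by move=> h; move: leaf_not_dot; rewrite h.
by move=> h; move: leaf_not_dot; rewrite h.
Qed.

Lemma leaf_other : ~~ cn set0 b a.
Proof.
rewrite cn_sym; apply: (is_end_new (sub0set _) leaf_end); last by rewrite in_set0.
exact: subsetP leaf_live e leaf_mem.
Qed.

Lemma rooted_leaf : rooted (W :\ e).
Proof.
split=> [|f fW]; first exact: leaf_liveD1.
have /setD1P[fe fW'] := fW; have [fa fb] := leaf_isolated fW.
have := rW.2 f fW'; rewrite leaf_cnW => /or3P[//|/andP[h _]|/andP[_ h]].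
  by rewrite cn_sym in h; move: fa; rewrite cn_sym (leaf_cn h).
by move: leaf_not_dot; rewrite h.
Qed.

Lemma leaf_strip f x : f \in W -> f != e -> ~~ cn set0 a x ->
  cn (W :\ f) x dot -> cn (W :\ e :\ f) x dot.
Proof.
move=> fW fe ax; have eWf : e \in W :\ f by rewrite in_setD1 eq_sym fe leaf_mem.
have WfL : W :\ f \subset live by apply: subset_trans leaf_live; apply: subsetDl.
have eq : W :\ f :\ e = W :\ e :\ f by apply/setP=> g; rewrite !inE andbCA.
have isoW : isolated (W :\ e :\ f) a by apply: isolatedS leaf_isolated; apply: subsetDl.
have WL : W :\ e :\ f \subset live by apply: subset_trans leaf_liveD1; apply: subsetDl.
rewrite (cn_end WfL leaf_end eWf) eq => /or3P[//|/andP[h _]|/andP[_ h]].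
  by rewrite cn_sym in h; move: ax; rewrite (isolated_cn WL isoW h).
by move: leaf_dot; rewrite (isolated_cn WL isoW h).
Qed.

End LeafGeometry.

(** Take an edge whose removal leaves the fewest arcs unconnected to the dot. A second edge at its
    far end would leave strictly fewer. *)
Lemma exists_leaf W : rooted W -> W != set0 -> exists e a b, leaf W e a b.
Proof.
move=> [WL rW] /set0Pn[e0 e0W].
pose far e := [set x | ~~ cn (W :\ e) x dot].
have [e eW mn] := @arg_minnP _ e0 (mem W) (fun e => #|far e|) e0W.
have WeL : W :\ e \subset live by apply: subset_trans WL; apply: subsetDl.
have eL := subsetP WL e eW.
have [a [b [eab nad bd]]] : exists a b, [/\ is_end e a b, ~~ cn (W :\ e) a dot & cn (W :\ e) b dot].
  have nab : ~~ cn (W :\ e) (ae e) (be e) by apply: cn_new; rewrite ?setD11.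
  have := rW e eW; rewrite (cnD1 WL eW) => /or3P[h|/andP[_ h]|/andP[h _]].
  - exists (be e), (ae e); rewrite /is_end !eqxx orbT; split=> //.
    by apply: contraNN nab => h'; apply: cn_trans h _; rewrite cn_sym.
  - exists (ae e), (be e); rewrite /is_end !eqxx; split=> //.
    by apply: contraNN nab => h'; apply: cn_trans h' _; rewrite cn_sym.
  - by rewrite h in nab.
exists e, a, b; split=> //.
  by apply: contraNN nad; apply: cnS; rewrite ?sub0set.
move=> f; rewrite in_setD1 => /andP[fe fW]; apply/andP; rewrite -negb_or.
apply/negP => inc; have := mn f fW; rewrite leqNgt => /negP; apply.
have WfL : W :\ f \subset live by apply: subset_trans WL; apply: subsetDl.
have WefL : W :\ e :\ f \subset live by apply: subset_trans WeL; apply: subsetDl.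
have fWe : f \in W :\ e by rewrite in_setD1 fe.
have fab := cn_mem WeL fWe.
have nfd : ~~ cn (W :\ e) (ae f) dot.
  apply: contraNN nad => h; case/orP: inc => /(cnS (sub0set _) WeL) inc.
    by rewrite cn_sym in inc; apply: cn_trans inc h.
  by rewrite cn_sym in inc; apply: cn_trans inc (cn_trans _ h); rewrite cn_sym.
have nfd' : ~~ cn (W :\ e) (be f) dot.
  by apply: contraNN nfd; apply: cn_trans fab.
have sub x : cn (W :\ e) x dot -> cn (W :\ f) x dot.
  rewrite (cnD1 WeL fWe) => /or3P[h|/andP[_ h]|/andP[_ h]].
  - by apply: cnS h; rewrite // setDDl setUC -setDDl subsetDl.
  - by case/negP: nfd'; apply: cnS h; rewrite // subsetDl.
  - by case/negP: nfd; apply: cnS h; rewrite // subsetDl.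
apply: proper_card; apply/properP; split.
  by apply/subsetP=> x; rewrite !inE; apply: contraNN; apply: sub.
exists a; rewrite !inE // negbK; apply: cn_trans (sub _ bd).
by apply: cn_end_mem eab _; rewrite // in_setD1 eq_sym fe.
Qed.

Lemma degree_leaf W e a b : W \subset live -> leaf W e a b ->
  degree GTe W (circle black Hc a) = 1%N.
Proof.
move=> WL [eW eab _ iso]; have eL := subsetP WL e eW.
have nab : ~~ cn set0 a b by apply: (is_end_new (sub0set _) eab eL); rewrite in_set0.
have other f : f \in W -> f != e ->
    (circle black Hc (ae f) == circle black Hc a) = false /\
    (circle black Hc (be f) == circle black Hc a) = false.
  by move=> fW fe; have [] := iso f; rewrite ?in_setD1 ?fe // !cn0 => /negPf-> /negPf->.
rewrite cn0 eq_sym in nab; rewrite /degree /GT_ends /=.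
case/orP: eab => /andP[/eqP ea /eqP eb]; subst a b.
- rewrite [X in (X + _)%N](_ : _ = 1%N) => [|]; last first.
    apply: etrans (cards1 e); apply: eq_card => f; rewrite !inE; have [->|fe] := eqVneq f e; first by rewrite eW eqxx.
    by case: (boolP (f \in W)) => //= fW; rewrite (other f fW fe).1.
  rewrite [X in (_ + X)%N](_ : _ = 0%N) //; apply: eq_card0 => f; rewrite !inE.
  have [->|fe] := eqVneq f e; first by rewrite (negPf nab) andbF.
  by case: (boolP (f \in W)) => //= fW; rewrite (other f fW fe).2.
- rewrite addnC [X in (X + _)%N](_ : _ = 1%N) => [|]; last first.
    apply: etrans (cards1 e); apply: eq_card => f; rewrite !inE; have [->|fe] := eqVneq f e; first by rewrite eW eqxx.
    by case: (boolP (f \in W)) => //= fW; rewrite (other f fW fe).2.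
  rewrite [X in (_ + X)%N](_ : _ = 0%N) //; apply: eq_card0 => f; rewrite !inE.
  have [->|fe] := eqVneq f e; first by rewrite (negPf nab) andbF.
  by case: (boolP (f \in W)) => //= fW; rewrite (other f fW fe).1.
Qed.

Lemma leaf_edgeP W e v : W \subset live ->
  reflect (exists a b, v = circle black Hc a /\ leaf W e a b) (leaf_edge black le dot T W e v).
Proof.
move=> WL; apply: (iffP and4P) => [[eW nroot inc deg]|[a [b [-> lf]]]]; last first.
  have [eW eab nad iso] := lf; split=> //; last by rewrite (degree_leaf WL lf).
    by rewrite /GT_root; rewrite cn0 in nad.
  by rewrite /incident /GT_ends /=; case/orP: eab => /andP[/eqP-> _]; rewrite eqxx ?orbT.
pose S1 := [set f in W | (GTe f).1 == v]; pose S2 := [set f in W | (GTe f).2 == v].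
have [a [b [eab va]]] : exists a b, is_end e a b /\ v = circle black Hc a.
  case/orP: inc => /eqP <-; first by exists (ae e), (be e); rewrite /is_end !eqxx.
  by exists (be e), (ae e); rewrite /is_end !eqxx orbT.
exists a, b; split=> //; split=> //; first by rewrite cn0 -va.
move=> f; rewrite in_setD1 => /andP[fe fW]; apply/andP; rewrite -negb_or !cn0 -va.
apply: contraL deg => inc'; rewrite /degree -/S1 -/S2 -cardsUI.
have sub : [set e; f] \subset S1 :|: S2.
  rewrite subUset !sub1set !inE eW fW /=; apply/andP; split.
    by case/orP: inc => ->; rewrite ?orbT.
  by case/orP: inc' => ->; rewrite ?orbT.
apply/eqP => deg1; have := subset_leq_card sub; rewrite cards2 eq_sym fe => le2.
by have := leq_trans le2 (leq_addr #|S1 :&: S2| _); rewrite deg1.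
Qed.

(** After e is deleted, one of its ends is still connected to the root and the other is not, so e is
    a leaf edge at one end only. *)
Lemma leaf_uniq W e a b a' b' : rooted W -> leaf W e a b -> leaf W e a' b' ->
  circle black Hc a = circle black Hc a'.
Proof.
move=> rW lf lf'; have [//|] : a = a' \/ a' = b.
  have := leaf_end lf; have := leaf_end lf'; rewrite /is_end.
  by case/orP=> /andP[/eqP-> _] /orP[]/andP[/eqP-> /eqP->]; auto.
  by move->.
move=> a'b; have := leaf_parent_dot rW lf; rewrite -a'b => h.
by have := leaf_not_dot rW lf'; rewrite h.
Qed.

Definition parent W e a := [/\ e \in W, a = ae e \/ a = be e & ~~ cn (W :\ e) a dot].

Lemma parent_leaf W e a b : rooted W -> leaf W e a b -> parent W e a.
Proof.
move=> rW lf; split; [exact: leaf_mem lf| |exact: leaf_not_dot rW lf].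
by case/orP: (leaf_end lf) => /andP[/eqP-> _]; auto.
Qed.

(** Edges towards the root do not change when leaves are stripped. This ties the labels left by the
    recursive matching to the direct description of the critical state. *)
Lemma parent_strip W e a b f x : rooted W -> leaf W e a b ->
  parent (W :\ e) f x <-> f != e /\ parent W f x.
Proof.
move=> rW lf; split=> [[fW fx nxd]|[fe [fW fx nxd]]].
  have /setD1P[fe fW'] := fW; split=> //; split=> //.
  apply: contraNN nxd; apply: (leaf_strip rW lf fW' fe).
  have [fa fb] := leaf_isolated lf fW.
  by rewrite cn_sym; case: fx => ->.
split; rewrite ?in_setD1 ?fe //; apply: contraNN nxd; apply: cnS.
  by rewrite setDDl setUC -setDDl subsetDl.
by apply: subset_trans (leaf_live rW); apply: subsetDl.
Qed.

Lemma parent_at_leaf W e a b x : rooted W -> leaf W e a b -> parent W e x -> x = a.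
Proof.
move=> rW lf [_ ex nx]; have := leaf_parent_dot rW lf => h.
case/orP: (leaf_end lf) => /andP[/eqP ea /eqP eb]; case: ex => xE; rewrite xE ea //.
  by move: nx; rewrite xE -eb h.
by move: nx; rewrite xE -eb h.
Qed.

Lemma rooted_ind (P : {set crossing L} -> Prop) : P set0 ->
  (forall W e a b, rooted W -> leaf W e a b -> P (W :\ e) -> P W) ->
  forall W, rooted W -> P W.
Proof.
move=> P0 PS W; move: {2}_.+1 (ltnSn #|W|) => n; elim: n W => // n IH W le_n rW.
have [->//|nz] := eqVneq W set0; have [e [a [b lf]]] := exists_leaf rW nz.
apply: (PS _ _ _ _ rW lf); apply: IH (rooted_leaf rW lf).
by move: le_n; rewrite (cardsD1 e) (leaf_mem lf); lia.
Qed.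

Lemma parent_exists W x : rooted W -> cn W x dot -> ~~ cn set0 x dot ->
  exists e a, parent W e a /\ cn set0 a x.
Proof.
move=> rW; elim/rooted_ind: rW x => [x -> //|{}W e a b rW lf IH x xd nxd].
have [ax|nax] := boolP (cn set0 a x); first by exists e, a; split=> //; apply: parent_leaf lf.
have [f [c [pf cx]]] : exists f c, parent (W :\ e) f c /\ cn set0 c x.
  apply: IH => //; move: xd; rewrite (leaf_cnW rW lf) => /or3P[//|/andP[h _]|/andP[_ h]].
    by rewrite cn_sym in h; move: nax; rewrite (leaf_cn rW lf h).
  by move: (leaf_not_dot rW lf); rewrite h.
by exists f, c; split=> //; have [_] := (parent_strip f c rW lf).1 pf.
Qed.

Lemma parent_uniq W e e' x x' : rooted W -> parent W e x -> parent W e' x' ->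
  cn set0 x x' -> e = e'.
Proof.
move=> rW; elim/rooted_ind: rW e e' x x' => [e e' x x' []|{}W g a b rW lf IH e e' x x' p p' xx'].
  by rewrite inE.
have at_leaf f y : parent W f y -> f != g -> ~~ cn set0 a y.
  case=> fW fy _ fg; have [] := leaf_isolated lf (f := f); first by rewrite in_setD1 fg.
  by case: fy => ->; rewrite ![cn _ a _]cn_sym.
have [eg|neg] := eqVneq e g; have [e'g|ne'g] := eqVneq e' g.
- by rewrite eg e'g.
- rewrite eg in p; rewrite (parent_at_leaf rW lf p) in xx'.
  by have := at_leaf _ _ p' ne'g; rewrite xx'.
- rewrite e'g in p'; rewrite (parent_at_leaf rW lf p') cn_sym in xx'.
  by have := at_leaf _ _ p neg; rewrite xx'.
by apply: IH xx'; apply/(parent_strip _ _ rW lf).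
Qed.

Implicit Types (s : enhanced black) (v : {set link_arc L}).

Local Notation GK := (GT_subgraph le T).
Local Notation Paired := (@paired L black le T).
Local Notation Left := (@left_over L black le T).
Local Notation vertex := (circle black Hc).
Local Notation neg := (neg_twist black T).
Local Notation next_lf := (next_leaf black le dot T).
Local Notation Match := (@tree_matching L black le dot).

Lemma mem_vertex a x : (x \in vertex a) = cn set0 a x.
Proof. by rewrite inE cnE twist0. Qed.

Lemma twist_GK s : twist (GK s) = subgraph s.
Proof. by apply/setP=> e; rewrite !inE; case: (e \in subgraph s); case: (_ || _). Qed.

Lemma GK_twist s K : subgraph s = twist K -> GK s = K.
Proof.
by move=> sK; apply/setP=> e; rewrite inE sK in_set; case: (e \in Hc); case: (e \in K).
Qed.

Lemma in_subcomplexE s : in_subcomplex le T s = (GK s \subset live).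
Proof.
have EDE e : (e \in T_ext_dead black le T) = ~~ ((e \in T) || (e \in EL)).
  by rewrite -[T_ext_dead _ _ _]/(ext_dead _ le T) ext_deadE in_setC in_setU.
have IDE e : (e \in ID) = (e \in T) && (e \notin live).
  rewrite -[ID]/(int_dead _ _ le T) int_deadE in_setD in_live andbC.
  by case: (boolP (e \in T)) => //= eT; rewrite [e \in EL]inE in_setC eT /= orbF.
apply/andP/subsetP => [[/subsetP sub dis] e|sub].
  rewrite inE in_setU; apply: contraR => eL.
  have := sub e; rewrite IDE eL andbT; have := eL; rewrite in_live negb_or => /andP[_ /negPf eEL].
  rewrite eEL orbF; case: (boolP (e \in T)) => [_ ->//|eT _].
  by rewrite (disjointFr dis) // EDE eEL (negPf eT).
split.
  apply/subsetP=> e eID; apply: contraT => es; have := sub e.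
  by rewrite inE in_setU eID (negPf es) => /(_ isT)/live_ID; rewrite eID.
rewrite disjoint_subset; apply/subsetP=> e eED; rewrite inE; apply/negP => es.
have := sub e; rewrite inE in_setU es IDE; move: eED; rewrite EDE negb_or => /andP[/negPf eT /negPf eEL].
by rewrite in_live eT eEL orbF inE eT => /(_ isT).
Qed.

Lemma label_cn s x y : cn (GK s) x y -> label s x = label s y.
Proof. by rewrite cnE twist_GK; apply: label_sc. Qed.

Lemma enhanced_eq s s' : GK s = GK s' -> (forall x, label s x = label s' x) -> s = s'.
Proof.
move=> eK el; apply/val_inj; rewrite [val s]surjective_pairing [val s']surjective_pairing.
congr (_, _); last exact/ffunP.
by rewrite -[LHS]/(subgraph s) -[RHS]/(subgraph s') -!twist_GK eK.
Qed.

Lemma make_state K (l : {ffun link_arc L -> bool}) :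
  (forall x y, cn K x y -> l x = l y) -> exists s, GK s = K /\ label s = l.
Proof.
move=> lK; have es : is_enhanced black (twist K, l).
  by apply/forallP=> x; apply/forallP=> y; apply/implyP; rewrite /= -cnE => /lK->.
by exists (Sub (twist K, l) es); split=> //; apply: GK_twist.
Qed.

Lemma pairedP e v s s' :
  reflect [/\ e \in GK s, GK s' = GK s :\ e
    & forall x, label s' x = if x \in v then neg e else label s x] (Paired e v s s').
Proof.
apply: (iffP and3P) => [[eK /eqP K' /forallP l]|[eK K' l]]; split=> //.
- by move=> x; rewrite (eqP (l x)); case: ifP => // _; case: (neg e).
- exact/eqP.
- by apply/forallP=> x; rewrite l; case: ifP => // _; case: (neg e).
Qed.

Lemma leftP e v s :
  reflect (e \notin GK s /\ forall x, x \in v -> label s x = ~~ neg e) (Left e v s).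
Proof.
apply: (iffP andP) => [[eK /forallP l]|[eK l]]; split=> //.
- by move=> x xv; have := l x; rewrite xv => /eqP->; case: (neg e).
- by apply/forallP=> x; apply/implyP=> /l->; case: (neg e).
Qed.

Lemma paired_left e a s s' : Paired e (vertex a) s s' ->
  ~~ Left e (vertex a) s /\ ~~ Left e (vertex a) s'.
Proof.
move=> /pairedP[eK K' l]; split; apply/leftP => -[]; first by rewrite eK.
move=> _ /(_ a); rewrite l mem_vertex cn_refl => /(_ isT).
by case: (neg e).
Qed.

Section LeafStates.

Variables (W : {set crossing L}) (e : crossing L) (a b : link_arc L).
Hypotheses (rW : rooted W) (lf : leaf W e a b).
Local Notation v := (vertex a).

Lemma leaf_dot_notin : dot \notin v.
Proof. by rewrite mem_vertex (leaf_dot lf). Qed.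

Lemma leaf_b_notin : b \notin v.
Proof. by rewrite mem_vertex cn_sym (leaf_other rW lf). Qed.

Lemma vertex_stable K x y : K \subset W :\ e -> cn K x y -> (x \in v) = (y \in v).
Proof.
move=> KW xy; have KL := subset_trans KW (leaf_liveD1 e rW).
have iso := isolatedS KW (leaf_isolated lf).
suff st z w : cn K z w -> z \in v -> w \in v.
  by apply/idP/idP; apply: st => //; rewrite cn_sym.
rewrite !mem_vertex => zw az; apply: (isolated_cn KL iso).
exact: cn_trans (cnS (sub0set _) KL az) zw.
Qed.

Lemma partner_below s : GK s \subset W -> e \in GK s ->
  exists2 s', Paired e v s s' & label s' dot = label s dot.
Proof.
move=> KW eK; have KW' : GK s :\ e \subset W :\ e by apply: setSD.
have KL := subset_trans KW (leaf_live rW).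
have [x y|s' [K' l]] := @make_state (GK s :\ e) [ffun x => if x \in v then neg e else label s x].
  move=> xy; rewrite !ffunE (vertex_stable KW' xy); case: ifP => // _.
  by apply: label_cn; apply: cnS xy; rewrite // subsetDl.
exists s'; last by rewrite l ffunE (negPf leaf_dot_notin).
by apply/pairedP; split=> // x; rewrite l ffunE.
Qed.

Lemma partner_above s : GK s \subset W -> e \notin GK s -> label s a = neg e ->
  exists2 s', Paired e v s' s & label s' dot = label s dot.
Proof.
move=> KW eK la; have KW' : GK s \subset W :\ e by rewrite subsetD1 KW.
have KL := subset_trans KW (leaf_live rW).
have eL := subsetP (leaf_live rW) e (leaf_mem lf).
have UL : e |: GK s \subset live by rewrite subUset sub1set eL.
have UK : (e |: GK s) :\ e = GK s by rewrite setU1K.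
(* Adding e attaches v to the component of b, whose label it takes over. The old label of v is the
   one prescribed by the pairing, so it can be recovered. *)
have [x y|s' [K' l]] := @make_state (e |: GK s) [ffun x => label s (if x \in v then b else x)].
  rewrite (cn_end UL (leaf_end lf)) ?setU11 // UK => /or3P[xy|/andP[xa yb]|/andP[xb ya]].
  - by rewrite !ffunE (vertex_stable KW' xy); case: ifP => // _; apply: label_cn.
  - rewrite !ffunE (vertex_stable KW' xa) mem_vertex cn_refl.
    rewrite -(vertex_stable KW' yb) (negPf leaf_b_notin).
    exact: label_cn.
  - rewrite !ffunE (vertex_stable KW' xb) (negPf leaf_b_notin) -(vertex_stable KW' ya).
    by rewrite mem_vertex cn_refl; apply: label_cn.
exists s'; last by rewrite l ffunE (negPf leaf_dot_notin).
apply/pairedP; split; rewrite ?K' ?setU11 ?UK // => x; rewrite l ffunE; case: ifP => xv; last by rewrite xv.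
rewrite -la; apply: label_cn; apply: cnS (sub0set _) KL _.
by rewrite cn_sym -mem_vertex.
Qed.

Lemma paired_inj_below s s1 s2 : Paired e v s s1 -> Paired e v s s2 -> s1 = s2.
Proof.
move=> /pairedP[_ K1 l1] /pairedP[_ K2 l2]; apply: enhanced_eq; first by rewrite K1 K2.
by move=> x; rewrite l1 l2.
Qed.

Lemma paired_above_label s s1 : GK s1 \subset live -> Paired e v s1 s ->
  forall x, label s1 x = label s (if x \in v then b else x).
Proof.
move=> KL /pairedP[eK K1 l1] x; case: (boolP (x \in v)) => xv; last by rewrite l1 (negPf xv).
rewrite l1 (negPf leaf_b_notin); apply: label_cn.
apply: cn_trans (cn_end_mem KL (leaf_end lf) eK); apply: cnS (sub0set _) KL _.
by rewrite cn_sym -mem_vertex.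
Qed.

Lemma paired_inj_above s s1 s2 : GK s1 \subset live -> GK s2 \subset live ->
  Paired e v s1 s -> Paired e v s2 s -> s1 = s2.
Proof.
move=> L1 L2 p1 p2; apply: enhanced_eq => [|x].
  have /pairedP[e1 K1 _] := p1; have /pairedP[e2 K2 _] := p2.
  by rewrite -(setD1K e1) -K1 K2 setD1K.
by rewrite (paired_above_label L1 p1) (paired_above_label L2 p2).
Qed.

End LeafStates.

Lemma next_leafP W e v : rooted W -> next_lf W e v ->
  exists a b, v = vertex a /\ leaf W e a b.
Proof. by move=> rW /andP[/(leaf_edgeP _ _ (leaf_live rW))]. Qed.

Lemma next_leaf_uniq W e v e' v' : rooted W ->
  next_lf W e v -> next_lf W e' v' -> e = e' /\ v = v'.
Proof.
move=> rW nl nl'; have [a [b [va lf]]] := next_leafP rW nl.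
have [a' [b' [va' lf']]] := next_leafP rW nl'.
have ee' : e = e'.
  have /andP[l1 /forallP m1] := nl; have /andP[l2 /forallP m2] := nl'.
  apply: (total_le_anti le_total).
    by apply: (implyP (m1 e')); apply/existsP; exists v'.
  by apply: (implyP (m2 e)); apply/existsP; exists v.
by rewrite -ee' in lf' *; rewrite va va' (leaf_uniq rW lf lf').
Qed.

Lemma next_leaf_exists W : rooted W -> W != set0 -> exists e v, next_lf W e v.
Proof.
move=> rW nz; have [e0 [a0 [b0 lf0]]] := exists_leaf rW nz.
have total' : total_order (fun f g => le g f).
  split=> [f|f g|g f h|f g].
  - exact: total_le_refl.
  - by move=> /andP[h1 h2]; apply: (total_le_anti le_total).
  - by move=> h1 h2; apply: (total_le_trans le_total h2 h1).
  - exact: total_le_total.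
have [|e /existsP[v lv] mn] :=
    max_edge total' (P := fun e => [exists v, leaf_edge black le dot T W e v]).
  exists e0; apply/existsP; exists (vertex a0).
  by apply/(leaf_edgeP _ _ (leaf_live rW)); exists a0, b0.
exists e, v; rewrite /next_leaf lv; apply/forallP=> f; apply/implyP => h.
exact: mn.
Qed.

Lemma MatchS n W e v s s' : rooted W -> next_lf W e v ->
  Match n.+1 T W s s' = Paired e v s s' || [&& Left e v s, Left e v s' & Match n T (W :\ e) s s'].
Proof.
move=> rW nl; apply/existsP/idP => [[e' /existsP[v' /andP[nl' h]]]|h].
  by have [-> ->] := next_leaf_uniq rW nl nl'.
by exists e; apply/existsP; exists v; rewrite nl.
Qed.

Lemma Match_leaf n W s s' : rooted W -> Match n.+1 T W s s' ->
  exists e a b, next_lf W e (vertex a) /\ leaf W e a b.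
Proof.
move=> rW /existsP[e /existsP[v /andP[nl _]]].
by have [a [b [va lf]]] := next_leafP rW nl; exists e, a, b; rewrite -va.
Qed.

Definition sym_match n W s s' := Match n T W s s' || Match n T W s' s.

Lemma sym_matchS n W e v s s' : rooted W -> next_lf W e v ->
  sym_match n.+1 W s s' = [|| Paired e v s s', Paired e v s' s
    | [&& Left e v s, Left e v s' & sym_match n (W :\ e) s s']].
Proof.
move=> rW nl; rewrite /sym_match !(MatchS _ _ _ rW nl).
by case: (Paired e v s s'); case: (Paired e v s' s); case: (Left e v s); case: (Left e v s'); rewrite /= ?orbT ?orbF.
Qed.

Lemma sym_match_fun n W s s1 s2 : rooted W ->
  GK s \subset live -> GK s1 \subset live -> GK s2 \subset live ->
  sym_match n W s s1 -> sym_match n W s s2 -> s1 = s2.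
Proof.
elim: n W => [|n IH] W rW sL s1L s2L //.
move=> m1; have [e [a [b [nl lf]]]] : exists e a b, next_lf W e (vertex a) /\ leaf W e a b.
  by case/orP: m1; apply: Match_leaf.
move: m1; rewrite !(sym_matchS _ _ _ rW nl).
case/or3P=> [p1|p1|/and3P[l1 l2 m1]]; case/or3P=> [p2|p2|/and3P[l1' l2' m2]].
- exact: paired_inj_below p1 p2.
- by have /pairedP[eK _ _] := p1; have /pairedP[_ K2 _] := p2; rewrite K2 setD11 in eK.
- by have [] := paired_left p1; rewrite l1'.
- by have /pairedP[eK _ _] := p2; have /pairedP[_ K2 _] := p1; rewrite K2 setD11 in eK.
- exact: (paired_inj_above rW lf s1L s2L p1 p2).
- by have [_] := paired_left p1; rewrite l1'.
- by have [] := paired_left p2; rewrite l1.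
- by have [_] := paired_left p2; rewrite l1.
exact: IH (rooted_leaf rW lf) sL s1L s2L m1 m2.
Qed.

(** The later stages act only within the remaining tree, so they keep what made a state left over at
    an earlier leaf; see [sym_match_left]. *)
Lemma match_untouched n W s s' : rooted W -> Match n T W s s' ->
  (forall f, f \notin W -> (f \in GK s) = (f \in GK s')) /\
  (forall x, isolated W x -> label s x = label s' x).
Proof.
elim: n W => // n IH W rW m; have [e [a [b [nl lf]]]] := Match_leaf rW m.
move: m; rewrite (MatchS _ _ _ rW nl) => /orP[/pairedP[eK K' l]|/and3P[_ _ m]].
  split=> [f fW|x iso].
    by rewrite K' in_setD1; have [fe|//] := eqVneq f e; rewrite fe (leaf_mem lf) in fW.
  rewrite l; case: ifP => //; rewrite mem_vertex => ax.
  have [] := iso e (leaf_mem lf).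
  by case/orP: (leaf_end lf) => /andP[/eqP ae_ _]; rewrite -ae_ ax.
have [h1 h2] := IH _ (rooted_leaf rW lf) m; split=> [f fW|x iso].
  by apply: h1; rewrite in_setD1 (negPf fW) andbF.
by apply: h2; apply: isolatedS iso; apply: subsetDl.
Qed.

Lemma sym_match_left n W e a b s s' : rooted W -> leaf W e a b -> Left e (vertex a) s ->
  sym_match n (W :\ e) s s' -> Left e (vertex a) s'.
Proof.
move=> rW lf /leftP[eK l] m.
have [h1 h2] : (forall f, f \notin W :\ e -> (f \in GK s) = (f \in GK s')) /\
    (forall x, isolated (W :\ e) x -> label s x = label s' x).
  case/orP: m => /(match_untouched (rooted_leaf rW lf))[h1 h2] //.
  by split=> [f /h1|x /h2].
apply/leftP; split=> [|x xv]; first by rewrite -h1 // setD11.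
rewrite -h2 ?l // => f fW; have [fa fb] := leaf_isolated lf fW.
move: xv; rewrite mem_vertex => ax; split.
  by apply: contraNN fa => h; apply: cn_trans h _; rewrite cn_sym.
by apply: contraNN fb => h; apply: cn_trans h _; rewrite cn_sym.
Qed.

Lemma not_left s W e a b : rooted W -> leaf W e a b -> GK s \subset W ->
  e \notin GK s -> ~~ Left e (vertex a) s -> label s a = neg e.
Proof.
move=> rW lf KW eK; have KL := subset_trans KW (leaf_live rW).
apply: contraNeq => la; apply/leftP; split=> // x; rewrite mem_vertex => ax.
rewrite -(label_cn (cnS (sub0set _) KL ax)).
by move: la; case: (label s a); case: (neg e).
Qed.

(** At the next leaf an unmatched state must be left over, otherwise one of the two partner
    constructions applies; the leaf is then stripped. The dot is never on the leaf vertex, so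
    partners have the same label there and stay in the reduced complex. *)
Lemma unmatched_labels n W s : #|W| = n -> rooted W -> GK s \subset W ->
  (forall s', label s' dot = label s dot -> GK s' \subset W -> ~~ sym_match n W s s') ->
  GK s = set0 /\ forall e x, parent W e x -> label s x = ~~ neg e.
Proof.
elim: n W => [|n IH] W cW rW KW un.
  have W0 : W = set0 by apply/eqP; rewrite -cards_eq0 cW.
  rewrite W0 in KW *; split; first by apply/eqP; rewrite -subset0.
  by move=> e x []; rewrite inE.
have [|e [v nl]] := next_leaf_exists rW; first by rewrite -cards_eq0 cW.
have [a [b [va lf]]] := next_leafP rW nl; rewrite va in nl.
have sl : Left e (vertex a) s.
  apply: contraT => nsl; have [eK|eK] := boolP (e \in GK s).
    have [s' p ld] := partner_below rW lf KW eK; have /pairedP[_ K' _] := p.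
    have := un s' ld; rewrite K' (subset_trans (subsetDl _ _) KW) => /(_ isT).
    by rewrite (sym_matchS _ _ _ rW nl) p.
  have [s' p ld] := partner_above rW lf KW eK (not_left rW lf KW eK nsl).
  have /pairedP[eK' K' _] := p.
  have := un s' ld; rewrite -(setD1K eK') -K' subUset sub1set (leaf_mem lf) KW => /(_ isT).
  by rewrite (sym_matchS _ _ _ rW nl) p orbT.
have [eK l] := leftP _ _ _ sl.
have [|||s' ld K' |K0 lab] := IH (W :\ e).
- by move: cW; rewrite (cardsD1 e) (leaf_mem lf) => -[].
- exact: rooted_leaf rW lf.
- by rewrite subsetD1 KW.
- have := un s' ld (subset_trans K' (subsetDl _ _)); apply: contraNN => m.
  by rewrite (sym_matchS _ _ _ rW nl) sl (sym_match_left rW lf sl m) m !orbT.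
split=> // f x p; have [fe|fe] := eqVneq f e.
  rewrite fe in p *; rewrite (parent_at_leaf rW lf p); apply: l.
  by rewrite mem_vertex cn_refl.
by apply: lab; apply/(parent_strip _ _ rW lf).
Qed.

(** Such a state is left over at every leaf met by the recursion, whereas paired states never
    are. *)
Lemma labels_unmatched n W s s' : rooted W -> GK s = set0 ->
  (forall e x, parent W e x -> label s x = ~~ neg e) -> ~~ sym_match n W s s'.
Proof.
move=> + K0; elim: n W => // n IH W rW lab; apply/negP => m.
have [e [a [b [nl lf]]]] : exists e a b, next_lf W e (vertex a) /\ leaf W e a b.
  by case/orP: m => /Match_leaf; apply.
have sl : Left e (vertex a) s.
  apply/leftP; rewrite K0 inE; split=> // x; rewrite mem_vertex => ax.
  rewrite -(lab e a (parent_leaf rW lf)); apply/esym/label_cn.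
  by rewrite K0.
move: m; rewrite (sym_matchS _ _ _ rW nl) => /or3P[/paired_left[]|/paired_left[_]|/and3P[_ _]].
- by rewrite sl.
- by rewrite sl.
apply/negP; apply: IH (rooted_leaf rW lf) _ => f x p.
by apply: lab; have [] := (parent_strip f x rW lf).1 p.
Qed.

Lemma parent_edgeP x e : reflect (exists a, parent live e a /\ cn set0 a x)
  (parent_edge black le dot T (vertex x) e).
Proof.
have DL : live :\ e \subset live := subsetDl _ _.
apply: (iffP and3P) => [[eL inc nc]|[a [[eL ea nad] ax]]].
  have nxd : ~~ cn (live :\ e) x dot by rewrite cn_joined.
  have nad a : cn set0 a x -> ~~ cn (live :\ e) a dot.
    move=> ax; apply: contraNN nxd; apply: cn_trans; rewrite cn_sym.
    exact: cnS (sub0set _) DL ax.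
  case/orP: inc; rewrite /GT_ends /= -cn0 => h.
    by exists (ae e); split=> //; split; auto.
  by exists (be e); split=> //; split; auto.
split=> //; first by move: ax; rewrite cn0 /incident; case: ea => -> h; rewrite h ?orbT.
apply: contraNN nad; rewrite /GT_root -[connect _ _ _]/(joined GTe (live :\ e) _ _) -cn_joined //.
by apply: cn_trans; apply: cnS (sub0set _) DL _.
Qed.

Lemma critical_label_parent e a : parent live e a ->
  critical_label black le dot T (vertex a) = ~~ neg e.
Proof.
move=> p; have [_ _ nad] := p; rewrite /critical_label.
have -> : vertex a != GT_root black le dot T.
  rewrite /GT_root -cn0; apply: contraNN nad; apply: cnS (sub0set _) _.
  exact: subsetDl.
rewrite /=; case: existsP => [[e' /andP[/parent_edgeP[a' [p' a'a]] ne']]|none].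
  by rewrite -(parent_uniq rooted_live p' p a'a) (negPf ne').
case ne: (neg e) => //; case: none; exists e; rewrite ne andbT.
by apply/parent_edgeP; exists a; rewrite cn_refl.
Qed.

Lemma GK_critical : GK (critical_enhanced black le dot T) = set0.
Proof. by apply: GK_twist; rewrite twist0. Qed.

Lemma label_critical x :
  label (critical_enhanced black le dot T) x = critical_label black le dot T (vertex x).
Proof. by rewrite /label /= ffunE. Qed.

Lemma critical_labels e x : parent live e x ->
  label (critical_enhanced black le dot T) x = ~~ neg e.
Proof. by move=> p; rewrite label_critical; apply: critical_label_parent. Qed.

Lemma labels_critical s : GK s = set0 -> label s dot = lab1 ->
  (forall e x, parent live e x -> label s x = ~~ neg e) ->
  s = critical_enhanced black le dot T.
Proof.
move=> K0 ld lab; apply: enhanced_eq => [|x]; first by rewrite K0 GK_critical.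
have lcn y z : cn set0 y z -> label s y = label s z by rewrite -K0; apply: label_cn.
rewrite label_critical; have [xd|nxd] := boolP (cn set0 x dot).
  rewrite (lcn _ _ xd) ld /critical_label /GT_root; move: xd; rewrite cn0 => ->.
  by [].
have [e [a [p ax]]] := parent_exists rooted_live (cn_live x dot) nxd.
rewrite -(lcn _ _ ax) (lab _ _ p) -(critical_label_parent p).
by move: ax; rewrite cn0 => /eqP->.
Qed.

Local Notation coefK := (@coef (CKh black le)).

Lemma coef_toggle s s' : coefK s s' != 0%R ->
  exists e, [/\ e \in A_edges black (subgraph s), subgraph s' = toggle (subgraph s) e,
    local_coef s s' e != 0%R & forall f, (f \in GK s') = (f \in GK s) (+) (f == e)].
Proof.
case/coef_nz=> e [eA s'E nz]; exists e; split=> // f; rewrite !in_set s'E in_toggle.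
by case: (f \in subgraph s); case: (f == e); case: (_ || _).
Qed.

Lemma A_edges_live s e : e \in live ->
  (e \in A_edges black (subgraph s)) = ((e \in GK s) == neg e).
Proof.
move=> eL; have := live_Hc eL; rewrite in_A_edges /neg_twist [e \in GK s]in_set => ->.
by case: (e \in subgraph s); case: (e \in T); case: (pos_edge _ _).
Qed.

Lemma coef_unit s s' e : subgraph s' = toggle (subgraph s) e ->
  e \in A_edges black (subgraph s) -> local_coef s s' e = 1%R ->
  coefK s s' \is a GRing.unit.
Proof.
move=> s'E eA one; rewrite /= (bigD1 e) //= big1 => [|f fe].
  by rewrite addr0 edge_coefE eA one mulr1 unitrX // unitrN unitr1.
rewrite edge_coefE; case: ifP => // _; rewrite /local_coef s'E.
case: eqP => [tE|_]; last by rewrite mulr0.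
have := congr1 (fun S : {set crossing L} => f \in S) tE; rewrite /= !in_toggle eqxx (negPf fe).
by case: (f \in _).
Qed.

(** For a negative twist the differential splits off v, and the term of Delta(y) with x on v and y
    on the rest has coefficient 1. For a positive twist it goes the other way, by m(1,y) = y. *)
Lemma paired_unit W e a b s s' : rooted W -> leaf W e a b ->
  GK s \subset live -> GK s' \subset live -> Paired e (vertex a) s s' ->
  coefK s s' \is a GRing.unit \/ coefK s' s \is a GRing.unit.
Proof.
move=> rW lf KL K'L /pairedP[eK K' l]; have eL := subsetP (leaf_live rW) e (leaf_mem lf).
have tog f : (f \in subgraph s') = (f \in subgraph s) (+) (f == e).
  rewrite -!twist_GK !in_twist K' in_setD1; have [->|] := eqVneq f e; rewrite ?eK /= ?addbF //.
  by case: (e \in Hc).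
have s'E : subgraph s' = toggle (subgraph s) e by apply/setP=> f; rewrite tog in_toggle.
have sE : subgraph s = toggle (subgraph s') e.
  by apply/setP=> f; rewrite in_toggle tog -addbA addbb addbF.
have eK' : e \notin GK s' by rewrite K' setD11.
have scE s1 x y : same_circle black (subgraph s1) x y = cn (GK s1) x y by rewrite cnE twist_GK.
have la' : label s' a = neg e by rewrite l mem_vertex cn_refl.
have lb' : label s' b = label s b by rewrite l (negPf (leaf_b_notin rW lf)).
have lab : label s a = label s b by apply: label_cn; apply: cn_end_mem KL (leaf_end lf) eK.
have same x : ~~ cn set0 a x -> label s' x = label s x.
  by move=> ax; rewrite l mem_vertex (negPf ax).
case ne: (neg e); [left|right].
  apply: (coef_unit s'E); first by rewrite A_edges_live // eK ne.
  rewrite /local_coef s'E eqxx !scE (cn_mem KL eK) /=.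
  rewrite ifT; last first.
    apply/forallP=> x; apply/implyP; rewrite !scE => /andP[ax bx]; apply/eqP/same.
    have h := cnS (sub0set _) KL.
    by case/orP: (leaf_end lf) => /andP[/eqP ea _]; rewrite ea; [apply: contraNN ax|apply: contraNN bx]; apply: h.
  case/orP: (leaf_end lf) => /andP[/eqP ea /eqP eb]; rewrite -ea -eb la' lb' ?lab ne;
  by case: (label s b).
apply: (coef_unit sE); first by rewrite A_edges_live // (negPf eK') ne.
rewrite /local_coef sE eqxx !scE (negPf (cn_new K'L eL eK')) /=.
rewrite ifT; last first.
  apply/forallP=> x; apply/implyP; rewrite !scE => /andP[ax bx]; apply/eqP/esym/same.
  have h := cnS (sub0set _) K'L.
  by case/orP: (leaf_end lf) => /andP[/eqP ea _]; rewrite ea; [apply: contraNN ax|apply: contraNN bx]; apply: h.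
case/orP: (leaf_end lf) => /andP[/eqP ea /eqP eb]; rewrite -ea -eb la' lb' ?lab ne;
by case: (label s b).
Qed.

Lemma sym_match_unit n W s s' : rooted W -> GK s \subset live -> GK s' \subset live ->
  sym_match n W s s' -> coefK s s' \is a GRing.unit \/ coefK s' s \is a GRing.unit.
Proof.
elim: n W => // n IH W rW KL K'L m.
have [e [a [b [nl lf]]]] : exists e a b, next_lf W e (vertex a) /\ leaf W e a b.
  by case/orP: m => /Match_leaf; apply.
move: m; rewrite (sym_matchS _ _ _ rW nl) => /or3P[p|p|/and3P[_ _]].
- exact: paired_unit rW lf KL K'L p.
- by case: (paired_unit rW lf K'L KL p); auto.
exact: IH (rooted_leaf rW lf) KL K'L.
Qed.

(* A potential which decreases along the Hasse diagram after reversal of the   *)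
(* matched edges.  At the leaf edge e, the states which are not left over form *)
(* a union of pairs, which the differential enters from the left over states   *)
(* when e is a positive twist and leaves towards them when it is negative.     *)
Fixpoint level n W s : nat :=
  if n is n'.+1 then
    if [pick p : crossing L * {set link_arc L} | next_lf W p.1 p.2] is Some p then
      if Left p.1 p.2 s then (if neg p.1 then 0 else 2 * #|crossing L|.+1) + level n' (W :\ p.1) s
      else (if neg p.1 then (2 * #|crossing L|.+1 * n').+1 else 0)
           + (if (p.1 \in GK s) == neg p.1 then 0 else #|crossing L|.+1)
           + #|A_edges black (subgraph s)|
    else 0
  else 0.

Lemma card_A_edges s : (#|A_edges black (subgraph s)| <= #|crossing L|)%N.
Proof. exact: max_card. Qed.

Lemma level_bound n W s : (level n W s <= 2 * #|crossing L|.+1 * n)%N.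
Proof.
elim: n W => //= n IH W; case: pickP => // -[e v] /= _.
have := card_A_edges s; rewrite mulnS; clear -IH.
have := IH (W :\ e); case: ifP => _; first by case: (neg e); lia.
move: (level _ _ _) => l; move: #|A_edges _ _| #|crossing L| => q m.
by case: (neg e); case: ifP => _; lia.
Qed.

Lemma levelS n W e v s : rooted W -> next_lf W e v -> level n.+1 W s =
  (if Left e v s then (if neg e then 0 else 2 * #|crossing L|.+1) + level n (W :\ e) s
   else (if neg e then (2 * #|crossing L|.+1 * n).+1 else 0)
        + (if (e \in GK s) == neg e then 0 else #|crossing L|.+1)
        + #|A_edges black (subgraph s)|)%N.
Proof.
move=> rW nl /=; case: pickP => [[e' v'] /= nl'|/(_ (e, v))]; last by rewrite nl.
by have [-> ->] := next_leaf_uniq rW nl nl'.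
Qed.

Lemma card_A_coef s s' : coefK s s' != 0%R ->
  #|A_edges black (subgraph s)| = #|A_edges black (subgraph s')|.+1.
Proof.
case/coef_nz=> e [eA -> _]; have := card_A_toggle eA.
have := cardsC (A_edges black (subgraph s)).
have := cardsC (A_edges black (toggle (subgraph s) e)); clear -s; lia.
Qed.

Section LeafDifferential.

Variables (W : {set crossing L}) (e : crossing L) (a b : link_arc L) (s s' : enhanced black).
Hypotheses (rW : rooted W) (lf : leaf W e a b).
Hypotheses (KW : GK s \subset W) (K'W : GK s' \subset W) (nz : coefK s s' != 0%R).
Local Notation v := (vertex a).

(** The toggled edge is another edge of the remaining tree, so it does not touch the leaf vertex,
    which is a circle of its own. *)
Lemma coef_keeps_vertex : e \notin GK s -> e \notin GK s' ->
  forall x, x \in v -> label s' x = label s x.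
Proof.
move=> eK eK' x xv; have [f [_ s'E lnz tog]] := coef_toggle nz.
have fe : f != e by apply: contraNneq eK' => fe; rewrite tog (negPf eK) fe eqxx.
have fW : f \in W :\ e.
  rewrite in_setD1 fe; have := tog f; rewrite eqxx addbT; case: (boolP (f \in GK s)) => fK.
    by rewrite (subsetP KW).
  by move=> fK'; rewrite (subsetP K'W).
have KW' : GK s \subset W :\ e by rewrite subsetD1 KW.
have KL := subset_trans KW (leaf_live rW).
have far y : cn (GK s) y x -> cn set0 a y.
  by rewrite -mem_vertex => /(vertex_stable rW lf KW') ->.
have [fa fb] := leaf_isolated lf fW.
move: lnz; rewrite /local_coef s'E eqxx /=; case: ifP; rewrite ?eqxx // => /forallP/(_ x).
rewrite -twist_GK -!cnE => /implyP h _; apply/eqP; apply: h; apply/andP; split.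
  by apply: contraNN fa => /far; rewrite cn_sym.
by apply: contraNN fb => /far; rewrite cn_sym.
Qed.

Lemma coef_flip : (e \in GK s') != (e \in GK s) -> (e \in GK s) = neg e.
Proof.
move=> ne; have [f [fA _ _ tog]] := coef_toggle nz.
have fe : e = f.
  by apply/eqP; move: ne; rewrite tog; case: (e \in GK s); case: (e == f).
have eL := subsetP (leaf_live rW) e (leaf_mem lf).
by move: fA; rewrite -fe A_edges_live // => /eqP.
Qed.

(* The coefficient of y (x) x in Delta(y') and that of y in m(1, y') vanish     *)
(* unless y = y'.                                                              *)
Lemma coef_flip_paired : (e \in GK s') != (e \in GK s) ->
  ~~ Left e v s -> ~~ Left e v s' -> Paired e v s s' || Paired e v s' s.
Proof.
move=> ne nl nl'; have [f [fA s'E lnz tog]] := coef_toggle nz.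
have fe : e = f.
  by apply/eqP; move: ne; rewrite tog; case: (e \in GK s); case: (e == f).
subst f; have eL := subsetP (leaf_live rW) e (leaf_mem lf).
have eN := coef_flip ne.
have KL := subset_trans KW (leaf_live rW); have K'L := subset_trans K'W (leaf_live rW).
have un x : ~~ cn (GK s) (ae e) x -> ~~ cn (GK s) (be e) x -> label s' x = label s x.
  move: lnz; rewrite /local_coef s'E eqxx /=; case: ifP; rewrite ?eqxx // => /forallP/(_ x).
  by rewrite -twist_GK -!cnE => /implyP h _ ax bx; apply/eqP; apply: h; rewrite ax.
have ends K x : (cn K (ae e) x || cn K (be e) x) = (cn K a x || cn K b x).
  by case/orP: (leaf_end lf) => /andP[/eqP-> /eqP->]; rewrite // orbC.
have {}un x : ~~ cn (GK s) a x -> ~~ cn (GK s) b x -> label s' x = label s x.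
  move=> ax bx; have : ~~ (cn (GK s) a x || cn (GK s) b x) by rewrite negb_or ax.
  by rewrite -ends negb_or => /andP[]; apply: un.
move: lnz; rewrite /local_coef s'E eqxx /=; case: ifP; rewrite ?eqxx // => _.
rewrite -twist_GK -cnE; have bv := leaf_b_notin rW lf.
have [eK|eK] := boolP (e \in GK s).
  have eK' : e \notin GK s' by rewrite tog eK eqxx.
  have K'E : GK s' = GK s :\ e.
    by apply/setP=> f; rewrite tog in_setD1; have [->|] := eqVneq f e; rewrite ?eK ?addbF.
  have ne1 : neg e by rewrite -eN.
  have la' : label s' a = true by rewrite (not_left rW lf K'W eK' nl') ne1.
  have K'W' : GK s' \subset W :\ e by rewrite subsetD1 K'W.
  have lab : label s a = label s b by apply: label_cn; apply: cn_end_mem KL (leaf_end lf) eK.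
  rewrite (cn_mem KL eK) => Dnz; have lb' : label s' b = label s b.
    move: Dnz; case/orP: (leaf_end lf) => /andP[/eqP <- /eqP <-]; rewrite la' ?lab;
    by case: (label s b); case: (label s' b).
  apply/orP; left; apply/pairedP; split=> // x; case: ifP => xv.
    rewrite ne1 -la'; apply: label_cn; apply: cnS (sub0set _) K'L _.
    by rewrite cn_sym -mem_vertex.
  have [h|h] := boolP (cn (GK s) b x); last first.
    apply: un => //; apply: contraNN h; apply: cn_trans.
    by rewrite cn_sym; apply: cn_end_mem KL (leaf_end lf) eK.
  have : cn (GK s') b x.
    have := h; rewrite (cn_end KL (leaf_end lf) eK) -K'E => /or3P[//|/andP[h1 _]|/andP[_ h1]].
      by have := vertex_stable rW lf K'W' h1; rewrite (negPf bv) mem_vertex cn_refl.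
    by have := vertex_stable rW lf K'W' h1; rewrite xv mem_vertex cn_refl.
  by move/label_cn => <-; rewrite lb'; apply: label_cn.
have eK' : e \in GK s' by rewrite tog (negPf eK) eqxx.
have KE : GK s = GK s' :\ e.
  by apply/setP=> f; rewrite in_setD1 tog; have [->|] := eqVneq f e; rewrite ?(negPf eK) ?addbF.
have ne0 : neg e = false by rewrite -eN (negPf eK).
have la : label s a = false by rewrite (not_left rW lf KW eK nl) ne0.
have KW' : GK s \subset W :\ e by rewrite subsetD1 KW.
have lab : label s' a = label s' b by apply: label_cn; apply: cn_end_mem K'L (leaf_end lf) eK'.
rewrite (negPf (cn_new KL eL eK)) => mnz; have lb' : label s' b = label s b.
  move: mnz; case/orP: (leaf_end lf) => /andP[/eqP <- /eqP <-]; rewrite la ?lab;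
  by case: (label s b); case: (label s' b).
apply/orP; right; apply/pairedP; split=> // x; case: ifP => xv.
  rewrite ne0 -la; apply: label_cn; apply: cnS (sub0set _) KL _.
  by rewrite cn_sym -mem_vertex.
have nax : ~~ cn (GK s) a x.
  by apply/negP => /(vertex_stable rW lf KW'); rewrite xv mem_vertex cn_refl.
have [h|h] := boolP (cn (GK s) b x); last by rewrite un.
rewrite -(label_cn h) -lb'; apply: label_cn; apply: cnS h => //.
by rewrite KE subsetDl.
Qed.

End LeafDifferential.

(** Left over states are compared by induction. With N crossings, a state not left over contributes
    at most 2N + 1 apart from the shift for negative twists, so the shifts in [level] put one kind
    of state wholly above the other, in the only direction in which the differential passes between
    them. Among states not left over, a step of the differential outside the matching keeps e and
    lowers the number of A-edges, while a reversed matched edge loses N + 1 and regains at most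
    N. *)
Lemma level_decr n W s s' : #|W| = n -> rooted W -> GK s \subset W -> GK s' \subset W ->
  (coefK s s' != 0%R /\ ~~ sym_match n W s s') \/ (coefK s' s != 0%R /\ sym_match n W s s') ->
  (level n W s' < level n W s)%N.
Proof.
elim: n W => [|n IH] W cW rW KW K'W step.
  case: step => [[/coef_toggle[e [_ _ _ tog]] _]|[_ //]].
  have W0 : W = set0 by apply/eqP; rewrite -cards_eq0 cW.
  move: KW K'W; rewrite W0 !subset0 => /eqP K0 /eqP K'0.
  by have := tog e; rewrite K0 K'0 inE eqxx.
have [|e [v nl]] := next_leaf_exists rW; first by rewrite -cards_eq0 cW.
have [a [b [va lf]]] := next_leafP rW nl; rewrite va in nl.
have cW' : #|W :\ e| = n by move: cW; rewrite (cardsD1 e) (leaf_mem lf) => -[].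
rewrite !(levelS _ _ rW nl).
have bound := level_bound n (W :\ e); have bs := bound s; have bs' := bound s'.
have As := card_A_edges s; have As' := card_A_edges s'.
have [sl|nsl] := boolP (Left e (vertex a) s); have [sl'|nsl'] := boolP (Left e (vertex a) s').
- have [eK _] := leftP _ _ _ sl; have [eK' _] := leftP _ _ _ sl'.
  rewrite ltn_add2l; apply: IH => //; rewrite ?subsetD1 ?KW ?K'W ?eK ?eK' //.
    exact: rooted_leaf rW lf.
  move: step; rewrite (sym_matchS _ _ _ rW nl) sl sl' /=.
  have -> : Paired e (vertex a) s s' = false.
    by apply/negP => /paired_left[]; rewrite sl.
  have -> : Paired e (vertex a) s' s = false.
    by apply/negP => /paired_left[]; rewrite sl'.
  by [].
- case: step => [[nz _]|[_]]; last first.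
    rewrite (sym_matchS _ _ _ rW nl) (negPf nsl') andbF orbF.
    by case/orP=> /paired_left[]; rewrite sl.
  have [eK l] := leftP _ _ _ sl; case ne: (neg e); last first.
    by case: ifP => _; clear -As As' bs bs'; lia.
  have eK' : e \notin GK s'.
    apply/negP => eK'; have := coef_flip rW lf nz; rewrite eK' (negPf eK) ne => /(_ isT).
    by [].
  case/leftP: nsl'; split=> // x xv.
  by rewrite (coef_keeps_vertex rW lf KW K'W nz eK eK' xv) l.
- case: step => [[nz _]|[_]]; last first.
    rewrite (sym_matchS _ _ _ rW nl) (negPf nsl) orbF.
    by case/orP=> /paired_left[]; rewrite sl'.
  have [eK' l'] := leftP _ _ _ sl'; case ne: (neg e).
    by case: ifP => _; clear -As As' bs bs'; lia.
  have eK : e \notin GK s.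
    apply/negP => eK; have := coef_flip rW lf nz; rewrite eK (negPf eK') ne => /(_ isT).
    by [].
  case/leftP: nsl; split=> // x xv.
  by rewrite -(coef_keeps_vertex rW lf KW K'W nz eK eK' xv) l'.
case: step => [[nz nm]|[nz m]].
  have := card_A_coef nz => Aeq.
  have [ee|ne] := eqVneq (e \in GK s') (e \in GK s); first by rewrite ee; clear -Aeq; lia.
  have := coef_flip_paired rW lf KW K'W nz ne nsl nsl'.
  move: nm; rewrite (sym_matchS _ _ _ rW nl) orbA => /norP[nm _].
  by rewrite (negPf nm).
have ne : (e \in GK s) != (e \in GK s').
  move: m; rewrite (sym_matchS _ _ _ rW nl) (negPf nsl) orbF.
  by case/orP=> /pairedP[eK K' _]; rewrite eK K' setD11.
have eN := coef_flip rW lf nz ne.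
have -> : ((e \in GK s) == neg e) = false by rewrite -eN; apply: negPf.
by rewrite eN eqxx; clear -As'; lia.
Qed.

End TreeOfTwistedUnknot.

(** * The spanning tree complex *)

Section SpanningTreeComplex.

Variables (L : diagram) (black : pred (side L)) (le : rel (crossing L)) (dot : link_arc L).
Hypotheses (oriented : well_oriented L) (coloured : checkerboard black).
Hypotheses (planar_L : planar L) (connected_L : connected_diagram L).
Hypothesis le_total : total_order le.
Implicit Types (T : {set crossing L}) (s : enhanced black) (r : reduced black dot).

Local Notation evs := (tait_ends_vertices coloured).
Local Notation in_sub := (in_subcomplex le).
Local Notation live := (T_live black le).
Local Notation M := (@matching L black le dot).
Local Notation coefK := (@coef (CKh_red black le dot)).

Lemma tree_of_exists s : exists T, is_tree black T && in_sub T s.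
Proof.
have [T tT iT] := exists_interval le_total evs (subgraph s)
  (spans_tait_graph oriented coloured connected_L).
by exists T; apply/andP.
Qed.

Definition tree_of s : {set crossing L} := xchoose (tree_of_exists s).

Lemma tree_ofP s : is_tree black (tree_of s).
Proof. by case/andP: (xchooseP (tree_of_exists s)). Qed.

Lemma in_tree_of s : in_sub (tree_of s) s.
Proof. by case/andP: (xchooseP (tree_of_exists s)). Qed.

Lemma tree_of_uniq s T : is_tree black T -> in_sub T s -> T = tree_of s.
Proof.
move=> tT iT; exact: (interval_uniq le_total evs tT (tree_ofP s) iT (in_tree_of s)).
Qed.

(** Each state lies in the interval of exactly one tree, so the tree quantified over in the
    definition must be that of r. *)
Lemma matchingE r r' : M r r' =
  in_sub (tree_of (val r)) (val r') &&
  sym_match le dot (tree_of (val r)) #|live (tree_of (val r))| (live (tree_of (val r))) (val r) (val r').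
Proof.
set s := val r; set s' := val r'; set T := tree_of s.
have iT : in_sub T s := in_tree_of s.
apply/existsP/andP => [[T' /andP[tT']]|[iT' m]].
  have TE : in_sub T' s -> T' = T by exact: tree_of_uniq.
  rewrite /matched_in /sym_match.
  case/orP=> /and3P[i1 i2 m]; first by rewrite -(TE i1) i2 m.
  by rewrite -(TE i2) i1 m orbT.
exists T; rewrite tree_ofP /matched_in iT iT' /=.
by case/orP: m => ->; rewrite ?orbT.
Qed.

Lemma matching_sym : symmetric M.
Proof. by move=> r r'; apply: eq_existsb => T; rewrite orbC. Qed.

Lemma matching_tree r r' : M r r' -> tree_of (val r) = tree_of (val r').
Proof. by rewrite matchingE => /andP[i _]; apply: tree_of_uniq (tree_ofP _) i. Qed.

Lemma GK_live s T : in_sub T s -> GT_subgraph le T s \subset live T.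
Proof. by rewrite in_subcomplexE. Qed.

Lemma live_rooted s : rooted black le dot (tree_of s) (live (tree_of s)).
Proof. exact: rooted_live oriented coloured planar_L connected_L _ (tree_ofP s). Qed.

Lemma matching_fun r r1 r2 : M r r1 -> M r r2 -> r1 = r2.
Proof.
rewrite !matchingE => /andP[/GK_live i1 m1] /andP[/GK_live i2 m2]; apply/val_inj.
exact: (sym_match_fun oriented coloured planar_L connected_L le_total (tree_ofP _)
  (live_rooted _) (GK_live (in_tree_of _)) i1 i2 m1 m2).
Qed.

Lemma matching_coef r r' : M r r' ->
  (coefK r r' \is a GRing.unit /\ coefK r' r = 0%R) \/
  (coefK r' r \is a GRing.unit /\ coefK r r' = 0%R).
Proof.
have asym q q' : coefK q q' \is a GRing.unit -> coefK q' q = 0%R.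
  move=> u; have nz : coefK q q' != 0%R by apply: contraTneq u => ->; rewrite unitr0.
  apply/eqP; apply: contraT => nz'.
  by have := card_A_coef nz; rewrite (card_A_coef nz'); lia.
rewrite matchingE => /andP[/GK_live i m].
have [u|u] := sym_match_unit oriented coloured planar_L connected_L le_total (tree_ofP _)
  (live_rooted _) (GK_live (in_tree_of _)) i m; [left|right]; split=> //; exact: asym.
Qed.

Lemma matching_unit r r' : M r r' -> @hasse (CKh_red black le dot) r r' ->
  coefK r r' \is a GRing.unit.
Proof. by case/matching_coef=> [[//]|[_ e]]; rewrite /hasse e eqxx. Qed.

Lemma matching_hasse r r' : M r r' ->
  @hasse (CKh_red black le dot) r r' \/ @hasse (CKh_red black le dot) r' r.
Proof.
by case/matching_coef=> -[u _]; [left|right]; rewrite /hasse;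
  apply: contraTneq u => ->; rewrite unitr0.
Qed.

(** The rank of the tree dominates, the multiplier exceeding every level. Trees are compared through
    their A-edges because the differential removes an edge from the A-edges whatever its sign. *)
Definition potential r : nat :=
  let T := tree_of (val r) in
  lex_rank le (A_edges black T) * (2 * #|crossing L|.+1 * #|crossing L|).+1
  + level le dot T #|live T| (live T) (val r).

Lemma level_lt s T : is_tree black T ->
  level le dot T #|live T| (live T) s < (2 * #|crossing L|.+1 * #|crossing L|).+1.
Proof.
move=> tT; rewrite ltnS; apply: leq_trans (level_bound _ _ _ _ _ _) _.
by rewrite leq_mul2l max_card orbT.
Qed.

Lemma potential_decr r r' : @rev_hasse (CKh_red black le dot) M r r' ->
  potential r' < potential r.
Proof.
set T := tree_of (val r); set T' := tree_of (val r').
have same : T = T' ->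
    (coefK r r' != 0%R /\ ~~ M r r') \/ (coefK r' r != 0%R /\ M r r') -> potential r' < potential r.
  move=> TT' step; rewrite /potential -/T -/T' -TT' ltn_add2l.
  have iT' : in_sub T (val r') by rewrite TT'; apply: in_tree_of.
  apply: (level_decr oriented coloured planar_L connected_L le_total (tree_ofP _) erefl
    (live_rooted _) (GK_live (in_tree_of _)) (GK_live iT')).
  by move: step; rewrite matchingE -/T iT'.
case/orP=> /andP[nz m]; last first.
  by apply: same; [apply/esym/matching_tree | right; rewrite matching_sym].
have [TT'|ne] := eqVneq T T'; first by apply: same => //; left.
have [e [eA s'E _]] := coef_nz nz.
have [|eH _ eT' agree] := interval_toggle le_total evs (tree_ofP (val r)) (tree_ofP (val r'))
    (in_tree_of (val r)) (in_tree_of (val r')) ne (e := e).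
  by move=> f fe; rewrite s'E in_toggle (negPf fe) addbF.
(* At e each tree agrees with its own subgraph, so e passes out of the A-edges of the trees as it
   does for the subgraphs; above e the trees coincide. *)
have lt : lex_lt le (A_edges black T') (A_edges black T).
  apply/lex_ltP; exists e; rewrite !in_A_edges; split.
  - by rewrite -eH; rewrite in_A_edges in eA.
  - by rewrite eT' -eH; move: eA; rewrite in_A_edges; case: (e \in _); case: (pos_edge _ _).
  - by move=> f ef fe; rewrite !in_A_edges agree.
have := lex_rank_lt le_total lt; rewrite /potential -/T -/T' => lt_rank.
set B := (2 * _ * _).+1; apply: (@leq_trans ((lex_rank le (A_edges black T')).+1 * B)).
  by rewrite mulSn addnC ltn_add2r; apply: level_lt; apply: tree_ofP.
by apply: leq_trans (leq_addr _ _); rewrite leq_mul2r lt_rank orbT.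
Qed.

Definition critical_of (t : tree black) : reduced black dot := critical black le dot (val t).

Lemma tree_of_critical (t : tree black) : tree_of (val (critical_of t)) = val t.
Proof.
apply/esym/tree_of_uniq; first exact: valP.
by rewrite in_subcomplexE GK_critical sub0set.
Qed.

Lemma critical_of_inj : injective critical_of.
Proof. by move=> t t' e; apply/val_inj; rewrite -!tree_of_critical e. Qed.

Lemma critical_unmatched r :
  (exists t, r = critical_of t) <-> (forall r', ~~ M r r').
Proof.
split=> [[t ->] r'|un].
  rewrite matchingE tree_of_critical negb_and; apply/orP; right.
  apply: (labels_unmatched oriented coloured planar_L connected_L le_total (valP t)) => //.
  - by rewrite -tree_of_critical; apply: live_rooted.
  - exact: GK_critical.
  - by move=> e x; apply: critical_labels => //; apply: valP.
set T := tree_of (val r); exists (Sub T (tree_ofP (val r))); apply/val_inj.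
have [|K0 lab] := unmatched_labels oriented coloured planar_L connected_L le_total
  (tree_ofP (val r)) erefl (live_rooted (val r)) (GK_live (in_tree_of (val r))).
  move=> s' ld K'; have ps' : label s' dot == lab1 by rewrite ld (eqP (valP r)).
  have := un (Sub s' ps'); rewrite matchingE in_subcomplexE /= K' /=.
  by [].
apply: labels_critical => //; first exact: tree_ofP.
exact: eqP (valP r).
Qed.

Theorem spanning_tree_complex :
  is_complex (CST_red black le dot) /\
  bigraded_isomorphic_homology (CST_red black le dot) (CKh_red black le dot).
Proof.
have cK := CKh_red_complex dot oriented coloured le_total.
split.
  exact: (@morse_complex (CKh_red black le dot) (CST_red black le dot) M potential critical_of
    cK matching_sym matching_fun matching_unit matching_hasse potential_decr
    critical_of_inj critical_unmatched).
exact: (@morse_homology (CKh_red black le dot) (CST_red black le dot) M potential critical_of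
    cK matching_sym matching_fun matching_unit matching_hasse potential_decr
    critical_of_inj critical_unmatched).
Qed.

End SpanningTreeComplex.

Theorem theorem1p1 (L : diagram) (hL : connected_link_diagram L)
    (dot : link_arc L)
    (black : pred (side L)) (hblack : checkerboard black)
    (le : rel (crossing L)) (hle : total_order le) :
  is_complex (CKh_red black le dot) /\
  is_complex (CST_red black le dot) /\
  bigraded_isomorphic_homology (CST_red black le dot) (CKh_red black le dot).
Proof.
have /and3P[oriented connected_L planar_L] := hL.
split; first exact: CKh_red_complex.
exact: spanning_tree_complex.
Qed.
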